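(* Let $\gamma>0$, $\zeta\ge2$ and $f\in\mathcal A_\zeta(\Omega)$. Then there does not exist a weak solution of the problem $$-\Delta u+(-\Delta)^s u=\frac{f(x)}{u^\gamma},\quad u>0\ \text{ in }\Omega,\qquad u=0\ \text{ in }\mathbb{R}^N\setminus\Omega,$$ in either of the following senses: (A) $u>0$ a.e. in $\Omega$, $u\in H_0^1(\Omega)$, and the identity $$\int_\Omega\nabla u\cdot\nabla\psi\,dx+\frac{C(N,s)}{2}\int_{\mathbb{R}^N}\int_{\mathbb{R}^N}\frac{(u(x)-u(y))(\psi(x)-\psi(y))}{|x-y|^{N+2s}}\,dx\,dy=\int_\Omega\frac{f(x)}{u^\gamma}\psi\,dx\qquad(\ast)$$ holds for every $\psi\in H_0^1(\Omega)$; (B) $u\in H^1_{loc}(\Omega)$, $u=0$ on $\partial\Omega$ in the generalized sense defined in the context, for every $\omega\Subset\Omega$ there is a constant $C(\omega)>0$ with $u\ge C(\omega)$ in $\omega$, and $(\ast)$ holds for every $\psi\in\bigcup_{\tilde\Omega\Subset\Omega}H_0^1(\tilde\Omega)$.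
   Context: $\Omega\subset\mathbb{R}^N$, $N\ge3$, is a bounded domain with $C^{1,1}$ boundary, $\delta(x)=\operatorname{dist}(x,\partial\Omega)$, and $s\in(0,1)$ is fixed. $C(N,s)=\left(\int_{\mathbb{R}^N}\frac{1-\cos(\xi_1)}{|\xi|^{N+2s}}\,d\xi\right)^{-1}$ and $(-\Delta)^su(x)=C(N,s)\,\mathrm{P.V.}\int_{\mathbb{R}^N}\frac{u(x)-u(y)}{|x-y|^{N+2s}}\,dy$. Functions are extended by zero outside their domain. $\mathcal A_\zeta(\Omega)$ is the class of functions $f:\Omega\to[0,\infty)$ with $f\asymp\delta^{-\zeta}$, i.e. $c_1\delta^{-\zeta}\le f\le c_2\delta^{-\zeta}$ in $\Omega$ for some constants $c_1,c_2>0$. Generalized boundary condition: $u\le0$ on $\partial\Omega$ means that $u=0$ in $\mathbb{R}^N\setminus\Omega$ and $(u-\epsilon)^+\in H_0^1(\Omega)$ for every $\epsilon>0$; $u=0$ on $\partial\Omega$ means $u\ge0$ and $u\le0$ on $\partial\Omega$. *)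

(* Defs.v *)
From HB Require Import structures.
From mathcomp Require Import all_boot all_order all_algebra.
From mathcomp Require Import all_classical all_reals all_analysis.
From mathcomp Require Import measurable_realfun.

Set Implicit Arguments.
Unset Strict Implicit.
Unset Printing Implicit Defensive.

Import Order.TTheory GRing.Theory Num.Theory.
Import numFieldNormedType.Exports.

Local Open Scope classical_set_scope.
Local Open Scope ring_scope.

(** * Lebesgue measure on R^n = 'rV[R]_n *)

Fact rV_display : measure_display.
Proof. exact. Qed.

Section rV_measurable.
Context {R : realType} {n : nat}.

Definition rV_coord (i : 'I_n) (x : 'rV[R]_n) : measurableTypeR R := x ord0 i.

Let rV_set0 : g_sigma_preimage rV_coord set0.
Proof. exact: sigma_algebra0. Qed.

Let rV_setC A : g_sigma_preimage rV_coord A -> g_sigma_preimage rV_coord (~` A).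
Proof. exact: sigma_algebraC. Qed.

Let rV_bigcup (F : _^nat) : (forall i, g_sigma_preimage rV_coord (F i)) ->
  g_sigma_preimage rV_coord (\bigcup_i (F i)).
Proof. exact: sigma_algebra_bigcup. Qed.

(* The product sigma-algebra, i.e. the Borel sets of R^n *)
HB.instance Definition _ := @isMeasurable.Build rV_display 'rV[R]_n
  (g_sigma_preimage rV_coord) rV_set0 rV_setC rV_bigcup.

Lemma measurable_rV_coord i : measurable_fun [set: 'rV[R]_n] (rV_coord i).
Proof.
move=> _ Y mY; rewrite setTI; apply: sub_sigma_algebra => /=.
rewrite -bigcup_seq/=; exists i => /=; first by rewrite mem_index_enum.
by exists Y => //; rewrite setTI.
Qed.

Lemma measurable_fun_rV d (T : measurableType d) (f : T -> 'rV[R]_n) :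
  (forall i, measurable_fun [set: T] (rV_coord i \o f)) ->
  measurable_fun [set: T] f.
Proof.
move=> mf; pose G := [set B : set 'rV[R]_n | measurable (f @^-1` B)].
have sG : sigma_algebra [set: 'rV[R]_n] G.
  split; rewrite /G /=.
  - by rewrite preimage_set0.
  - by move=> B mB; rewrite setTD -preimage_setC; exact: measurableC.
  - by move=> F mF; rewrite preimage_bigcup; exact: bigcupT_measurable.
have sub : g_sigma_preimage rV_coord `<=` G.
  apply: smallest_sub => // B; rewrite -bigcup_seq/= => -[i _ [A mA <-]].
  by rewrite /G /= setTI -comp_preimage -[X in measurable X]setTI; exact: mf.
by move=> _ Y mY; rewrite setTI; exact: sub.
Qed.

End rV_measurable.

Section lebesgue_rV.
Context {R : realType}.

Definition rV_cons n (p : measurableTypeR R * 'rV[R]_n) : 'rV[R]_n.+1 :=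
  \row_i if unlift ord0 i is Some j then p.2 ord0 j else p.1.

Definition rV_uncons n (x : 'rV[R]_n.+1) : measurableTypeR R * 'rV[R]_n :=
  (x ord0 ord0, \row_j x ord0 (lift ord0 j)).

Lemma rV_consK n : cancel (@rV_cons n) (@rV_uncons n).
Proof.
move=> [a y]; rewrite /rV_uncons /rV_cons; congr pair.
  by rewrite mxE unlift_none.
by apply/rowP => j; rewrite !mxE liftK.
Qed.

Lemma rV_unconsK n : cancel (@rV_uncons n) (@rV_cons n).
Proof.
move=> x; apply/rowP => i; rewrite mxE.
by case: unliftP => [j ->|->] /=; rewrite ?mxE.
Qed.

Lemma measurable_rV_cons n : measurable_fun setT (@rV_cons n).
Proof.
apply: measurable_fun_rV => i; case: (unliftP ord0 i) => [j ->|->].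
  rewrite (_ : _ \o _ = @rV_coord R n j \o snd).
    by apply: measurableT_comp; [exact: measurable_rV_coord|].
  by apply/funext => p; rewrite /rV_coord /rV_cons /= mxE liftK.
rewrite (_ : _ \o _ = fst)//.
by apply/funext => p; rewrite /rV_coord /rV_cons /= mxE unlift_none.
Qed.

Lemma measurable_rV_uncons n : measurable_fun setT (@rV_uncons n).
Proof.
apply/measurable_fun_pair.
  exact: (@measurable_rV_coord R n.+1 ord0).
apply: measurable_fun_rV => i.
rewrite (_ : _ \o _ = @rV_coord R n.+1 (lift ord0 i)).
  exact: measurable_rV_coord.
by apply/funext => x; rewrite /rV_coord /rV_uncons /= mxE.
Qed.

Section push.
Variables (n : nat) (m : {sigma_finite_measure set 'rV[R]_n -> \bar R}).

Definition rV_push : set 'rV[R]_n.+1 -> \bar R :=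
  pushforward (@lebesgue_measure R \x m)%E (@rV_cons n).

Let measurable_preimage_cons A : measurable A -> measurable (@rV_cons n @^-1` A).
Proof. by move=> mA; rewrite -[X in measurable X]setTI; exact: measurable_rV_cons. Qed.

Let rV_push0 : rV_push set0 = 0%E.
Proof. by rewrite /rV_push /pushforward preimage_set0 measure0. Qed.

Let rV_push_ge0 A : (0 <= rV_push A)%E.
Proof. exact: (measure_ge0 (@lebesgue_measure R \x m)%E). Qed.

Let rV_push_sigma_additive : semi_sigma_additive rV_push.
Proof.
move=> F mF tF mUF; rewrite /rV_push /pushforward preimage_bigcup.
apply: measure_semi_sigma_additive.
- by move=> k; exact: measurable_preimage_cons.
- apply/trivIsetP => /= i j _ _ ij; rewrite -preimage_setI.
  by move/trivIsetP : tF => /(_ _ _ _ _ ij) ->//; rewrite preimage_set0.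
- by rewrite -preimage_bigcup; exact: measurable_preimage_cons.
Qed.

HB.instance Definition _ := isMeasure.Build _ _ _ rV_push
  rV_push0 rV_push_ge0 rV_push_sigma_additive.

Let rV_push_sigma_finite : sigma_finite setT rV_push.
Proof.
have /sigma_finiteP[F [TF ndF Foo]] := sigma_finiteT (@lebesgue_measure R).
have /sigma_finiteP[G [TG ndG Goo]] := sigma_finiteT m.
exists (fun k => @rV_uncons n @^-1` (F k `*` G k)).
  rewrite -preimage_bigcup (_ : \bigcup_k _ = setT) ?preimage_setT//.
  rewrite -setXTT TF TG predeqE => -[x y]; split.
    by move=> [k _ []/= ? ?]; split; exists k.
  move=> [/= [k _ Fkx] [l _ Gly]]; exists (maxn k l) => //; split.
  - by move: x Fkx; exact/subsetPset/ndF/leq_maxl.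
  - by move: y Gly; exact/subsetPset/ndG/leq_maxr.
move=> k; have [mFk Fkoo] := Foo k; have [mGk Gkoo] := Goo k.
have mFG : measurable (F k `*` G k) by exact: measurableX.
split.
  by rewrite -[X in measurable X]setTI; exact: measurable_rV_uncons.
rewrite /rV_push /pushforward -comp_preimage.
rewrite (_ : _ \o _ = id) ?preimage_id; last first.
  by apply/funext => p /=; rewrite rV_consK.
by rewrite product_measure1E// lte_mul_pinfty// ge0_fin_numE.
Qed.

HB.instance Definition _ := Measure_isSigmaFinite.Build _ _ _ rV_push
  rV_push_sigma_finite.

End push.

(* R^0 is a point of mass 1, and the measure on R^(n+1) is the image of the
   product of the measures on R and on R^n under (a, y) |-> (a, y_1, ..., y_n). *)
Fixpoint lebesgue_rV n : {sigma_finite_measure set 'rV[R]_n -> \bar R} :=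
  match n with
  | 0%N => dirac (0 : 'rV[R]_0)
  | n'.+1 => rV_push (lebesgue_rV n')
  end.

Lemma lebesgue_rV_box n (B : 'I_n -> set (measurableTypeR R)) :
  (forall i, measurable (B i)) ->
  lebesgue_rV n [set x | forall i, B i (x ord0 i)] =
  (\big[*%E/1%E]_(i < n) lebesgue_measure (B i))%E.
Proof.
elim: n B => [|n IHn] B mB /=.
  by rewrite big_ord0 /= diracE mem_set// => -[].
have mbox : measurable [set x : 'rV[R]_n | forall i, B (lift ord0 i) (x ord0 i)].
  rewrite (_ : mkset _ = \bigcap_(i in [set: 'I_n])
      (rV_coord i @^-1` B (lift ord0 i))); last first.
    by apply/seteqP; split => x /= Bx i; [move=> _|]; exact: Bx.
  apply: fin_bigcap_measurable => // i _.
  by rewrite -[X in measurable X]setTI; exact: measurable_rV_coord.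
rewrite big_ord_recl -IHn// -product_measure1E//.
rewrite /rV_push /pushforward; congr (product_measure1 _ _ _).
apply/seteqP; split => -[a y] /=.
  by move=> Bx; split=> [|i]; [have := Bx ord0|have := Bx (lift ord0 i)];
    rewrite mxE ?unlift_none ?liftK.
by move=> [Ba By] i; rewrite mxE; case: unliftP => [j|] ->.
Qed.

End lebesgue_rV.

(** * Lebesgue measurable and Lebesgue integrable functions

   [measurable_fun] and [integrable] refer to Borel sets. A function is Lebesgue
   measurable (resp. integrable) when it agrees almost everywhere with a Borel
   one. The library integral is the lower integral of the positive part minus that
   of the negative part, so its value at such an f is the Lebesgue integral even
   when f is not Borel, see [ae_eq_lower_integral]. *)
Section completion.
Context d (T : measurableType d) (R : realType).
Implicit Types (mu : {measure set T -> \bar R}) (D : set T) (f : T -> R).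

Import HBNNSimple.

Let ge0_ae_le_integral mu (N : set T) (f g : T -> \bar R) :
  measurable N -> mu N = 0%E ->
  (forall x, 0 <= f x)%E -> (forall x, 0 <= g x)%E ->
  (forall x, ~ N x -> f x = g x) -> (\int[mu]_x f x <= \int[mu]_x g x)%E.
Proof.
move=> mN N0 f0 g0 fg; rewrite !ge0_integralTE//.
apply: ge_ereal_sup => _ [/= h hf <-].
have mNC : measurable (~` N) by exact: measurableC.
have -> : sintegral mu h = sintegral mu (proj_nnsfun h mNC).
  transitivity (\int[mu]_x (h x)%:E)%E.
    by rewrite integral_nnsfun// patch_setT.
  rewrite (@ge0_negligible_integral _ _ _ _ _ N)//; last 2 first.
  - by apply/measurable_EFinP; exact: measurable_funP.
  - by move=> x _; rewrite lee_fin; exact: fun_ge0.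
  by rewrite setTD integral_nnsfun// -mrestrict.
apply: ereal_sup_ubound; exists (proj_nnsfun h mNC) => //= x.
rewrite mindicE; have [xN|xN] := boolP (x \in ~` N).
  by rewrite mulr1 -fg ?hf//; move/set_mem : xN.
by rewrite mulr0.
Qed.

Lemma ae_eq_lower_integral mu D (f g : T -> \bar R) :
  {ae mu, forall x, D x -> f x = g x} ->
  (\int[mu]_(x in D) f x = \int[mu]_(x in D) g x)%E.
Proof.
move=> [N [mN N0 fgN]].
have E x : ~ N x -> (f \_ D) x = (g \_ D) x.
  move=> Nx; rewrite !patchE; case: ifP => // /set_mem Dx.
  by apply: contrapT => fgx; apply: Nx; apply: fgN => /(_ Dx).
rewrite integral_mkcond [RHS]integral_mkcond integralE [RHS]integralE.
by congr (_ - _)%E; apply/eqP; rewrite eq_le; apply/andP; split;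
  apply: (ge0_ae_le_integral mN N0) => // x Nx; rewrite /= ?funeposE ?funenegE E.
Qed.

Definition ae_measurable mu D f :=
  exists2 g : T -> R, measurable_fun D g & {ae mu, forall x, D x -> f x = g x}.

Definition ae_integrable mu D f :=
  exists2 g : T -> R, mu.-integrable D (EFin \o g) &
    {ae mu, forall x, D x -> f x = g x}.

Definition in_L2 mu D f :=
  ae_measurable mu D f /\ (\int[mu]_(x in D) ((f x) ^+ 2)%:E < +oo)%E.

End completion.

Section euclidean.
Context {R : realType}.

(* The norm of the normed module 'rV[R]_n is the sup norm. *)
Definition enorm n (x : 'rV[R]_n) : R := Num.sqrt (\sum_i x ord0 i ^+ 2).

Definition dotv n (x y : 'rV[R]_n) : R := \sum_i x ord0 i * y ord0 i.

Definition basisv n (i : 'I_n) : 'rV[R]_n := delta_mx ord0 i.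

Definition boundary n (A : set 'rV[R]_n) : set 'rV[R]_n := closure A `\` A°.

Definition dist_boundary n (A : set 'rV[R]_n) (x : 'rV[R]_n) : R :=
  inf [set enorm (x - y) | y in boundary A].

Definition bounded_domain n (A : set 'rV[R]_n) :=
  [/\ open A, connected A, A !=set0 & bounded_set A].

Definition C11_function n (phi : 'rV[R]_n -> R^o) :=
  (forall y, differentiable phi y) /\
  exists L : R, forall y z i,
    `|'D_(basisv i) phi y - 'D_(basisv i) phi z| <= L * enorm (y - z).

(* Near each boundary point, and in suitable orthonormal coordinates x *m Q,
   A is the strict epigraph of a C^{1,1} function of the first n coordinates. *)
Definition C11_boundary n (A : set 'rV[R]_n.+1) :=
  forall x0, boundary A x0 ->
  exists r : R, exists Q : 'M[R]_n.+1, exists phi : 'rV[R]_n -> R^o,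
  [/\ 0 < r, Q *m Q^T = 1%:M, C11_function phi &
    forall x, enorm (x - x0) < r ->
      (A x <-> phi (col' ord_max (x *m Q)) < (x *m Q) ord0 ord_max)].

Definition compactly_contained n (A B : set 'rV[R]_n) :=
  compact (closure A) /\ closure A `<=` B.

End euclidean.

(** * Sobolev spaces

   All functions are defined on the whole of R^n. *)
Section sobolev.
Context {R : realType} {n : nat}.
Implicit Types (A : set 'rV[R]_n) (u : 'rV[R]_n -> R) (G : 'rV[R]_n -> 'rV[R]_n).
Local Notation mu := (@lebesgue_rV R n).

Fixpoint Ck_function k (phi : 'rV[R]_n -> R^o) : Prop :=
  match k with
  | 0%N => continuous phi
  | k'.+1 => forall i : 'I_n, (forall x, derivable phi x (basisv i)) /\
               Ck_function k' (fun x => 'D_(basisv i) phi x)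
  end.

Definition test_function A (phi : 'rV[R]_n -> R^o) :=
  (forall k, Ck_function k phi) /\
  compactly_contained [set x | phi x != 0] A.

Definition in_L1loc A u :=
  forall K, compact K -> K `<=` A -> ae_integrable mu K u.

Definition is_weak_gradient A u G :=
  [/\ in_L1loc A u, forall i, in_L1loc A (fun x => G x ord0 i) &
    forall phi, test_function A phi -> forall i,
      \int[mu]_(x in A) (u x * 'D_(basisv i) phi x) =
      - \int[mu]_(x in A) (G x ord0 i * phi x)].

(* Some weak gradient of u on A if there is one, and 0 otherwise *)
Definition weak_gradient A u : 'rV[R]_n -> 'rV[R]_n :=
  xget (cst 0) [set G | is_weak_gradient A u G].

Definition sobolev_H1 A u :=
  in_L2 mu A u /\ exists2 G, is_weak_gradient A u G &
    forall i, in_L2 mu A (fun x => G x ord0 i).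

(* The closure of the test functions in H^1(A), extended by zero *)
Definition sobolev_H10 A u :=
  [/\ sobolev_H1 A u,
      {ae mu, forall x, ~ A x -> u x = 0} &
      forall e : R, 0 < e -> exists2 phi, test_function A phi &
        (\int[mu]_(x in A) ((u x - phi x) ^+ 2 +
           \sum_i (weak_gradient A u x ord0 i - 'D_(basisv i) phi x) ^+ 2)%:E
         < e%:E)%E].

Definition sobolev_H1loc A u :=
  exists2 G, is_weak_gradient A u G &
    forall B, open B -> compactly_contained B A ->
      in_L2 mu B u /\ forall i, in_L2 mu B (fun x => G x ord0 i).

(* u <= 0 on the boundary of A in the generalized sense *)
Definition le0_on_boundary A u :=
  {ae mu, forall x, ~ A x -> u x = 0} /\
  forall e : R, 0 < e -> sobolev_H10 A (fun x => Num.max (u x - e) 0).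

(* u is nonnegative, and u <= 0 on the boundary of A *)
Definition eq0_on_boundary A u :=
  {ae mu, forall x, 0 <= u x} /\ le0_on_boundary A u.

End sobolev.

(** * The mixed local and nonlocal problem *)
Section problem.
Context {R : realType} {n : nat}.
Local Notation point := 'rV[R]_n.+1.
Local Notation mu := (@lebesgue_rV R n.+1).
Implicit Types (Omega : set point) (f u psi : point -> R) (s gamma zeta : R).

Definition frac_const s : R :=
  (\int[mu]_xi ((1 - cos (xi ord0 ord0)) / enorm xi `^ (n.+1%:R + 2 * s)))^-1.

Definition class_A zeta Omega f :=
  (forall x, Omega x -> 0 <= f x) /\
  exists c1 c2 : R, [/\ 0 < c1, 0 < c2 & forall x, Omega x ->
    c1 * dist_boundary Omega x `^ (- zeta) <= f x
      <= c2 * dist_boundary Omega x `^ (- zeta)].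

(* The identity presupposes that its three integrals converge absolutely. *)
Definition weak_identity s gamma Omega f u psi :=
  let local_term x :=
    dotv (weak_gradient Omega u x) (weak_gradient Omega psi x) in
  let nonlocal_term (p : point * point) :=
    (u p.1 - u p.2) * (psi p.1 - psi p.2)
      / enorm (p.1 - p.2) `^ (n.+1%:R + 2 * s) in
  let source_term x := f x / u x `^ gamma * psi x in
  [/\ ae_integrable mu Omega local_term,
      ae_integrable (mu \x mu)%E setT nonlocal_term,
      ae_integrable mu Omega source_term &
      \int[mu]_(x in Omega) local_term x
        + frac_const s / 2 * \int[(mu \x mu)%E]_p nonlocal_term p
      = \int[mu]_(x in Omega) source_term x].

Definition weak_solution_A s gamma Omega f u :=
  [/\ {ae mu, forall x, Omega x -> 0 < u x}, sobolev_H10 Omega u &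
      forall psi, sobolev_H10 Omega psi -> weak_identity s gamma Omega f u psi].

Definition weak_solution_B s gamma Omega f u :=
  [/\ sobolev_H1loc Omega u, eq0_on_boundary Omega u,
      forall omega, compactly_contained omega Omega ->
        exists2 C : R, 0 < C & {ae mu, forall x, omega x -> C <= u x} &
      forall Omega', open Omega' -> compactly_contained Omega' Omega ->
        forall psi, sobolev_H10 Omega' psi -> weak_identity s gamma Omega f u psi].

End problem.

(* Main.v *)
From HB Require Import structures.
Require Import Defs.
From mathcomp Require Import all_boot all_order all_algebra.
From mathcomp Require Import all_classical all_reals all_analysis.
From mathcomp Require Import measurable_realfun.
From mathcomp Require Import ring lra.
Set Implicit Arguments.
Unset Strict Implicit.
Unset Printing Implicit Defensive.
Import Order.TTheory GRing.Theory Num.Theory.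
Import numFieldNormedType.Exports.
Local Open Scope classical_set_scope.
Local Open Scope ring_scope.

(** A solution u, in either sense, is almost everywhere equal to a nonnegative
    integrable Borel function. The equation is tested with a single smooth bump psi,
    supported in a cube Q of half-side r <= 1 inside Omega whose points lie at a distance
    at most D r from the boundary, with D independent of r.

    On the left-hand side all derivatives and differences are moved to psi. The
    Laplacian of psi is at most K r^-2 on Q and vanishes off Q. The nonlocal
    term becomes the integral of u against the symmetrised second differences of psi;
    as u >= 0 and psi vanishes off Q, only points of Q contribute positively, and
    there the second differences give at most C r^-2. So the left-hand side is at most
    C r^-2 times the integral of u over Q ([weak_identity_estimate]).

    On the right-hand side f >= c r^-2 on Q because zeta >= 2, and
    u^-gamma >= 1 - u / a for every 0 < a <= 1, so the right-hand side is at least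
    c r^-2 (m - I / a), where m and I are the integrals of psi and of u over Q
    ([source_lower_bound]). Comparison of the two sides shows that the mean of u over
    Q is bounded below by a positive constant that does not depend on Q.

    But u is small near the boundary: for every eps > 0 one has u <= eps + w with w
    in H^1_0(Omega), namely w = u in case (A) and w = (u - eps)^+ in case (B), and
    there are cubes as above, as small as desired, on which the mean of w^2 is as
    small as desired ([good_cube]). This is a contradiction ([no_solution]).

    For the last fact, a C^{1,1} domain satisfies a cone condition with some axis v at
    a boundary point ([cone_condition]). The points x of Omega near it such that
    x - tau v is not in Omega form a layer of measure at least c tau
    ([layer_measure]). For such an x the cube Q of half-side kappa tau around
    x + tau v lies in Omega, while Q - 3 tau v lies outside, where w vanishes; hence
    the integral of w^2 over Q is that of (w - w(. - 3 tau v))^2, whose integral over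
    the whole space is O(tau^2) ([translation_energy_le]). Averaging over the layer
    produces a cube on which the mean of w^2 is O(tau).

    The weak gradient in the equation is an arbitrary choice among all weak
    gradients. It is unique up to null sets ([weak_gradient_unique]), so for a test
    function it is the classical gradient. *)

(** * Borel sets and invariance of Lebesgue measure *)

Notation pushm m mf :=
  (measure_function_pushforward__canonical__measure_function_Measure m mf).

Lemma lebesgue_translate (R : realType) (c : R) (A : set (measurableTypeR R)) :
  measurable A -> lebesgue_measure ((fun x => x + c) @^-1` A) = lebesgue_measure A.
Proof.
move=> mA; have mf : measurable_fun [set: measurableTypeR R]
    ((fun x => x + c) : measurableTypeR R -> measurableTypeR R).
  by apply: measurable_funD.
apply/esym; rewrite (lebesgue_measure_unique (mu := pushm lebesgue_measure mf))//.
move=> X [[a b] /= _ <-]; rewrite /pushforward.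
rewrite (_ : _ @^-1` _ = `]a - c, b - c]%classic); last first.
  by apply/seteqP; split=> x /=; rewrite !in_itv/= ltrBlDr lerBrDr.
rewrite !lebesgue_measure_itv/= !lte_fin ltrD2r.
by case: ifP => // _; rewrite -!EFinB; congr EFin; ring.
Qed.

Lemma lebesgue_isometry1 (R : realType) (s c : R) (A : set (measurableTypeR R)) :
  s = 1 \/ s = -1 -> measurable A ->
  lebesgue_measure ((fun x => s * x + c) @^-1` A) = lebesgue_measure A.
Proof.
have mf : measurable_fun [set: measurableTypeR R]
    ((fun x => x + c) : measurableTypeR R -> measurableTypeR R).
  by apply: measurable_funD.
move=> [->|->] mA.
  under eq_fun do rewrite mul1r; exact: lebesgue_translate.
under eq_fun do rewrite mulN1r.
rewrite -(lebesgue_translate c mA) -[RHS]lebesgue_measureN//.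
by rewrite -[X in measurable X]setTI; exact: mf.
Qed.

Section rV.
Context {R : realType}.
Local Notation mu n := (@lebesgue_rV R n).
Implicit Types n : nat.

Lemma normv_le n (x : 'rV[R]_n) (e : R) :
  0 <= e -> (forall i, `|x ord0 i| <= e) -> `|x| <= e.
Proof.
move=> e0 xe; rewrite /Num.norm /= mx_normrE; apply: bigmax_le => //= -[i j] _ /=.
by rewrite (ord1 i).
Qed.

Lemma coord_le_normv n (x : 'rV[R]_n) i : `|x ord0 i| <= `|x|.
Proof.
rewrite [leRHS]/Num.norm /= mx_normrE.
exact: (le_bigmax _ (fun ij : 'I_1 * 'I_n => `|x ij.1 ij.2|) (ord0, i)).
Qed.

Lemma normv_lt n (x : 'rV[R]_n) (e : R) :
  0 < e -> (forall i, `|x ord0 i| < e) -> `|x| < e.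
Proof.
move=> e0 xe; rewrite /Num.norm /= mx_normrE; apply: bigmax_lt => //= -[i j] _ /=.
by rewrite (ord1 i).
Qed.

Lemma measurable_coord n (i : 'I_n) :
  measurable_fun [set: 'rV[R]_n] (fun x => x ord0 i : R).
Proof. exact: (measurable_rV_coord i). Qed.

Lemma measurable_rV_box n (B : 'I_n -> set R) :
  (forall i, measurable (B i)) ->
  measurable [set x : 'rV[R]_n | forall i, B i (x ord0 i)].
Proof.
move=> mB; rewrite (_ : mkset _ = \bigcap_(i in [set: 'I_n])
    ((fun x : 'rV[R]_n => x ord0 i) @^-1` B i)); last first.
  by apply/seteqP; split => x /= Bx i; [move=> _|]; exact: Bx.
apply: fin_bigcap_measurable => // i _.
by rewrite -[X in measurable X]setTI; exact: measurable_coord.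
Qed.

Lemma cubeE n (c : 'rV[R]_n) (r : R) : 0 < r ->
  [set z | `|z - c| < r] =
  [set z | forall i, `](c ord0 i - r), (c ord0 i + r)[%classic (z ord0 i)].
Proof.
move=> r0; apply/seteqP; split=> z /= H.
  move=> i; rewrite in_itv /=; have := coord_le_normv (z - c) i.
  move=> /le_lt_trans/(_ H); rewrite !mxE ltr_norml => /andP[? ?].
  by apply/andP; split; lra.
apply: normv_lt => // i; have := H i; rewrite in_itv /= !mxE ltr_norml.
by move=> /andP[? ?]; apply/andP; split; lra.
Qed.

Lemma measurable_cube n (c : 'rV[R]_n) (r : R) : measurable [set z | `|z - c| < r].
Proof.
have [r0|r0] := ltP 0 r.
  rewrite cubeE//; pose B i := `](c ord0 i - r), (c ord0 i + r)[%classic.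
  by apply: (measurable_rV_box (B := B)) => i; exact: measurable_itv.
rewrite (_ : mkset _ = set0)//; apply/seteqP; split=> // z /= H.
by have := le_lt_trans (normr_ge0 _) (lt_le_trans H r0); rewrite ltxx.
Qed.

Lemma measure_cube n (c : 'rV[R]_n) (r : R) : 0 < r ->
  mu n [set z | `|z - c| < r] = ((2 * r) ^+ n)%:E.
Proof.
move=> r0; rewrite cubeE//.
pose B i : set (measurableTypeR R) := `](c ord0 i - r), (c ord0 i + r)[%classic.
rewrite (lebesgue_rV_box (B := B)); last by move=> i; exact: measurable_itv.
rewrite (eq_bigr (fun=> (2 * r)%:E)); last first.
  move=> i _; rewrite /B lebesgue_measure_itv/= lte_fin ifT; last lra.
  by rewrite -EFinB; congr EFin; ring.
rewrite prodEFin; congr EFin; rewrite big_const_ord iter_mulr_1//.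
Qed.

(** The boxes form a countable family. Hence open sets belong to the product
    sigma-algebra, and almost everywhere statements on open sets reduce to boxes. *)
Lemma open_bigcup_box n (U : set 'rV[R]_n) : open U ->
  let B (p : 'rV[rat]_n * nat) := [set z | `|z - map_mx ratr p.1| < p.2.+1%:R^-1 :> R] in
  let C (p : 'rV[rat]_n * nat) := [set z | `|z - map_mx ratr p.1| <= p.2.+1%:R^-1 :> R] in
  U = \bigcup_(p in [set p | C p `<=` U]) B p.
Proof.
move=> oU B C; apply/seteqP; split; last first.
  move=> x [p /= CU Bx]; apply: CU; exact: ltW.
move=> x Ux; have /nbhs_ballP[e /= e0 eU] := oU _ Ux.
have [k ke] : exists k : nat, k.+1%:R^-1 < e / 2 :> R.
  have [k _ /(_ _ (leqnn k)) H] := near_infty_natSinv_lt (PosNum (divr_gt0 e0 (@ltr0Sn R 1))).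
  by exists k.
pose d : R := k.+1%:R^-1.
rewrite -/d in ke; have d0 : 0 < d by rewrite invr_gt0 ltr0n.
have H i : {q : rat | ratr q \in `](x ord0 i - d), (x ord0 i + d)[}.
  by apply/cid/rat_in_itvoo; rewrite ltrBlDr -addrA ltrDl addr_gt0.
exists (\row_i sval (H i), k) => /=.
  move=> z /= zk; apply: eU; rewrite -ball_normE /= -opprB normrN.
  apply: (le_lt_trans (ler_distD (map_mx ratr (\row_i sval (H i))) _ _)).
  rewrite [e]splitr; apply: ler_ltD; first exact: (le_trans zk (ltW ke)).
  apply: normv_lt; first by lra.
  move=> i; rewrite !mxE; case: (H i) => q /=; rewrite in_itv /= -/d.
  by move=> /andP[? ?]; rewrite ltr_norml; apply/andP; split; lra.
apply: normv_lt => // i; rewrite !mxE; case: (H i) => q /=.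
by rewrite in_itv /= -/d => /andP[? ?]; rewrite ltr_norml; apply/andP; split; lra.
Qed.

Lemma countable_box n : countable [set: 'rV[rat]_n * nat].
Proof. exact: countableP. Qed.

Lemma open_measurable_rV n (U : set 'rV[R]_n) : open U -> measurable U.
Proof.
move=> /open_bigcup_box ->; rewrite bigcup_mkcond.
apply: countable_bigcupT_measurable; first exact: countable_box.
by move=> p; case: ifP => // _; exact: measurable_cube.
Qed.

Lemma closed_measurable_rV n (U : set 'rV[R]_n) : closed U -> measurable U.
Proof.
by move=> cU; rewrite -[U]setCK; apply: measurableC; apply: open_measurable_rV; rewrite openC.
Qed.

Lemma continuous_measurable_rV n (f : 'rV[R]_n -> R) :
  continuous f -> measurable_fun setT f.
Proof.
move=> cf; apply: (measurability _ (RGenOpens.measurableE R)).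
move=> _ [_ [a [b ->] <-]]; rewrite setTI; apply: open_measurable_rV.
by apply: open_comp => [x _|]; [exact: cf|exact: interval_open].
Qed.

Lemma measurable_isometry n (s : R) (v : 'rV[R]_n) :
  measurable_fun [set: 'rV[R]_n] (fun x => s *: x + v).
Proof.
apply: measurable_fun_rV => i.
rewrite (_ : _ \o _ = (fun x : 'rV[R]_n => s * x ord0 i + v ord0 i)); last first.
  by apply/funext => x; rewrite /rV_coord /= !mxE.
apply: measurable_funD => //; apply: measurable_funM => //; exact: measurable_coord.
Qed.

(** The map acts coordinate by coordinate, so that the recursive construction of the
    measure as a product reduces the claim to the line. *)
Lemma lebesgue_rV_isometry n (s : R) (v : 'rV[R]_n) (A : set 'rV[R]_n) :
  s = 1 \/ s = -1 -> measurable A ->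
  mu n ((fun x => s *: x + v) @^-1` A) = mu n A.
Proof.
move=> hs; elim: n v A => [|n IH] v A mA.
  rewrite (_ : (fun x : 'rV[R]_0 => s *: x + v) @^-1` A = A)//.
  by apply/seteqP; split=> x /=; rewrite (_ : s *: x + v = x)//; apply/rowP => -[].
rewrite /= /rV_push /pushforward.
pose c := v ord0 ord0; pose w := \row_j v ord0 (lift ord0 j).
pose T (p : measurableTypeR R * 'rV[R]_n) : measurableTypeR R * 'rV[R]_n :=
  (s * p.1 + c, s *: p.2 + w).
have mT : measurable_fun setT T.
  apply/measurable_fun_pair.
    apply: measurable_funD => //; apply: measurable_funM => //; exact: measurable_fst.
  by apply: (measurableT_comp (measurable_isometry _ _)); exact: measurable_snd.
have mcA : measurable (@rV_cons R n @^-1` A).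
  by rewrite -[X in measurable X]setTI; exact: measurable_rV_cons.
transitivity (pushforward (@lebesgue_measure R \x mu n)%E T (@rV_cons R n @^-1` A)).
  have TE p : s *: rV_cons p + v = rV_cons (T p).
    apply/rowP => i; rewrite !mxE /=; case: unliftP => [j ->|->] /=.
      by rewrite !mxE.
    by [].
  by rewrite /pushforward; congr product_measure1; apply/seteqP; split=> p /=;
    rewrite TE.
apply/esym; apply: (@product_measure_unique _ _ _ _ _ (@lebesgue_measure R) (mu n)
  (pushm (@lebesgue_measure R \x mu n)%E mT)) => // B C mB mC.
rewrite /= /pushforward.
rewrite (_ : T @^-1` (B `*` C) =
  ((fun x => s * x + c) @^-1` B) `*` ((fun x => s *: x + w) @^-1` C))//.
have mf : measurable_fun [set: measurableTypeR R]
    ((fun x => s * x + c) : measurableTypeR R -> measurableTypeR R).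
  by apply: measurable_funD => //; apply: measurable_funM.
rewrite product_measure1E//.
- by congr (_ * _)%E; [exact: lebesgue_isometry1|exact: IH].
- by rewrite -[X in measurable X]setTI; exact: mf.
- by rewrite -[X in measurable X]setTI; exact: measurable_isometry.
Qed.

Lemma ge0_integral_isometry n (s : R) (v : 'rV[R]_n) (f : 'rV[R]_n -> \bar R) :
  s = 1 \/ s = -1 -> measurable_fun setT f -> (forall x, 0 <= f x)%E ->
  (\int[mu n]_x f (s *: x + v)%R = \int[mu n]_x f x)%E.
Proof.
move=> hs mf f0.
rewrite -[LHS](@ge0_integral_pushforward _ _ _ _ _ _ (measurable_isometry s v) (mu n) setT)//.
apply: (@eq_measure_integral _ _ _ _ (mu n)
  (pushm (mu n) (measurable_isometry s v))) => A mA _.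
exact: lebesgue_rV_isometry.
Qed.

Lemma integral_isometry n (s : R) (v : 'rV[R]_n) (f : 'rV[R]_n -> \bar R) :
  s = 1 \/ s = -1 -> measurable_fun setT f ->
  (\int[mu n]_x f (s *: x + v)%R = \int[mu n]_x f x)%E.
Proof.
move=> hs mf; rewrite integralE [RHS]integralE.
have mp := measurable_funepos mf; have mn := measurable_funeneg mf.
congr (_ - _)%E.
  rewrite -(ge0_integral_isometry v hs mp (funepos_ge0 f)).
  by apply: eq_integral => x _; rewrite !funeposE.
rewrite -(ge0_integral_isometry v hs mn (funeneg_ge0 f)).
by apply: eq_integral => x _; rewrite !funenegE.
Qed.

Lemma integrable_isometry n (s : R) (v : 'rV[R]_n) (f : 'rV[R]_n -> \bar R) :
  s = 1 \/ s = -1 -> (mu n).-integrable setT f ->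
  (mu n).-integrable setT (fun x => f (s *: x + v)).
Proof.
move=> hs /integrableP[mf foo]; apply/integrableP; split.
  exact: (measurableT_comp mf (measurable_isometry s v)).
rewrite (ge0_integral_isometry v hs (f := fun x => `|f x|%E))//.
exact: measurableT_comp.
Qed.

End rV.

(** * Smooth functions and bumps *)

Section calculus1.
Context {R : realType}.

Lemma is_derive_cvg (V W : normedModType R) (f : V -> W) (x v : V) (d : W) :
  h^-1 *: (f (h *: v + x) - f x) @[h --> (0:R)^'] --> d -> is_derive x v f d.
Proof.
move=> H; apply: DeriveDef; last by apply: cvg_lim => //; exact: norm_hausdorff.
by apply/cvg_ex; exists d.
Qed.

Lemma is_derive_cvgE (V W : normedModType R) (f : V -> W) (x v : V) (d : W) :
  is_derive x v f d -> h^-1 *: (f (h *: v + x) - f x) @[h --> (0:R)^'] --> d.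
Proof. by move=> [H <-]; exact: H. Qed.

Lemma is_derive_line (V W : normedModType R) (f : V -> W) (x v : V) (t : R) (d : W) :
  is_derive (t *: v + x) v f d <-> is_derive t 1 (fun s : R => f (s *: v + x)) d.
Proof.
split=> /is_derive_cvgE H; apply: is_derive_cvg; move: H;
  apply: cvg_trans; apply: near_eq_cvg; apply: nearW => h /=.
  by rewrite scalerDl addrA /GRing.scale /= mulr1.
by rewrite scalerDl addrA /GRing.scale /= mulr1.
Qed.

(** This provides the derivative at 0 of exp (- 1 / t) extended by zero. *)
Lemma is_derive_quadratic (f : R -> R) (x C : R) :
  (forall y, `|f y - f x| <= C * (y - x) ^+ 2) -> is_derive x 1 f 0.
Proof.
move=> H; apply: is_derive_cvg.
have C0 : 0 <= C.
  by have := le_trans (normr_ge0 _) (H (x + 1)); rewrite addrC addKr expr1n mulr1.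
apply/cvgr0Pnorm_le => e e0.
have d0 : 0 < e / (C + 1) by rewrite divr_gt0// ltr_wpDl.
near=> h.
have h0 : h != 0 by near: h; exact: nbhs_dnbhs_neq.
have he : `|h| <= e / (C + 1).
  by near: h; exact: (dnbhs0_le d0).
have := H (h *: 1 + x); rewrite /GRing.scale /= mulr1 addrK normrM normfV => Hh.
rewrite ler_pdivrMl ?normr_gt0//; apply: (le_trans Hh).
rewrite -(real_normK (num_real h)) expr2 mulrCA ler_wpM2l//.
move: he; rewrite ler_pdivlMr ?ltr_wpDl// => he.
by apply: le_trans he; rewrite mulrC ler_wpM2l// lerDl.
Unshelve. all: by end_near. Qed.

Lemma is_derive_affine1 (a b t : R) : is_derive t (1 : R) (fun s : R => a * s + b) a.
Proof.
apply: is_derive_cvg; apply: cvg_near_cst; near=> h.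
have h0 : h != 0 by near: h; exact: nbhs_dnbhs_neq.
by rewrite /GRing.scale /=; field.
Unshelve. all: by end_near. Qed.

Lemma is_derive_continuous (f : R -> R) (x d : R) :
  is_derive x 1 f d -> {for x, continuous f}.
Proof. by move=> [H _]; apply: differentiable_continuous; exact/derivable1_diffP. Qed.

Lemma mean_value (f df : R -> R) (a b : R) :
  (forall x : R, is_derive x 1 f (df x)) ->
  exists2 c, `|c - a| <= `|b - a| & f b - f a = df c * (b - a).
Proof.
move=> H.
have cf A : {within A, continuous f}.
  by apply: continuous_subspaceT => x; exact: is_derive_continuous (H x).
have [ab|ba] := leP a b.
  have [c + E] := @MVT_segment R f df a b ab (fun x _ => H x) (cf _).
  rewrite in_itv /= => /andP[ac cb]; exists c => //.
  by rewrite !ger0_norm ?subr_ge0// lerD2r.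
have [c + E] := @MVT_segment R f df b a (ltW ba) (fun x _ => H x) (cf _).
rewrite in_itv /= => /andP[ac cb]; exists c; last by rewrite -opprB E -mulrN opprB.
by rewrite -![`|_ - a|]normrN !opprB !ger0_norm ?subr_ge0// ?lerD2l ?lerN2// ltW.
Qed.

(** The functions t^-m exp (- 1 / t), extended by zero to t <= 0. Their linear
    combinations are stable under differentiation, so they are smooth. *)
Definition expinv m (t : R) : R :=
  if 0 < t then t^-1 ^+ m * expR (- t^-1) else 0.

Lemma expinv_ge0 m t : 0 <= expinv m t.
Proof.
rewrite /expinv; case: ifP => // t0.
by rewrite mulr_ge0 ?expR_ge0// exprn_ge0// invr_ge0 ltW.
Qed.

(** With y = 1 / t this is the inequality (y / m)^m <= exp y. *)
Lemma expinv_le m t : expinv m t <= m%:R ^+ m.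
Proof.
rewrite /expinv; case: ifP => [t0|_]; last by rewrite exprn_ge0.
case: m => [|m]; first by rewrite !expr0 mul1r -expR0 ler_expR oppr_le0 invr_ge0 ltW.
set y := t^-1; have y0 : 0 < y by rewrite invr_gt0.
have m0 : 0 < m.+1%:R :> R by rewrite ltr0n.
rewrite expRN ler_pdivrMr ?expR_gt0//.
have -> : y = m.+1%:R * (y / m.+1%:R) by rewrite mulrCA divff ?mulr1// gt_eqF.
rewrite expRM_natl -exprMn lerXn2r ?nnegrE ?mulr_ge0 ?divr_ge0 ?expR_ge0// ?ltW//.
rewrite ltr_pM2l//; apply: lt_le_trans (expR_ge1Dx _); by rewrite ltrDr.
Qed.

(** In view of the bound above, this shows that [expinv m] is quadratically small at
    the origin. *)
Lemma expinv_sqr m t : expinv m t = t ^+ 2 * expinv m.+2 t.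
Proof.
rewrite /expinv; case: ifP => [t0|_]; last by rewrite mulr0.
rewrite mulrA; congr (_ * _); rewrite !exprS mulrA.
have t1 : t != 0 by rewrite gt_eqF.
by field.
Qed.

Lemma is_derive_expinv m (t : R) :
  is_derive t 1 (expinv m) (expinv m.+2 t + - m%:R * expinv m.+1 t).
Proof.
have [t0|t0|->] := ltgtP t 0; last first.
- rewrite {2 3}/expinv ltxx mulr0 addr0.
  apply: (@is_derive_quadratic _ _ (m.+2%:R ^+ m.+2)) => y.
  rewrite [expinv m 0]/expinv ltxx !subr0 ger0_norm ?expinv_ge0//.
  by rewrite expinv_sqr mulrC ler_wpM2r ?sqr_ge0// expinv_le.
- apply: (@near_eq_is_derive R R^o R^o (fun s : R => s^-1 ^+ m * expR (- s^-1))).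
    near=> s; rewrite /expinv ifT//; near: s; exact: lt_nbhsr.
  have tn0 : t != 0 by rewrite gt_eqF.
  have DV : is_derive t 1 (fun s : R => s^-1) (- t ^- 2 *: 1).
    exact: is_deriveV.
  have DN : is_derive t 1 (fun s : R => - s^-1) (- (- t ^- 2 *: 1)).
    rewrite (_ : (fun s : R => - s^-1) = - (fun s : R => s^-1))//.
    exact: is_deriveN.
  have DE : is_derive t 1 (fun s : R => expR (- s^-1)) (expR (- t^-1) * - (- t ^- 2 *: 1)).
    exact: (@is_derive1_comp _ expR (fun s : R => - s^-1)).
  have DX : is_derive t 1 (fun s : R => s^-1 ^+ m) (m%:R * t^-1 ^+ m.-1 *: (- t ^- 2 *: 1)).
    rewrite (_ : (fun s : R => s^-1 ^+ m) = (fun s : R => s^-1) ^+ m).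
      exact: is_deriveX.
    by apply/funext => s; rewrite fctE.
  have DM := is_deriveM DX DE.
  apply: is_derive_eq; rewrite /expinv t0 /GRing.scale /= !mulr1.
  by case: m DX {DM} => [|m] DX; rewrite /= ?exprS ?expr0; field.
- apply: (@near_eq_is_derive R R^o R^o (cst 0)).
    near=> s; rewrite /expinv ltNge ltW//=; near: s; exact: lt_nbhsl.
  by rewrite /expinv !ltNge !ltW//= mulr0 addr0; exact: is_derive_cst.
Unshelve. all: by end_near. Qed.

End calculus1.

Section smooth.
Context {R : realType} {n : nat}.
Local Notation V := 'rV[R]_n.
Implicit Types f g phi : V -> R^o.

Definition smooth phi := forall k, Ck_function k phi.

Lemma smooth_continuous phi : smooth phi -> continuous phi.
Proof. exact: (fun H => H 0%N). Qed.

Lemma smooth_derivable phi x i : smooth phi -> derivable phi x (basisv i).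
Proof. by move=> H; have [+ _] := H 1%N i; exact. Qed.

Lemma smooth_is_derive phi x i :
  smooth phi -> is_derive x (basisv i) phi ('D_(basisv i) phi x).
Proof. by move=> H; apply/derivableP/smooth_derivable. Qed.

Lemma smooth_partial phi i : smooth phi -> smooth (fun x => 'D_(basisv i) phi x).
Proof. by move=> H k; have [_ +] := H k.+1 i; exact. Qed.

Lemma Ck_step k phi (d : 'I_n -> V -> R^o) :
  (forall i x, is_derive x (basisv i) phi (d i x)) ->
  (forall i, Ck_function k (d i)) -> Ck_function k.+1 phi.
Proof.
move=> H Hd i; split; first by move=> x; have [] := H i x.
have -> : (fun x => 'D_(basisv i) phi x) = d i; last exact: Hd.
by apply/funext => x; have [] := H i x.
Qed.

Lemma Ck_cst k (c : R) : Ck_function k (fun _ : V => c : R^o).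
Proof.
elim: k c => [|k IH] c; first by move=> x; exact: cst_continuous.
apply: (@Ck_step k _ (fun _ _ => 0)) => // i x; exact: is_derive_cst.
Qed.

Lemma Ck_add k f g : Ck_function k f -> Ck_function k g ->
  Ck_function k (fun x => f x + g x : R^o).
Proof.
elim: k f g => [|k IH] f g Hf Hg; first by move=> x; exact: (cvgD (Hf x) (Hg x)).
apply: (@Ck_step k _ (fun i x => 'D_(basisv i) f x + 'D_(basisv i) g x)) => i; last first.
  by apply: IH; [have [] := Hf i|have [] := Hg i].
by move=> x; apply: is_deriveD; apply/derivableP; [have [] := Hf i|have [] := Hg i].
Qed.

Lemma Ck_scale k (c : R) f : Ck_function k f -> Ck_function k (fun x => c * f x : R^o).
Proof.
elim: k f => [|k IH] f Hf; first by move=> x; exact: (cvgM (cvg_cst (c : R^o)) (Hf x)).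
apply: (@Ck_step k _ (fun i x => c * 'D_(basisv i) f x)) => i; last first.
  by apply: IH; have [] := Hf i.
by move=> x; apply: is_deriveZ; apply/derivableP; have [] := Hf i.
Qed.

Lemma smooth_mul f g : smooth f -> smooth g -> smooth (fun x => f x * g x : R^o).
Proof.
move=> + + k; elim: k f g => [|k IH] f g sf sg.
  by move=> x; exact: (@continuousM R _ f g x (@smooth_continuous f sf x) (@smooth_continuous g sg x)).
apply: (@Ck_step k _ (fun i x => f x * 'D_(basisv i) g x + g x * 'D_(basisv i) f x)) => i.
  move=> x; have df := smooth_is_derive x i sf; have dg := smooth_is_derive x i sg.
  exact: is_deriveM.
by apply: Ck_add; apply: IH => //; exact: smooth_partial.
Qed.

Lemma smooth_prod (I : Type) (r : seq I) (F : I -> V -> R^o) :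
  (forall i, smooth (F i)) -> smooth (fun x => \prod_(i <- r) F i x : R^o).
Proof.
move=> sF; elim: r => [|j r IH].
  rewrite (_ : (fun _ => _) = fun=> 1); first by move=> k; exact: Ck_cst.
  by apply/funext => x; rewrite big_nil.
rewrite (_ : (fun _ => _) = fun x => F j x * \prod_(i <- r) F i x).
  exact: smooth_mul.
by apply/funext => x; rewrite big_cons.
Qed.

Lemma is_derive_coord (h : R -> R) (dh : R) (a b : R) (j i : 'I_n) (x : V) :
  is_derive (a * x ord0 j + b) 1 h dh ->
  is_derive x (basisv i) (fun y : V => h (a * y ord0 j + b) : R^o)
    (if i == j then a * dh else 0).
Proof.
move=> H; rewrite -[x in is_derive x _ _]add0r -(scale0r (basisv i)).
apply/is_derive_line; case: ifPn => [/eqP ->|ij].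
  rewrite (_ : (fun s : R => _) = h \o (fun s : R => a * s + (a * x ord0 j + b))); last first.
    by apply/funext => s /=; rewrite !mxE !eqxx /= mulr1 mulrDr addrA.
  have D1 := is_derive_affine1 a (a * x ord0 j + b) 0.
  rewrite [a * dh]mulrC; apply: is_derive1_comp => //.
  by rewrite mulr0 add0r.
rewrite (_ : (fun s : R => _) = cst (h (a * x ord0 j + b))); last first.
  by apply/funext => s /=; rewrite !mxE eqxx /= eq_sym (negbTE ij) mulr0 add0r.
exact: is_derive_cst.
Qed.

Lemma smooth_expinv m (a b : R) (j : 'I_n) :
  smooth (fun x : V => expinv m (a * x ord0 j + b) : R^o).
Proof.
move=> k; elim: k m => [|k IH] m.
  move=> x; apply: (@continuous_comp _ _ _ (fun x : V => a * x ord0 j + b) (expinv m)).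
    apply: (@continuousD R R^o V (fun x : V => a * x ord0 j) (cst b)); last exact: cst_continuous.
    by apply: (@continuousM R V (cst a) (fun x : V => x ord0 j)); [exact: cst_continuous|exact: coord_continuous].
  exact: is_derive_continuous (is_derive_expinv _ _).
apply: (@Ck_step k _ (fun i x => if i == j then
   a * (expinv m.+2 (a * x ord0 j + b) + - m%:R * expinv m.+1 (a * x ord0 j + b)) else 0)).
  by move=> i x; exact: is_derive_coord (is_derive_expinv m (a * x ord0 j + b)).
move=> i; case: (i == j); last exact: Ck_cst.
by apply/Ck_scale/Ck_add; [exact: IH|apply: Ck_scale; exact: IH].
Qed.

Lemma is_derive_affine f (a : R) (b x v : V) (d : R^o) :
  is_derive (a *: x + b) v f d ->
  is_derive x v (fun y => f (a *: y + b)) (a * d : R^o).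
Proof.
move=> H; rewrite -[x in is_derive x _ _]add0r -(scale0r v); apply/is_derive_line.
have H' : is_derive (a * 0) 1 (fun s : R => f (s *: v + (a *: x + b))) d.
  have E : (a * 0) *: v + (a *: x + b) = a *: x + b.
    by rewrite mulr0 scale0r add0r.
  by apply: (proj1 (is_derive_line f (a *: x + b) v (a * 0) d)); rewrite E.
have D1 := is_derive_affine1 a 0 0.
rewrite (_ : (fun s : R => _) = (fun s : R => f (s *: v + (a *: x + b))) \o (fun s : R => a * s + 0)).
  by rewrite [a * d]mulrC; apply: is_derive1_comp => //; rewrite addr0.
by apply/funext => s /=; rewrite addr0 scalerDr scalerA addrA.
Qed.

Lemma smooth_affine f (a : R) (b : V) :
  smooth f -> smooth (fun x => f (a *: x + b)).
Proof.
move=> + k; elim: k f => [|k IH] f sf.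
  move=> x; apply: (@continuous_comp _ _ _ (fun y : V => a *: y + b) f).
    apply: (@continuousD R V V (fun y : V => a *: y) (cst b)); last exact: cst_continuous.
    exact: scaler_continuous.
  exact: smooth_continuous.
apply: (@Ck_step k _ (fun i x => a * 'D_(basisv i) f (a *: x + b))) => i.
  by move=> x; apply: is_derive_affine; exact: smooth_is_derive.
by apply: Ck_scale; apply: (IH (fun x => 'D_(basisv i) f x)); exact: smooth_partial.
Qed.

End smooth.
Arguments smooth_continuous {R n} phi _ _.

Section bump.
Context {R : realType} {n : nat}.
Local Notation V := 'rV[R]_n.
Local Notation mu := (@lebesgue_rV R n).
Implicit Types (f g phi : V -> R^o) (A K : set V).

Lemma rV_hausdorff : hausdorff_space V.
Proof. exact: norm_hausdorff. Qed.

Lemma bounded_set_normv A : bounded_set A ->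
  exists2 M : R, 0 < M & forall x, A x -> `|x| < M.
Proof.
move=> [M [Mr HM]]; exists (Num.max M 0 + 2).
  by rewrite ltr_wpDl// le_max lexx orbT.
move=> x Ax; apply: (@le_lt_trans _ _ (Num.max M 0 + 1)).
  by apply: HM => //; rewrite ltr_pwDr// le_max lexx.
by rewrite ltrD2l ltr1n.
Qed.

Lemma bounded_lebesgue_lty A : bounded_set A -> measurable A -> (mu A < +oo)%E.
Proof.
move=> /bounded_set_normv[M M0 HM] mA.
apply: (@le_lt_trans _ _ (mu [set z | `|z - 0| < M])); last by rewrite measure_cube// ltry.
apply: le_measure; rewrite ?inE//; first exact: measurable_cube.
by move=> x /HM; rewrite /= subr0.
Qed.

Lemma compact_measurable K : compact K -> measurable K.
Proof. by move=> cK; apply: closed_measurable_rV; exact: compact_closed rV_hausdorff cK. Qed.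

Lemma compact_bounded_rV K : compact K -> exists2 M : R, 0 < M & forall x, K x -> `|x| < M.
Proof. by move=> /compact_bounded/bounded_set_normv. Qed.

Lemma compact_fin_measure K : compact K -> (mu K < +oo)%E.
Proof.
by move=> cK; apply: bounded_lebesgue_lty; [exact: compact_bounded|exact: compact_measurable].
Qed.

(** A compact set off which the function vanishes is easier to produce than the closure
    of its support. *)
Lemma test_functionP A phi : test_function A phi <->
  smooth phi /\ exists K, [/\ compact K, K `<=` A & forall x, ~ K x -> phi x = 0].
Proof.
split=> [[sphi [cK KA]]|[sphi [K [cK KA phiK]]]]; split=> //.
  exists (closure [set x | phi x != 0]); split=> // x nK.
  apply: contrapT => phix; apply: nK; apply: subset_closure; exact/eqP.
have clK : closed K by exact: compact_closed rV_hausdorff cK.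
have sub : closure [set x | phi x != 0] `<=` K.
  move/closure_id : clK => ->; apply: closure_subset => x /= /eqP phix.
  by apply: contrapT => /phiK.
split; last exact: subset_trans KA.
exact: subclosed_compact (@closed_closure _ _) cK sub.
Qed.

Lemma test_function_partial A phi i : test_function A phi ->
  test_function A (fun x => 'D_(basisv i) phi x).
Proof.
move=> /test_functionP[sphi [K [cK KA phiK]]]; apply/test_functionP.
split; first exact: smooth_partial.
exists K; split=> // x nK.
have oK : open (~` K) by apply: closed_openC; exact: compact_closed rV_hausdorff cK.
rewrite (@near_eq_derive R _ _ _ (cst 0)) ?derive_cst//.
by near=> y; apply: phiK; near: y; exact: oK.
Unshelve. all: by end_near. Qed.

Lemma continuous_compact_bounded f K : continuous f -> compact K ->
  (forall x, ~ K x -> f x = 0) -> exists2 C : R, 0 < C & forall x, `|f x| <= C.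
Proof.
move=> cf cK fK.
have cfK : compact (f @` K).
  by apply: continuous_compact => //; exact: continuous_subspaceT.
have [M [Mr HM]] := compact_bounded cfK.
exists (Num.max M 0 + 1); first by rewrite ltr_wpDl// le_max lexx orbT.
move=> x; have [Kx|/fK ->] := pselect (K x); last first.
  by rewrite normr0 addr_ge0// le_max lexx orbT.
by apply: HM; [rewrite ltr_pwDr// le_max lexx|exists x].
Qed.

Lemma compact_bounded_integrable (f : V -> R) K (C : R) : measurable_fun setT f ->
  compact K -> (forall x, `|f x| <= C) -> (forall x, ~ K x -> f x = 0) ->
  mu.-integrable setT (EFin \o f).
Proof.
move=> mf cK fC fK.
have mK := compact_measurable cK.
have : mu.-integrable K (EFin \o f).
  apply: measurable_bounded_integrable => //; first exact: compact_fin_measure.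
    exact: measurable_funTS.
  exists C; split; first exact: num_real.
  by move=> M CM x _; exact: le_trans (fC x) (ltW CM).
rewrite integrable_mkcond//; apply: eq_integrable => // x _.
by rewrite patchE; case: ifPn => // /negP nK; rewrite /= fK// => Kx; apply: nK; rewrite inE.
Qed.

Lemma test_function_bounded A phi : test_function A phi ->
  exists2 C : R, 0 < C & forall x, `|phi x| <= C.
Proof.
move=> /test_functionP[sphi [K [cK _ phiK]]].
by apply: (continuous_compact_bounded _ cK phiK); exact: smooth_continuous.
Qed.

Lemma test_function_measurable A phi : test_function A phi ->
  measurable_fun setT (phi : V -> R).
Proof.
by move=> /test_functionP[sphi _]; apply: continuous_measurable_rV; exact: smooth_continuous.
Qed.

Lemma test_function_integrable A phi : test_function A phi ->
  mu.-integrable setT (EFin \o (phi : V -> R)).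
Proof.
move=> tphi; have [C C0 HC] := test_function_bounded tphi.
have mphi := test_function_measurable tphi.
move/test_functionP: tphi => [sphi [K [cK _ phiK]]].
exact: compact_bounded_integrable mphi cK HC phiK.
Qed.

Lemma test_functionM A phi f : test_function A phi -> smooth f ->
  test_function A (fun x => phi x * f x).
Proof.
move=> /test_functionP[sphi [K [cK KA phiK]]] sf; apply/test_functionP.
split; first exact: smooth_mul.
by exists K; split=> // x /phiK ->; rewrite mul0r.
Qed.

Lemma test_function_sub A B phi : A `<=` B -> test_function A phi -> test_function B phi.
Proof.
move=> AB /test_functionP[sphi [K [cK KA phiK]]]; apply/test_functionP.
by split=> //; exists K; split=> // x /KA /AB.
Qed.

Definition closed_box (a b : V) : set V :=
  [set x | forall j, `[a ord0 j, b ord0 j]%classic (x ord0 j)].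

Definition open_box (a b : V) : set V :=
  [set x | forall j, `]a ord0 j, b ord0 j[%classic (x ord0 j)].

Lemma compact_box (a b : V) : compact (closed_box a b).
Proof.
apply: (@rV_compact R n (fun j => `[a ord0 j, b ord0 j]%classic)) => j.
exact: segment_compact.
Qed.

(** As k grows, [boxbump k a b] increases to the indicator of the open box. *)
Definition boxbump (k : R) (a b : V) : V -> R^o := fun x =>
  \prod_(j < n) (expinv 0 (k * (x ord0 j - a ord0 j)) *
                 expinv 0 (k * (b ord0 j - x ord0 j))).

Lemma boxbump_smooth k a b : smooth (boxbump k a b).
Proof.
apply: smooth_prod => j; apply: smooth_mul.
  rewrite (_ : (fun x => _) = (fun x : V => expinv 0 (k * x ord0 j + - (k * a ord0 j)))).
    exact: smooth_expinv.
  by apply/funext => x; rewrite mulrBr.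
rewrite (_ : (fun x => _) = (fun x : V => expinv 0 (- k * x ord0 j + k * b ord0 j))).
  exact: smooth_expinv.
by apply/funext => x; rewrite mulrBr mulNr addrC.
Qed.

Lemma boxbump_ge0 k a b x : 0 <= boxbump k a b x.
Proof. by apply: prodr_ge0 => j _; rewrite mulr_ge0// expinv_ge0. Qed.

Lemma expinv0_le1 (t : R) : expinv 0 t <= 1.
Proof. by have := expinv_le 0 t; rewrite expr0. Qed.

Lemma boxbump_le1 k a b x : boxbump k a b x <= 1.
Proof.
apply: prodr_ile1 => j _; rewrite mulr_ge0 ?expinv_ge0//=.
by apply: mulr_ile1; rewrite ?expinv_ge0 ?expinv0_le1.
Qed.

Lemma boxbump_out k a b x : 0 < k -> ~ open_box a b x -> boxbump k a b x = 0.
Proof.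
move=> k0 nx; apply/eqP/negPn/negP => /prodf_neq0 H; apply: nx => j.
have := H j erefl; rewrite mulf_eq0 negb_or /expinv !pmulr_rgt0//.
rewrite /= in_itv /= !subr_gt0.
by case: (a ord0 j < x ord0 j); case: (x ord0 j < b ord0 j); rewrite ?eqxx//= andbF.
Qed.

Lemma boxbump_test k a b A : 0 < k -> closed_box a b `<=` A ->
  test_function A (boxbump k a b).
Proof.
move=> k0 abA; apply/test_functionP; split; first exact: boxbump_smooth.
exists (closed_box a b); split=> //; first exact: compact_box.
move=> x nx; apply: boxbump_out => // H; apply: nx => j.
by have := H j; rewrite /= !in_itv /= => /andP[/ltW -> /ltW ->].
Qed.

Lemma boxbump_cvg a b x : open_box a b x ->
  (boxbump m.+1%:R a b x : R) @[m --> \oo] --> (1:R).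
Proof.
move=> Hx.
have E (t : R) : 0 < t -> (expinv 0 (m.+1%:R * t) : R) @[m --> \oo] --> (1:R).
  move=> t0; rewrite (_ : (fun m => _) = (fun m => expR (- (t^-1 * m.+1%:R^-1)))); last first.
    apply/funext => m; rewrite /expinv mulr_gt0// ?ltr0n// expr0 mul1r.
    by rewrite invfM mulrC.
  have H : - (t^-1 * m.+1%:R^-1) @[m --> \oo] --> (0 : R).
    rewrite -oppr0; apply: cvgN; rewrite -(mulr0 t^-1); apply: cvgMl_tmp.
    exact: (@cvg_harmonic R).
  have H0 : {for (0:R), continuous (@expR R)} by exact: continuous_expR.
  by have := continuous_cvg _ H0 H; rewrite expR0; exact.
rewrite /boxbump; elim: (index_enum _) => [|j r IH].
  by under eq_fun do rewrite big_nil; exact: cvg_cst.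
under eq_fun do rewrite big_cons.
have := Hx j; rewrite /= in_itv /= => /andP[ax xb].
have E1 : 0 < x ord0 j - a ord0 j by rewrite subr_gt0.
have E2 : 0 < b ord0 j - x ord0 j by rewrite subr_gt0.
by have := cvgM (cvgM (E _ E1) (E _ E2)) IH; rewrite !mulr1; exact.
Qed.

(** A bound on second differences that survives products: the increment of [F] agrees
    with an odd function up to a quadratic error, uniformly in the base point. *)
Definition quadratic_expansion (F : V -> R) :=
  exists2 C : R, 0 < C & forall x, exists2 l : V -> R, forall z, l (- z) = - l z &
  [/\ `|F x| <= C, forall z, `|l z| <= C * `|z|,
      forall z, `|F (x + z) - F x| <= C * `|z| &
      forall z, `|F (x + z) - F x - l z| <= C * `|z| ^+ 2].

Lemma quadratic_expansionM (F G : V -> R) :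
  quadratic_expansion F -> quadratic_expansion G ->
  quadratic_expansion (fun x => F x * G x).
Proof.
move=> [C C0 HF] [D D0 HG]; exists (3 * C * D); first by rewrite !mulr_gt0.
move=> x; have [l lN [Fx lz dF qF]] := HF x; have [m mN [Gx mz dG qG]] := HG x.
have FC y : `|F y| <= C by have [? _ []] := HF y.
exists (fun z => F x * m z + G x * l z); first by move=> z; rewrite lN mN !mulrN opprD.
have CD : 0 < C * D by exact: mulr_gt0.
split.
- by rewrite normrM; apply: le_trans (ler_pM _ _ Fx Gx) _ => //; nra.
- move=> z; apply: le_trans (ler_normD _ _) _; rewrite !normrM.
  have := ler_pM (normr_ge0 _) (normr_ge0 _) Fx (mz z).
  have := ler_pM (normr_ge0 _) (normr_ge0 _) Gx (lz z).
  by have := normr_ge0 z; nra.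
- move=> z; have -> : F (x + z) * G (x + z) - F x * G x =
    F (x + z) * (G (x + z) - G x) + (F (x + z) - F x) * G x by ring.
  apply: le_trans (ler_normD _ _) _; rewrite !normrM.
  have := ler_pM (normr_ge0 _) (normr_ge0 _) (FC (x + z)) (dG z).
  have := ler_pM (normr_ge0 _) (normr_ge0 _) (dF z) Gx.
  by have := normr_ge0 z; nra.
- move=> z; have -> : F (x + z) * G (x + z) - F x * G x - (F x * m z + G x * l z) =
    F (x + z) * (G (x + z) - G x - m z) + (F (x + z) - F x) * m z +
    (F (x + z) - F x - l z) * G x by ring.
  apply: le_trans (ler_normD _ _) _; apply: le_trans (lerD (ler_normD _ _) (lexx _)) _.
  rewrite !normrM.
  have := ler_pM (normr_ge0 _) (normr_ge0 _) (FC (x + z)) (qG z).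
  have := ler_pM (normr_ge0 _) (normr_ge0 _) (dF z) (mz z).
  have := ler_pM (normr_ge0 _) (normr_ge0 _) (qF z) Gx.
  by rewrite expr2; lra.
Qed.

Lemma quadratic_expansion_cst (c : R) : quadratic_expansion (fun=> c).
Proof.
exists (`|c| + 1) => [|x]; first by rewrite ltr_wpDl.
exists (fun=> 0) => [z|]; first by rewrite oppr0.
have C0 : 0 <= `|c| + 1 by rewrite addr_ge0.
by split=> [|z|z|z]; rewrite ?subrr ?subr0 ?normr0 ?mulr_ge0// ?lerDl// exprn_ge0.
Qed.

Lemma quadratic_expansion_prod (I : Type) (r : seq I) (F : I -> V -> R) :
  (forall i, quadratic_expansion (F i)) ->
  quadratic_expansion (fun x => \prod_(i <- r) F i x).
Proof.
move=> HF; elim: r => [|j r IH].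
  by under eq_fun do rewrite big_nil; exact: quadratic_expansion_cst.
by under eq_fun do rewrite big_cons; exact: quadratic_expansionM.
Qed.

Lemma quadratic_expansion_expinv (m : nat) (a b : R) j :
  quadratic_expansion (fun x => expinv m (a * x ord0 j + b)).
Proof.
pose B k : R := k%:R ^+ k.
have B0 k : 0 <= B k by rewrite exprn_ge0.
have eB k t : `|expinv k t| <= B k by rewrite ger0_norm ?expinv_ge0// expinv_le.
pose e1 t : R := expinv m.+2 t + - m%:R * expinv m.+1 t.
pose e2 t : R := expinv m.+4 t + - m.+2%:R * expinv m.+3 t +
   - m%:R * (expinv m.+3 t + - m.+1%:R * expinv m.+2 t).
have d1 (t : R) : is_derive t 1 (expinv m) (e1 t) by exact: is_derive_expinv.
have d2 (t : R) : is_derive t 1 e1 (e2 t).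
  apply: is_deriveD; first exact: is_derive_expinv.
  by apply: is_deriveZ; exact: is_derive_expinv.
pose C1 := B m.+2 + m%:R * B m.+1.
pose C2 := B m.+4 + m.+2%:R * B m.+3 + m%:R * (B m.+3 + m.+1%:R * B m.+2).
have b1 t : `|e1 t| <= C1.
  apply: le_trans (ler_normD _ _) _; rewrite lerD// normrM normrN normr_nat.
  by rewrite ler_wpM2l.
have b2 t : `|e2 t| <= C2.
  apply: le_trans (ler_normD _ _) _; rewrite lerD//.
    apply: le_trans (ler_normD _ _) _; rewrite lerD// normrM normrN normr_nat.
    by rewrite ler_wpM2l.
  rewrite normrM normrN normr_nat ler_wpM2l//.
  apply: le_trans (ler_normD _ _) _; rewrite lerD// normrM normrN normr_nat.
  by rewrite ler_wpM2l.
have C10 : 0 <= C1 by exact: le_trans (b1 0).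
have C20 : 0 <= C2 by exact: le_trans (b2 0).
have a0 := normr_ge0 a.
exists (B m + C1 * `|a| + C2 * `|a| ^+ 2 + 1).
  by rewrite ltr_wpDl// !addr_ge0// mulr_ge0// exprn_ge0.
move=> x; set t := a * x ord0 j + b.
exists (fun z => e1 t * (a * z ord0 j)); first by move=> z; rewrite mxE !mulrN.
have tz z : a * (x + z) ord0 j + b - t = a * z ord0 j by rewrite /t mxE; ring.
have zj (z : V) : `|a * z ord0 j| <= `|a| * `|z| by rewrite normrM ler_wpM2l// coord_le_normv.
have Cm := mulr_ge0 C10 a0; have Cm2 := mulr_ge0 C20 (exprn_ge0 2 a0).
split.
- by apply: le_trans (eB _ _) _; rewrite -!addrA lerDl !addr_ge0.
- move=> z; rewrite normrM.
  apply: le_trans (ler_pM (normr_ge0 _) (normr_ge0 _) (b1 t) (zj z)) _.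
  rewrite mulrA ler_wpM2r// -!addrA addrCA lerDl !addr_ge0//.
- move=> z; have [c _ ->] := mean_value t (a * (x + z) ord0 j + b) d1.
  rewrite tz normrM; apply: le_trans (ler_pM (normr_ge0 _) (normr_ge0 _) (b1 c) (zj z)) _.
  rewrite mulrA ler_wpM2r// -!addrA addrCA lerDl !addr_ge0//.
- move=> z; have [c ct ->] := mean_value t (a * (x + z) ord0 j + b) d1.
  rewrite tz in ct *; rewrite -mulrBl normrM.
  have [c' _ ->] := mean_value t c d2.
  rewrite normrM -mulrA.
  have H1 := ler_pM (normr_ge0 _) (normr_ge0 _) (le_trans ct (zj z)) (zj z).
  have H2 := ler_pM (normr_ge0 _) (mulr_ge0 (normr_ge0 _) (normr_ge0 _)) (b2 c') H1.
  apply: (le_trans H2).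
  rewrite -expr2 exprMn mulrA ler_wpM2r ?exprn_ge0// -addrA addrC -addrA lerDl !addr_ge0//.
Qed.

Lemma boxbump_quadratic k a b : quadratic_expansion (boxbump k a b).
Proof.
apply: quadratic_expansion_prod => j; apply: quadratic_expansionM.
  rewrite (_ : (fun x => _) = (fun x : V => expinv 0 (k * x ord0 j + - (k * a ord0 j)))).
    exact: quadratic_expansion_expinv.
  by apply/funext => x; rewrite mulrBr.
rewrite (_ : (fun x => _) = (fun x : V => expinv 0 (- k * x ord0 j + k * b ord0 j))).
  exact: quadratic_expansion_expinv.
by apply/funext => x; rewrite mulrBr mulNr addrC.
Qed.

End bump.

(** * Integration by parts and uniqueness of weak gradients *)

Lemma integrable_indic_lty d (T : measurableType d) (R : realType)
    (mu : {measure set T -> \bar R}) (A : set T) :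
  measurable A -> (mu A < +oo)%E -> mu.-integrable setT (fun x => (\1_A x)%:E).
Proof.
move=> mA Aoo; apply/integrableP; split; first exact/measurable_EFinP.
rewrite (eq_integral (fun x => (\1_A x)%:E)); last first.
  by move=> t _; rewrite gee0_abs// lee_fin.
by rewrite integral_indic// setIT.
Qed.

Lemma integrable_mul_bounded d (T : measurableType d) (R : realType)
    (mu : {measure set T -> \bar R}) (D : set T) (h b : T -> R) (C : R) :
  measurable D -> mu.-integrable D (EFin \o h) -> measurable_fun D b ->
  (forall x, `|b x| <= C) -> mu.-integrable D (fun x => (h x * b x)%:E).
Proof.
move=> mD hi mb HC; under eq_fun do rewrite EFinM.
apply: (@integrableMl _ _ _ mu D mD (EFin \o h) b) => //.
exists C; split; first exact: num_real.
by move=> M CM x _; exact: le_trans (HC x) (ltW CM).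
Qed.

Section ibp.
Context {R : realType} {n : nat}.
Local Notation V := 'rV[R]_n.
Local Notation mu := (@lebesgue_rV R n).
Implicit Types (f g phi chi : V -> R^o) (A K : set V).

Lemma normv_basisv (i : 'I_n) : `|basisv i : V| <= 1.
Proof.
apply: normv_le => // j; rewrite mxE eqxx /=.
by case: (j == i); rewrite ?normr1 ?normr0.
Qed.

(** The bound is uniform in the step, and thus dominates the difference quotients. *)
Lemma translate_difference A phi i : test_function A phi ->
  exists C M : R, [/\ 0 < C, 0 < M & forall t x, `|t| <= 1 ->
    `|phi (t *: basisv i + x) - phi x| <= C * `|t| * \1_[set z : V | `|z - 0| < M] x].
Proof.
move=> tphi; have [C C0 HC] := test_function_bounded (test_function_partial i tphi).
have /test_functionP[sphi [K [cK _ phiK]]] := tphi.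
have [M M0 HM] := compact_bounded_rV cK.
exists C, (M + 1); split=> //; first by rewrite addr_gt0.
move=> t x t1; rewrite indicE; case: (boolP (x \in _)) => /= [_|]; last first.
  rewrite notin_setE /= subr0 => /negP; rewrite -leNgt => xM.
  have out y : M <= `|y| -> phi y = 0.
    by move=> My; apply: phiK => /HM; rewrite ltNge My.
  have tb : `|t *: basisv i : V| <= 1.
    by rewrite normrZ; apply: mulr_ile1 => //; exact: normv_basisv.
  have My : M <= `|t *: basisv i + x|.
    rewrite addrC; apply: le_trans (lerB_normD _ _); rewrite lerBrDr.
    by apply: le_trans xM; rewrite lerD2l.
  have Mx : M <= `|x| by apply: le_trans xM; rewrite lerDl.
  by rewrite (out _ My) (out _ Mx) subrr normr0 mulr0.
rewrite mulr1.
have dphi s : is_derive (s : R) 1 (fun s => phi (s *: basisv i + x))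
    ('D_(basisv i) phi (s *: basisv i + x)).
  by apply: (proj1 (is_derive_line phi x (basisv i) s _)); exact: smooth_is_derive.
have [c _] := mean_value 0 t dphi.
by rewrite scale0r add0r subr0 => ->; rewrite normrM ler_wpM2r.
Qed.

Lemma difference_quotient_cvg A phi i (t : R^nat) x : test_function A phi ->
  (forall m, t m != 0) -> t m @[m --> \oo] --> (0 : R) ->
  ((t m)^-1 * (phi (t m *: basisv i + x) - phi x) : R) @[m --> \oo] --> 'D_(basisv i) phi x.
Proof.
move=> [sphi _] t0 tc.
have /is_derive_cvgE H := smooth_is_derive x i sphi.
have tc' : t m @[m --> \oo] --> (0 : R)^'.
  move=> B /= [e e0 HB]; have : nbhs (0:R) (ball_ Num.Def.normr 0 e).
    by exists e.
  move=> /tc H1; suff : \forall m \near \oo, B (t m) by [].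
  have {}H1 : \forall m \near \oo, ball_ Num.Def.normr 0 e (t m) by [].
  by apply: filterS H1 => m Bm; apply: HB; [exact: Bm|exact: t0].
exact: cvg_comp tc' H.
Qed.

(** The integral of each difference quotient vanishes by translation invariance, and
    dominated convergence passes to the derivative. *)
Lemma integral_partial0 A phi i : test_function A phi ->
  (\int[mu]_x ('D_(basisv i) phi x)%:E = 0)%E.
Proof.
move=> tphi; have [C [M [C0 M0 HC]]] := translate_difference i tphi.
pose t m : R := m.+1%:R^-1.
have t0 m : 0 < t m by rewrite invr_gt0 ltr0n.
have t1 m : `|t m| <= 1 by rewrite gtr0_norm// invf_le1 ?ltr0n// ler1n.
pose q m x : R := (t m)^-1 * (phi (t m *: basisv i + x) - phi x).
have iphi := test_function_integrable tphi.
have mphi := test_function_measurable tphi.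
have q0 m : (\int[mu]_x (q m x)%:E = 0)%E.
  have H := @integral_isometry R n 1 (t m *: basisv i) (EFin \o phi) (or_introl erefl)
    (measurable_int _ iphi).
  have I1 := @integrable_isometry R n 1 (t m *: basisv i) (EFin \o phi) (or_introl erefl) iphi.
  rewrite (eq_integral (fun x : V => ((t m)^-1%R)%:E *
    ((phi (1 *: x + t m *: basisv i)%R)%:E - (phi x)%:E))%E); last first.
    by move=> x _; rewrite scale1r [x + _]addrC.
  rewrite integralZl//; last by apply: integrableB.
  rewrite integralB// H subee ?mule0//.
  exact: integrable_fin_num.
have mq m : measurable_fun setT (q m).
  apply: measurable_funM => //; apply: measurable_funB => //.
  rewrite (_ : (fun x => _) = phi \o (fun x => 1 *: x + t m *: basisv i)).
    exact: measurableT_comp mphi (measurable_isometry _ _).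
  by apply/funext => x /=; rewrite scale1r addrC.
have [|||||_ _ H] := @dominated_convergence _ _ _ mu setT measurableT
  (fun m x => (q m x)%:E) (fun x => ('D_(basisv i) phi x)%:E)
  (fun x => (C * \1_[set z : V | `|z - 0| < M] x)%:E).
- by move=> m; apply/measurable_EFinP.
- apply/measurable_EFinP; exact: test_function_measurable (test_function_partial i tphi).
- apply: aeW => x _; apply: cvg_EFin; first exact: nearW.
  apply: (@difference_quotient_cvg A phi i t x tphi); first by move=> m; rewrite gt_eqF.
  exact: (@cvg_harmonic R).
- apply: (@integrableZl _ _ _ mu setT measurableT C
    (fun x => (\1_[set z : V | `|z - 0| < M] x)%:E)).
  apply: integrable_indic_lty; first exact: measurable_cube.
  by rewrite [ltLHS](measure_cube (0 : V) M0) ltry.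
- apply: aeW => x m _; have Hx := HC (t m) x (t1 m).
  rewrite (gtr0_norm (t0 m)) in Hx.
  rewrite abse_EFin lee_fin normrM normfV (gtr0_norm (t0 m)) ler_pdivrMl; last exact: t0.
  by rewrite mulrCA mulrA.
move: H; rewrite (_ : [sequence _]_n = cst 0%E) => [H|]; last by apply/funext => m; exact: q0.
by apply: (cvg_unique _ H) => //; exact: cvg_cst.
Qed.

End ibp.

Lemma integral_out0 d (T : measurableType d) (R : realType)
    (mu : {measure set T -> \bar R}) (A : set T) (f : T -> \bar R) :
  (forall x, ~ A x -> f x = 0%E) -> (\int[mu]_(x in A) f x = \int[mu]_x f x)%E.
Proof.
move=> fA; rewrite integral_mkcond; apply: eq_integral => x _.
by rewrite patchE; case: ifPn => // /negP nA; rewrite fA// => Ax; apply: nA; rewrite inE.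
Qed.

Section weak_gradient.
Context {R : realType} {n : nat}.
Local Notation V := 'rV[R]_n.
Local Notation mu := (@lebesgue_rV R n).
Implicit Types (f g phi chi : V -> R^o) (A K : set V).

Lemma test_function_out A phi x : test_function A phi -> ~ A x -> phi x = 0.
Proof. by move=> /test_functionP[_ [K [_ KA phiK]]] nA; apply: phiK => /KA. Qed.

Lemma integration_by_parts A phi chi i :
  test_function A phi -> test_function A chi ->
  \int[mu]_(x in A) (phi x * 'D_(basisv i) chi x) =
  - \int[mu]_(x in A) ('D_(basisv i) phi x * chi x).
Proof.
move=> tphi tchi.
have [sphi _] := tphi; have [schi _] := tchi.
have t1 : test_function A (fun x => phi x * 'D_(basisv i) chi x).
  by apply: test_functionM => //; exact: smooth_partial.
have t2 : test_function A (fun x => 'D_(basisv i) phi x * chi x).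
  by apply: test_functionM => //; exact: test_function_partial.
have E f : test_function A f -> \int[mu]_(x in A) f x = \int[mu]_x f x.
  by move=> tf; congr fine; apply: integral_out0 => x /(test_function_out tf) ->.
rewrite (E _ t1) (E _ t2).
apply/eqP; rewrite -addr_eq0 -[_ + _]RintegralD//; last 2 first.
- exact: test_function_integrable t1.
- exact: test_function_integrable t2.
rewrite /Rintegral (eq_integral (fun x => ('D_(basisv i) (fun y => phi y * chi y) x)%:E)).
  by rewrite (@integral_partial0 _ _ A) ?eqxx//; exact: test_functionM.
move=> x _; congr EFin.
have d1 := smooth_is_derive x i sphi; have d2 := smooth_is_derive x i schi.
have [_ ->] := is_deriveM d1 d2.
by rewrite /GRing.scale /= [X in _ + X]mulrC.
Qed.

Lemma integrable_L1loc A (f : V -> R) :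
  mu.-integrable setT (EFin \o f) -> in_L1loc A f.
Proof.
move=> fi K cK _; exists f; last exact: aeW.
apply: (integrableS measurableT) => //.
exact: compact_measurable.
Qed.

Lemma test_function_gradient A phi : test_function A phi ->
  is_weak_gradient A phi (fun x => \row_i 'D_(basisv i) phi x).
Proof.
move=> tphi; split.
- exact/integrable_L1loc/test_function_integrable/tphi.
- move=> i; apply: integrable_L1loc.
  rewrite (_ : _ \o _ = EFin \o (fun x => 'D_(basisv i) phi x)).
    exact: test_function_integrable (test_function_partial i tphi).
  by apply/funext => x /=; rewrite mxE.
- move=> chi tchi i; rewrite integration_by_parts//; congr (- _).
  by apply: eq_Rintegral => x _; rewrite mxE.
Qed.

End weak_gradient.

Section density.
Context d (T : measurableType d) (R : realType).
Variables (mu : {measure set T -> \bar R}) (f : T -> \bar R).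
Hypotheses (mf : measurable_fun setT f) (f0 : forall x, (0 <= f x)%E).

Definition density of measurable_fun setT f & (forall x, (0 <= f x)%E) :=
  fun A => (\int[mu]_(x in A) f x)%E.

Let density0 : density mf f0 set0 = 0%E.
Proof. exact: integral_set0. Qed.

Let density_ge0 A : (0 <= density mf f0 A)%E.
Proof. by apply: integral_ge0 => x _. Qed.

Let density_sigma_additive : semi_sigma_additive (density mf f0).
Proof.
move=> F mF tF mUF; rewrite /density ge0_integral_bigcup//; last exact: measurable_funTS.
by apply: is_cvg_nneseries => k _ _; exact: density_ge0.
Qed.

HB.instance Definition _ := isMeasure.Build _ _ _ (density mf f0)
  density0 density_ge0 density_sigma_additive.

End density.

Section fundamental.
Context {R : realType} {n : nat}.
Local Notation V := 'rV[R]_n.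
Local Notation mu := (@lebesgue_rV R n).
Implicit Types (phi chi : V -> R^o) (A K : set V).

Definition open_boxes : set (set V) := [set B | exists a b, B = open_box a b].

Lemma measurable_open_box (a b : V) : measurable (open_box a b).
Proof.
pose B j := `]a ord0 j, b ord0 j[%classic.
by apply: (measurable_rV_box (B := B)) => j; exact: measurable_itv.
Qed.

Lemma open_boxI (a b c d : V) : open_box a b `&` open_box c d =
  open_box (\row_j Num.max (a ord0 j) (c ord0 j)) (\row_j Num.min (b ord0 j) (d ord0 j)).
Proof.
apply/seteqP; split=> x /=.
  move=> [H1 H2] j; have := H1 j; have := H2 j; rewrite /= !in_itv /= !mxE.
  by move=> /andP[? ?] /andP[? ?]; rewrite gt_max lt_min; apply/andP; split; apply/andP.
move=> H; split=> j; have := H j; rewrite /= !in_itv /= !mxE gt_max lt_min;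
  by move=> /andP[/andP[? ?] /andP[? ?]]; apply/andP.
Qed.

Lemma open_box_cover : \bigcup_k open_box (const_mx (- k%:R) : V) (const_mx k%:R) = setT.
Proof.
apply/seteqP; split=> // x _; have [k xk] : exists k : nat, `|x| < k%:R.
  by exists (Num.truncn `|x|).+1; exact: truncnS_gt.
exists k => // j; rewrite /= in_itv /= !mxE -ltr_norml.
exact: le_lt_trans (coord_le_normv _ _) xk.
Qed.

Lemma measurable_open_boxes :
  (@measurable rV_display 'rV[R]_n) = <<s open_boxes >>.
Proof.
apply/seteqP; split; last first.
  apply: smallest_sub; first exact: sigma_algebra_measurable.
  by move=> _ [a [b ->]]; exact: measurable_open_box.
apply: smallest_sub; first exact: smallest_sigma_algebra.
move=> B; rewrite -bigcup_seq/= => -[i _ [C mC <-]].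
pose T := g_sigma_algebraType open_boxes.
have H : measurable_fun [set: T] ((fun x : T => (x : V) ord0 i) : T -> R).
  apply: (measurability _ (RGenOpens.measurableE R)).
  move=> _ [_ [a [b ->] <-]]; rewrite setTI.
  rewrite (_ : _ @^-1` _ = \bigcup_k open_box
    (\row_j if j == i then a else - k%:R) (\row_j if j == i then b else k%:R)).
    apply: bigcupT_measurable => k; apply: sub_sigma_algebra.
    by eexists; eexists.
  apply/seteqP; split=> x /=.
    move=> xab; have [k _ xk] : (\bigcup_k open_box (const_mx (- k%:R) : V) (const_mx k%:R)) x.
      by rewrite open_box_cover.
    exists k => // j; have := xk j; rewrite /= !in_itv /= !mxE.
    by case: eqP => // ->; move: xab; rewrite /= in_itv.
  by move=> [k _ /(_ i)]; rewrite /= !mxE eqxx.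
exact: (H measurableT C mC).
Qed.

(** The positive and the negative part of [f] are densities of two measures that agree
    on the pi-system of open boxes, hence on all Borel sets. *)
Lemma open_box_separate (f : V -> R) :
  mu.-integrable setT (EFin \o f) ->
  (forall a b, \int[mu]_(x in open_box a b) (f x)%:E = 0)%E ->
  {ae mu, forall x, f x = 0}.
Proof.
move=> fi H; set F := EFin \o f in fi.
have mF : measurable_fun setT F := measurable_int _ fi.
have mp := measurable_funepos mF; have mn := measurable_funeneg mF.
have ip := integrable_funepos measurableT fi.
have in_ := integrable_funeneg measurableT fi.
have mE E : measurable E -> (\int[mu]_(x in E) F^\+ x = \int[mu]_(x in E) F^\- x)%E.
  move=> mE.
  have : density mu mp (funepos_ge0 F) E = density mu mn (funeneg_ge0 F) E; last by [].
  apply: (measure_unique open_boxes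
      (fun k => open_box (const_mx (- k%:R) : V) (const_mx k%:R))) => //.
  - exact: measurable_open_boxes.
  - by move=> _ _ [a [b ->]] [c [d ->]]; rewrite open_boxI; eexists; eexists.
  - by move=> k; eexists; eexists.
  - exact: open_box_cover.
  - move=> _ [a [b ->]]; rewrite /density /=.
    have mB := measurable_open_box a b.
    have fB : mu.-integrable (open_box a b) F by exact: integrableS fi.
    have p1 := integrable_pos_fin_num mB fB; have p2 := integrable_neg_fin_num mB fB.
    have := H a b; rewrite integralE => /eqP.
    by rewrite sube_eq ?fin_num_adde_defl// add0e => /eqP.
  - move=> k; rewrite /density /=.
    apply: integrable_lty => //; first exact: measurable_open_box.
    apply: integrableS ip => //; exact: measurable_open_box.
have : ae_eq mu setT F (cst 0%E).
  apply: integral_ae_eq => // E _ mEE.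
  rewrite integralE mE// subee ?integral0//.
  by rewrite integrable_neg_fin_num//; exact: integrableS fi.
by apply: filterS => x /(_ I) [].
Qed.

Lemma ae_open_boxes A (P : V -> Prop) : open A ->
  (forall a b, closed_box a b `<=` A -> {ae mu, forall x, open_box a b x -> P x}) ->
  {ae mu, forall x, A x -> P x}.
Proof.
move=> oA H.
pose a (p : 'rV[rat]_n * nat) : V := map_mx ratr p.1 - const_mx p.2.+1%:R^-1.
pose b (p : 'rV[rat]_n * nat) : V := map_mx ratr p.1 + const_mx p.2.+1%:R^-1.
pose N p := [set x | closed_box (a p) (b p) `<=` A /\ open_box (a p) (b p) x /\ ~ P x].
have NN p : mu.-negligible (N p).
  have [cA|ncA] := pselect (closed_box (a p) (b p) `<=` A).
    apply: negligibleS (H _ _ cA) => x /= [_ [bx nP]] bP; exact: nP (bP bx).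
  rewrite (_ : N p = set0); first exact: (@negligible_set0 _ _ _ mu).
  by apply/seteqP; split=> // x [].
pose F k := if @unpickle ('rV[rat]_n * nat)%type k is Some p then N p else set0.
have NF k : mu.-negligible (F k).
  by rewrite /F; case: unpickle => [p|]; [exact: NN|exact: negligible_set0].
apply: negligibleS (negligible_bigcup NF).
move=> x /= /not_implyP[Ax nPx].
move: (Ax); rewrite {1}(open_bigcup_box oA) => -[p /= pA px].
exists (pickle p) => //; rewrite /F pickleK; split; last split=> //.
  move=> y yp; apply: pA => /=; apply: normv_le; first by rewrite invr_ge0.
  move=> j; have := yp j; rewrite /= in_itv /= !mxE ler_norml => /andP[? ?].
  by rewrite lerBrDr lerBlDl [_ + ratr _]addrC; apply/andP.
move=> j; rewrite /= in_itv /= !mxE; have := coord_le_normv (x - map_mx ratr p.1) j.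
move=> /le_lt_trans/(_ px); rewrite ltr_norml !mxE ltrBrDr ltrBlDl [_ + ratr _]addrC => /andP[? ?].
exact/andP.
Qed.

(** Test functions increase to the indicator of any open box inside [A], so that [g]
    has zero integral over all of them. *)
Lemma fundamental_lemma A (g : V -> R) : open A -> in_L1loc A g ->
  (forall chi, test_function A chi -> \int[mu]_(x in A) (g x * chi x) = 0) ->
  {ae mu, forall x, A x -> g x = 0}.
Proof.
move=> oA gL1 H; apply: ae_open_boxes => // a b abA.
have mB := measurable_open_box a b.
have BK : open_box a b `<=` closed_box a b.
  by move=> x Hx j; have := Hx j; rewrite /= !in_itv /= => /andP[/ltW -> /ltW ->].
have [f fi fg] := gL1 _ (@compact_box R n a b) abA.
have mK : measurable (closed_box a b) := compact_measurable (@compact_box R n a b).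
pose h := f \_ (open_box a b).
have fi' : mu.-integrable (open_box a b) (EFin \o f) by exact: integrableS fi.
have hi : mu.-integrable setT (EFin \o h).
  by rewrite -restrict_EFin; exact: (proj1 (integrable_mkcond _ mB) fi').
suff : {ae mu, forall x, h x = 0}.
  apply: filterS2 fg => x fgx hx Bx; rewrite fgx; last exact: BK.
  by move: hx; rewrite /h patchE mem_set.
apply: open_box_separate => // c d.
have mE : measurable (open_box c d) by exact: measurable_open_box.
set a' : V := \row_j Num.max (a ord0 j) (c ord0 j).
set b' : V := \row_j Num.min (b ord0 j) (d ord0 j).
have sub : closed_box a' b' `<=` closed_box a b.
  move=> x Hx j; have := Hx j; rewrite /= !in_itv /= !mxE ge_max le_min.
  by move=> /andP[/andP[-> _] /andP[-> _]].
have sub2 : open_box a' b' `<=` open_box a b.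
  by rewrite -open_boxI; exact: subIsetl.
have Hm m : (\int[mu]_x (h x * boxbump m.+1%:R a' b' x)%:E = 0)%E.
  have m0 : 0 < m.+1%:R :> R by rewrite ltr0n.
  have tA : test_function A (boxbump m.+1%:R a' b').
    by apply: boxbump_test => //; exact: subset_trans sub abA.
  have [C C0 HC] := test_function_bounded tA.
  have out x : ~ A x -> (h x * boxbump m.+1%:R a' b' x)%:E = 0%E.
    by move=> nA; rewrite (test_function_out tA nA) mulr0.
  have gh : {ae mu, forall x, A x -> (g x * boxbump m.+1%:R a' b' x)%:E =
      (h x * boxbump m.+1%:R a' b' x)%:E}.
    apply: filterS fg => x fgx _.
    have [bx|nbx] := pselect (open_box a' b' x); last first.
      by rewrite (boxbump_out m0 nbx) !mulr0.
    by have abx := sub2 _ bx; rewrite /h patchE mem_set// fgx//; exact: BK.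
  have := H _ tA; rewrite /Rintegral (ae_eq_lower_integral gh) (integral_out0 mu out) => Hf.
  rewrite -[LHS]fineK ?Hf//; apply: integrable_fin_num => //.
  exact: integrable_mul_bounded hi (test_function_measurable tA) HC.
have E1 : (\int[mu]_(x in open_box c d) (h x)%:E =
           \int[mu]_x (h x * \1_(open_box a' b') x)%:E)%E.
  rewrite integral_mkcond; apply: eq_integral => x _; rewrite patchE indicE.
  rewrite -open_boxI in_setI /h patchE.
  by case: (x \in open_box c d); case: (x \in open_box a b); rewrite ?mulr1 ?mulr0 ?mul0r.
rewrite E1.
have [|||||_ _ Hc] := @dominated_convergence _ _ _ mu setT measurableT
  (fun m x => (h x * boxbump m.+1%:R a' b' x)%:E)
  (fun x => (h x * \1_(open_box a' b') x)%:E) (fun x => `|(h x)%:E|%E).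
- move=> m; apply/measurable_EFinP; apply: measurable_funM.
    by apply/measurable_EFinP; exact: measurable_int hi.
  by apply: continuous_measurable_rV; apply: smooth_continuous; exact: boxbump_smooth.
- apply/measurable_EFinP; apply: measurable_funM.
    by apply/measurable_EFinP; exact: measurable_int hi.
  by apply: measurable_indic; exact: measurable_open_box.
- apply: aeW => x _; apply: cvg_EFin; first exact: nearW.
  apply: (@cvgMl_tmp R); rewrite indicE; have [bx|nbx] := pselect (open_box a' b' x).
    by rewrite mem_set//; exact: boxbump_cvg.
  rewrite memNset// (_ : (fun _ => _) = cst 0); first exact: cvg_cst.
  by apply/funext => m; rewrite boxbump_out// ltr0n.
- exact: integrable_abse.
- apply: aeW => x m _; rewrite lee_fin normrM ler_piMr//.
  by rewrite ger0_norm ?boxbump_ge0 ?boxbump_le1.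
move: Hc; rewrite (_ : [sequence _]_n = cst 0%E) => [Hc|]; last by apply/funext => m; exact: Hm.
by apply: (cvg_unique _ Hc) => //; exact: cvg_cst.
Qed.

End fundamental.

Section ae_integral.
Context d (T : measurableType d) (R : realType) (mu : {measure set T -> \bar R}).
Implicit Types (D : set T) (f g : T -> R).

Lemma ae_eq_Rintegral D f g : {ae mu, forall x, D x -> f x = g x} ->
  \int[mu]_(x in D) f x = \int[mu]_(x in D) g x.
Proof.
move=> fg; congr fine; apply: ae_eq_lower_integral.
by apply: filterS fg => x fgx /fgx ->.
Qed.

Lemma ae_integrableD D f g : measurable D ->
  ae_integrable mu D f -> ae_integrable mu D g ->
  ae_integrable mu D (fun x => f x + g x) /\
  \int[mu]_(x in D) (f x + g x) = \int[mu]_(x in D) f x + \int[mu]_(x in D) g x.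
Proof.
move=> mD [f' fi ff'] [g' gi gg'].
have H : {ae mu, forall x, D x -> f x + g x = f' x + g' x}.
  by apply: filterS2 ff' gg' => x e1 e2 Dx; rewrite e1// e2.
split.
  exists (fun x => f' x + g' x) => //.
  by rewrite (_ : _ \o _ = (EFin \o f') \+ (EFin \o g'))//; exact: integrableD.
by rewrite (ae_eq_Rintegral H) (ae_eq_Rintegral ff') (ae_eq_Rintegral gg') RintegralD.
Qed.

Lemma ae_integrableZ D f (c : R) : measurable D -> ae_integrable mu D f ->
  ae_integrable mu D (fun x => c * f x) /\
  \int[mu]_(x in D) (c * f x) = c * \int[mu]_(x in D) f x.
Proof.
move=> mD [f' fi ff'].
have H : {ae mu, forall x, D x -> c * f x = c * f' x}.
  by apply: filterS ff' => x e1 Dx; rewrite e1.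
split; last by rewrite (ae_eq_Rintegral H) (ae_eq_Rintegral ff') RintegralZl.
exists (fun x => c * f' x) => //.
exact: (@integrableZl _ _ _ mu D mD c (EFin \o f')).
Qed.

Lemma ae_integrable_sum (I : Type) (r : seq I) D (F : I -> T -> R) : measurable D ->
  (forall i, ae_integrable mu D (F i)) ->
  ae_integrable mu D (fun x => \sum_(i <- r) F i x) /\
  \int[mu]_(x in D) (\sum_(i <- r) F i x) = \sum_(i <- r) \int[mu]_(x in D) F i x.
Proof.
move=> mD HF; elim: r => [|i r [IH1 IH2]].
  rewrite big_nil; under eq_fun do rewrite big_nil; split.
    by exists (cst 0); [exact: integrable0|exact: aeW].
  by rewrite Rintegral_cst// mul0r.
have [H1 H2] := ae_integrableD mD (HF i) IH1.
under eq_fun do rewrite big_cons.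
by rewrite big_cons H2 IH2.
Qed.

End ae_integral.

Section uniqueness.
Context {R : realType} {n : nat}.
Local Notation V := 'rV[R]_n.
Local Notation mu := (@lebesgue_rV R n).
Implicit Types (u : V -> R) (G : V -> V) (phi chi psi : V -> R^o) (A K : set V).

Lemma L1loc_mul A u chi : open A -> in_L1loc A u -> test_function A chi ->
  ae_integrable mu A (fun x => u x * chi x).
Proof.
move=> oA uL1 tchi; have [C C0 HC] := test_function_bounded tchi.
have mchi := test_function_measurable tchi.
have /test_functionP[schi [K [cK KA chiK]]] := tchi.
have [f fi fu] := uL1 K cK KA.
have mK := compact_measurable cK.
have mA := open_measurable_rV oA.
have fi' := proj1 (integrable_mkcond _ mK) fi; rewrite restrict_EFin in fi'.
exists (fun x => (f \_ K) x * chi x).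
  have H := integrable_mul_bounded measurableT fi' mchi HC.
  exact: integrableS H.
apply: filterS fu => x fux Ax; rewrite patchE; case: ifPn => [/set_mem Kx|/negP nK].
  by rewrite fux.
by rewrite chiK ?mulr0// => Kx; apply: nK; rewrite inE.
Qed.

Lemma L1locB A u v : in_L1loc A u -> in_L1loc A v -> in_L1loc A (fun x => u x - v x).
Proof.
move=> Hu Hv K cK KA.
have mK := compact_measurable cK.
have [+ _] := ae_integrableD mK (Hu K cK KA) (proj1 (ae_integrableZ (-1) mK (Hv K cK KA))).
by under eq_fun do rewrite mulN1r.
Qed.

Lemma weak_gradient_unique A u G G' : open A ->
  is_weak_gradient A u G -> is_weak_gradient A u G' ->
  forall i, {ae mu, forall x, A x -> G x ord0 i = G' x ord0 i}.
Proof.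
move=> oA [_ GL1 HG] [_ GL1' HG'] i; have mA := open_measurable_rV oA.
suff : {ae mu, forall x, A x -> G x ord0 i - G' x ord0 i = 0}.
  by apply: filterS => x H /H /eqP; rewrite subr_eq0 => /eqP.
apply: fundamental_lemma => //; first exact: L1locB.
move=> chi tchi.
have i1 := L1loc_mul oA (GL1 i) tchi; have i2 := L1loc_mul oA (GL1' i) tchi.
have [i3 E3] := ae_integrableZ (-1) mA i2.
have [_ E] := ae_integrableD mA i1 i3.
transitivity (\int[mu]_(x in A) (G x ord0 i * chi x + -1 * (G' x ord0 i * chi x))).
  by apply: eq_Rintegral => x _; rewrite mulrBl mulN1r.
rewrite E E3 mulN1r; apply/eqP; rewrite subr_eq0 -eqr_opp.
by apply/eqP; rewrite -HG// -HG'.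
Qed.

Lemma weak_gradientP A u G : is_weak_gradient A u G ->
  is_weak_gradient A u (weak_gradient A u).
Proof. by move=> HG; apply: (@xgetPex _ (cst 0) [set G | is_weak_gradient A u G]); exists G. Qed.

Lemma weak_gradient_test A phi i : open A -> test_function A phi ->
  {ae mu, forall x, A x -> weak_gradient A phi x ord0 i = 'D_(basisv i) phi x}.
Proof.
move=> oA tphi; have H := test_function_gradient tphi.
apply: filterS (weak_gradient_unique oA (weak_gradientP H) H i) => x E /E ->.
by rewrite mxE.
Qed.

Lemma test_function_L2 A B phi : test_function A phi -> measurable B -> in_L2 mu B phi.
Proof.
move=> tphi mB; have mphi := test_function_measurable tphi; split.
  by exists phi; [exact: measurable_funTS|exact: aeW].
have [sphi _] := tphi; have H := test_function_integrable (test_functionM tphi sphi).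
have {}H : mu.-integrable B (EFin \o (fun x => phi x * phi x)) by exact: integrableS H.
under eq_integral do rewrite expr2.
exact: integrable_lty.
Qed.

Lemma ae_all_ord (P : V -> 'I_n -> Prop) :
  (forall i, {ae mu, forall x, P x i}) -> {ae mu, forall x, forall i, P x i}.
Proof.
move=> H.
suff : {ae mu, forall x, forall i, i \in enum 'I_n -> P x i}.
  by apply: filterS => x Hx i; apply: Hx; rewrite mem_enum.
elim: (enum 'I_n) => [|j r IH]; first exact: aeW.
apply: filterS2 IH (H j) => x Hx Pj i; rewrite inE => /orP[/eqP ->//|]; exact: Hx.
Qed.

Lemma test_function_H10 A phi : open A -> test_function A phi -> sobolev_H10 A phi.
Proof.
move=> oA tphi; have mA := open_measurable_rV oA; split.
- split; first exact: test_function_L2 tphi mA.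
  exists (fun x => \row_i 'D_(basisv i) phi x); first exact: test_function_gradient.
  move=> i; rewrite (_ : (fun x => _) = (fun x => 'D_(basisv i) phi x)).
    exact: test_function_L2 (test_function_partial i tphi) mA.
  by apply/funext => x; rewrite mxE.
- by apply: aeW => x; exact: test_function_out.
- move=> e e0; exists phi => //.
  rewrite (@ae_eq_lower_integral _ _ _ mu A _ (cst 0%E)) ?integral0 ?lte_fin//.
  have H : {ae mu, forall x, forall i,
      A x -> weak_gradient A phi x ord0 i = 'D_(basisv i) phi x}.
    by apply: ae_all_ord => i; exact: weak_gradient_test.
  apply: filterS H => x Hx Ax; rewrite subrr expr0n add0r big1// => i _.
  by rewrite Hx// subrr expr0n.
Qed.

(** Both derivatives fall on the smooth function, so that no regularity of [u] beyond
    the existence of a weak gradient enters. *)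
Lemma integral_gradient A u G psi : open A -> is_weak_gradient A u G ->
  test_function A psi ->
  \int[mu]_(x in A) dotv (weak_gradient A u x) (weak_gradient A psi x) =
  - \int[mu]_(x in A) (u x * \sum_i 'D_(basisv i) (fun y => 'D_(basisv i) psi y) x).
Proof.
move=> oA /weak_gradientP; set W := weak_gradient A u => -[uL1 WL1 HW] tpsi.
have mA := open_measurable_rV oA.
have tD i := test_function_partial i tpsi.
have tDD i := test_function_partial i (tD i).
transitivity (\int[mu]_(x in A) (\sum_i W x ord0 i * 'D_(basisv i) psi x)).
  apply: ae_eq_Rintegral.
  have H : {ae mu, forall x, forall i,
      A x -> weak_gradient A psi x ord0 i = 'D_(basisv i) psi x}.
    by apply: ae_all_ord => i; exact: weak_gradient_test.
  by apply: filterS H => x Hx Ax; apply: eq_bigr => i _; rewrite Hx.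
have [_ ->] := ae_integrable_sum (index_enum 'I_n) mA (fun i => L1loc_mul oA (WL1 i) (tD i)).
have [_ E] := ae_integrable_sum (index_enum 'I_n) mA (fun i => L1loc_mul oA uL1 (tDD i)).
transitivity (- \int[mu]_(x in A) \sum_i (u x * 'D_(basisv i) (fun y => 'D_(basisv i) psi y) x)).
  by rewrite E -sumrN; apply: eq_bigr => i _; rewrite HW// opprK.
by congr (- _); apply: eq_Rintegral => x _; rewrite mulr_sumr.
Qed.

End uniqueness.

(** * The nonlocal term *)

Section kernel.
Context {R : realType} {n : nat}.
Local Notation V := 'rV[R]_n.
Local Notation mu := (@lebesgue_rV R n).

Lemma normv_le_enorm (x : V) : `|x| <= enorm x.
Proof.
apply: normv_le => [|i]; first exact: sqrtr_ge0.
rewrite -sqrtr_sqr; apply: ler_wsqrtr.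
by rewrite (bigD1 i)//= lerDl; apply: sumr_ge0 => j _; exact: sqr_ge0.
Qed.

Lemma enorm_le (x : V) : enorm x <= n%:R * `|x|.
Proof.
rewrite -[leRHS]ger0_norm ?mulr_ge0// -sqrtr_sqr; apply: ler_wsqrtr.
apply: (@le_trans _ _ (\sum_(i < n) `|x| ^+ 2)).
  apply: ler_sum => i _; rewrite -(real_normK (num_real (x ord0 i))).
  by rewrite lerXn2r ?nnegrE// coord_le_normv.
rewrite sumr_const card_ord -[_ *+ n]mulr_natl exprMn ler_wpM2r ?sqr_ge0//.
by case: n => [|m]; rewrite ?expr0n// expr2 ler_peMl// ler1n.
Qed.

Lemma enormN (x : V) : enorm (- x) = enorm x.
Proof. by congr Num.sqrt; apply: eq_bigr => i _; rewrite mxE sqrrN. Qed.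

Lemma measurable_enorm : measurable_fun [set: V] (@enorm R n).
Proof.
apply: (@measurableT_comp _ _ _ _ _ _ (@Num.sqrt R)).
  by apply: continuous_measurable_fun; exact: sqrt_continuous.
by apply: measurable_sum => i; apply: measurable_funX; exact: measurable_coord.
Qed.

Lemma shell_cover (k : nat) (t : R) : 2 ^- k <= t < 2 ^+ k ->
  exists2 j, (j < k)%N & 2 ^+ j <= t < 2 ^+ j.+1 \/ 2 ^- j.+1 <= t < 2 ^- j.
Proof.
elim: k => [|k IH]; first by rewrite expr0 invr1 => /andP[/le_lt_trans H /H]; rewrite ltxx.
move=> /andP[H1 H2]; have [H3|H3] := leP (2 ^+ k) t.
  by exists k => //; left; rewrite H3.
have [H4|H4] := leP (2 ^- k) t; last by exists k => //; right; rewrite H1.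
have [|j jk Hj] := IH; first by rewrite H4.
by exists j => //; exact: ltnW.
Qed.

Definition kern (p : R) (z : V) : R := enorm z `^ (- p).

Lemma kern_le (p c : R) z : 0 < p -> 0 < c -> c <= `|z| -> kern p z <= c `^ (- p).
Proof.
move=> p0 c0 cz; have cE := le_trans cz (normv_le_enorm z).
rewrite /kern !powRN lef_pV2 ?posrE ?powR_gt0//; last exact: lt_le_trans cE.
by apply: ge0_ler_powR => //; rewrite ?nnegrE ltW//; exact: lt_le_trans cE.
Qed.

Definition shell (k : nat) : set V := [set z | 2 ^- k <= `|z| < 2 ^+ k].

Lemma measurable_shell k : measurable (shell k).
Proof.
have mlt c : measurable [set z : V | `|z| < c].
  by have := measurable_cube (0 : V) c; under eq_set do rewrite subr0.
rewrite (_ : shell k = [set z | `|z| < 2 ^+ k] `\` [set z | `|z| < 2 ^- k]).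
  exact: measurableD.
apply/seteqP; split=> z /=; first by move=> /andP[H ->]; split=> //; apply/negP; rewrite -leNgt.
by move=> [H1 H2]; apply/andP; split=> //; rewrite leNgt; exact/negP.
Qed.

Lemma measurable_kern p : measurable_fun setT (kern p).
Proof. exact: measurableT_comp (measurable_powR _) measurable_enorm. Qed.

Lemma sum_geometric_le (c q : R) k : 0 <= c -> 0 <= q < 1 ->
  \sum_(j < k) c * q ^+ j <= c / (1 - q).
Proof.
move=> c0 /andP[q0 q1]; rewrite -mulr_sumr ler_wpM2l//.
have q1' : 0 < 1 - q by rewrite subr_gt0.
rewrite -[leRHS]mul1r ler_pdivlMr//.
by rewrite mulrC -[1 - q]opprB mulNr -subrX1 opprB gerBl exprn_ge0.
Qed.

(** A dyadic decomposition: the annulus of radius 2^j has measure of order 2^(j n),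
    so it contributes a geometric series on either side of the unit sphere. *)
Lemma kernel_integral (p : R) : n%:R < p < n%:R + 2 ->
  exists2 L : R, 0 < L & forall k,
    (\int[mu]_z (Num.min (`|z| ^+ 2) 1 * kern p z * \1_(shell k) z)%:E <= L%:E)%E.
Proof.
move=> /andP[np pn]; have p0 : 0 < p by apply: le_lt_trans np.
have two0 : 0 < 2 :> R by [].
pose a j : R := (2 ^+ j) `^ (- p).
pose b j : R := (2 ^- j) ^+ 2 * (2 ^- j.+1) `^ (- p).
pose q1 : R := 2 `^ (n%:R - p). pose q2 : R := 2 `^ (p - n%:R - 2).
have powlt1 (r : R) : r < 0 -> 0 <= 2 `^ r < 1.
  move=> r0; rewrite powR_ge0/= /powR gt_eqF// -[X in _ < X]expR0 ltr_expR.
  by rewrite nmulr_rlt0//; apply: ln_gt0; lra.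
have q1b : 0 <= q1 < 1 by apply: powlt1; lra.
have q2b : 0 <= q2 < 1 by apply: powlt1; lra.
have P2 r t : 2 `^ (r + t) = 2 `^ r * 2 `^ t :> R.
  by apply: powRD; apply/implyP => _; rewrite gt_eqF.
have E1 j : a j * (2 * 2 ^+ j.+1) ^+ n = 4 ^+ n * q1 ^+ j.
  have -> : 2 * 2 ^+ j.+1 = 4 * 2 ^+ j :> R by rewrite exprS mulrA -natrM.
  rewrite exprMn mulrCA; congr (_ * _).
  rewrite /a /q1 -!powR_mulrn ?powR_ge0 ?exprn_ge0//.
  rewrite -!powRrM -P2.
  by congr powR; ring.
have E2 j : b j * (2 * 2 ^- j) ^+ n = 2 ^+ n * 2 `^ p * q2 ^+ j.
  have V2 i : 2 ^- i = 2 `^ (- i%:R) :> R by rewrite powRN powR_mulrn.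
  rewrite exprMn /b !V2 -!powR_mulrn ?powR_ge0// /q2 -!powRrM.
  rewrite mulrCA -mulrA; congr (_ * _).
  rewrite -!P2.
  by congr powR; rewrite -[j.+1]addn1 natrD; ring.
have a0 j : 0 <= a j by exact: powR_ge0.
have b0 j : 0 <= b j by rewrite mulr_ge0 ?powR_ge0// exprn_ge0// invr_ge0 exprn_ge0.
have c1 : 0 < 4 ^+ n :> R by rewrite exprn_gt0.
have c2 : 0 < 2 ^+ n * 2 `^ p :> R by rewrite mulr_gt0 ?exprn_gt0 ?powR_gt0.
pose B r : set V := [set z | `|z - 0| < r].
have mB r : measurable (B r) := measurable_cube (0 : V) r.
exists (4 ^+ n / (1 - q1) + 2 ^+ n * 2 `^ p / (1 - q2)).
  by rewrite addr_gt0// divr_gt0// subr_gt0; [case/andP: q1b|case/andP: q2b].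
move=> k.
pose F j (z : V) : R := a j * \1_(B (2 ^+ j.+1)) z + b j * \1_(B (2 ^- j)) z.
have F0 j z : 0 <= F j z by rewrite addr_ge0// mulr_ge0.
have mF j : measurable_fun setT (F j).
  by apply: measurable_funD; apply: measurable_funM => //; exact: measurable_indic.
apply: (@le_trans _ _ (\int[mu]_z (\sum_(j < k) (F j z)%:E))%E).
  apply: ge0_le_integral => //.
  - move=> z _; rewrite lee_fin; apply: mulr_ge0 => //; apply: mulr_ge0.
      by rewrite le_min exprn_ge0//= ler01.
    exact: powR_ge0.
  - apply/measurable_EFinP; apply: measurable_funM; last by apply: measurable_indic; exact: measurable_shell.
    apply: measurable_funM; last exact: measurable_kern.
    apply: measurable_minr => //; apply: measurable_funX.
    by apply: continuous_measurable_rV; exact: norm_continuous.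
  - by apply: emeasurable_sum => j; apply/measurable_EFinP; exact: mF.
  - move=> z _; rewrite sumEFin lee_fin indicE.
  have [/set_mem zk|_] := boolP (z \in shell k); last first.
    by rewrite mulr0; apply: sumr_ge0 => j _; exact: F0.
  have [j jk Hj] := shell_cover zk; rewrite mulr1.
  rewrite (bigD1 (Ordinal jk))//= -[leLHS]addr0 lerD//; last by apply: sumr_ge0 => *; exact: F0.
  have m0 : 0 <= Num.min (`|z| ^+ 2) 1 by rewrite le_min exprn_ge0//= ler01.
  case: Hj => /andP[H1 H2]; rewrite /F !indicE.
    have -> : z \in B (2 ^+ j.+1) by rewrite inE /B /= subr0.
    rewrite mulr1 -[leLHS]addr0 lerD ?mulr_ge0// -[leRHS]mul1r.
    by apply: ler_pM; rewrite ?powR_ge0// ?ge_min ?lexx ?orbT// kern_le// exprn_gt0.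
  have -> : z \in B (2 ^- j) by rewrite inE /B /= subr0.
  rewrite mulr1 -[leLHS]add0r lerD ?mulr_ge0//.
  apply: ler_pM; rewrite ?powR_ge0//; last by rewrite kern_le// invr_gt0 exprn_gt0.
  rewrite ge_min; apply/orP; left; rewrite lerXn2r ?nnegrE ?invr_ge0 ?exprn_ge0//.
  exact: ltW.
rewrite ge0_integral_sum//; last 2 first.
- by move=> j; apply/measurable_EFinP; exact: mF.
- by move=> j z _; rewrite lee_fin F0.
have IF j : (\int[mu]_z (F j z)%:E = (4 ^+ n * q1 ^+ j + 2 ^+ n * 2 `^ p * q2 ^+ j)%:E)%E.
  transitivity (\int[mu]_z ((a j)%:E * (\1_(B (2 ^+ j.+1)) z)%:E +
      (b j)%:E * (\1_(B (2 ^- j)) z)%:E))%E; first by [].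
  rewrite ge0_integralD//; last 4 first.
  - by move=> z _; rewrite lee_fin mulr_ge0.
  - by apply/measurable_EFinP; apply: measurable_funM => //; exact: measurable_indic.
  - by move=> z _; rewrite lee_fin mulr_ge0.
  - by apply/measurable_EFinP; apply: measurable_funM => //; exact: measurable_indic.
  have I r c : 0 <= c -> 0 < r -> (\int[mu]_z (c%:E * (\1_(B r) z)%:E) = (c * (2 * r) ^+ n)%:E)%E.
    move=> cc rr; have mI : measurable_fun setT (fun z : V => (\1_(B r) z)%:E : \bar R).
      by apply/measurable_EFinP; exact: measurable_indic.
    rewrite (ge0_integralZl _ measurableT mI)//.
    by rewrite integral_indic// setIT [X in (_ * X)%E](measure_cube (0 : V) rr).
  by rewrite !I// ?exprn_gt0 ?invr_gt0 ?exprn_gt0// -EFinD E1 E2.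
under eq_bigr do rewrite IF.
rewrite sumEFin lee_fin big_split /=.
by apply: lerD; apply: sum_geometric_le => //; exact: ltW.
Qed.

End kernel.

Section nonlocal.
Context {R : realType} {n : nat} (p : R) (hp : n%:R < p < n%:R + 2).
Local Notation V := 'rV[R]_n.
Local Notation mu := (@lebesgue_rV R n).

Let p0 : 0 < p. Proof. by case/andP: hp => np _; apply: le_lt_trans np. Qed.

(** Off the diagonal and on a bounded range the two halves of the nonlocal integrand,
    with u(x) and with u(y), are separately integrable, which fails for the full
    kernel. *)
Definition truncated_kern (k : nat) (z : V) : R := kern p z * \1_(shell k) z.
Local Notation kk := truncated_kern.

Lemma truncated_kern_ge0 k z : 0 <= kk k z.
Proof. by rewrite mulr_ge0// powR_ge0. Qed.

Lemma truncated_kernN k z : kk k (- z) = kk k z.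
Proof.
rewrite /kk /kern enormN !indicE; congr (_ * _%:R); congr nat_of_bool.
by apply/idP/idP; rewrite !inE /shell /= normrN.
Qed.

Lemma measurable_truncated_kern k : measurable_fun setT (kk k).
Proof.
apply: measurable_funM; first exact: measurable_kern.
by apply: measurable_indic; exact: measurable_shell.
Qed.

Lemma truncated_kern_integrable k : mu.-integrable setT (EFin \o kk k).
Proof.
have c0 : 0 < 2 ^- k :> R by rewrite invr_gt0 exprn_gt0.
apply: (@compact_bounded_integrable R n _
  (closed_box (const_mx (- 2 ^+ k)) (const_mx (2 ^+ k))) ((2 ^- k) `^ (- p))).
- exact: measurable_truncated_kern.
- exact: compact_box.
- move=> z; rewrite ger0_norm ?truncated_kern_ge0// /kk indicE.
  have [/set_mem /andP[zk _]|_] := boolP (z \in shell k); last by rewrite mulr0 powR_ge0.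
  by rewrite mulr1 kern_le.
- move=> z nz; rewrite /kk indicE.
  have [/set_mem /andP[_ zk]|_] := boolP (z \in shell k); last by rewrite mulr0.
  exfalso; apply: nz => j; rewrite /= in_itv /= !mxE -ler_norml.
  exact: le_trans (coord_le_normv _ _) (ltW zk).
Qed.

Lemma measurable_subv :
  measurable_fun [set: V * V] (fun q : V * V => q.1 - q.2 : V).
Proof.
apply: measurable_fun_rV => i.
rewrite (_ : _ \o _ = fun q : V * V => q.1 ord0 i - q.2 ord0 i); last first.
  by apply/funext => q; rewrite /rV_coord /= !mxE.
apply: measurable_funB.
  exact: (measurableT_comp (measurable_coord i) measurable_fst).
exact: (measurableT_comp (measurable_coord i) measurable_snd).
Qed.

Variables (u psi : V -> R) (A : R) (Q : set V) (L : R).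
Hypotheses (mu_ : measurable_fun setT u) (u0 : forall x, 0 <= u x)
  (ui : mu.-integrable setT (EFin \o u)) (mpsi : measurable_fun setT psi)
  (psi01 : forall x, 0 <= psi x <= 1) (mQ : measurable Q)
  (psiQ : forall x, ~ Q x -> psi x = 0) (A1 : 1 <= A)
  (psi2 : forall x z, 2 * psi x - psi (x + z) - psi (x - z) <= A * `|z| ^+ 2)
  (L0 : 0 < L)
  (HL : forall k,
    (\int[mu]_z (Num.min (`|z| ^+ 2) 1 * kern p z * \1_(shell k) z)%:E <= L%:E)%E).

Let A0 : 0 <= A. Proof. exact: le_trans ler01 A1. Qed.

Let f k x y := kk k (x - y) * (psi x - psi y).

Let psi1 x y : `|psi x - psi y| <= 1.
Proof.
have /andP[? ?] := psi01 x; have /andP[? ?] := psi01 y.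
by rewrite ler_norml; apply/andP; split; lra.
Qed.

Let mf k x : measurable_fun setT (f k x).
Proof.
apply: measurable_funM; last exact: measurable_funB.
rewrite (_ : (fun y => _) = kk k \o (fun y => -1 *: y + x)).
  exact: measurableT_comp (measurable_truncated_kern k) (measurable_isometry _ _).
by apply/funext => y /=; rewrite scaleN1r addrC.
Qed.

Let ksub_integrable k x : mu.-integrable setT (fun y => (kk k (x - y))%:E).
Proof.
have := @integrable_isometry R n (-1) x (EFin \o kk k) (or_intror erefl)
  (truncated_kern_integrable k).
by apply: eq_integrable => // y _ /=; rewrite scaleN1r addrC.
Qed.

Let fi k x : mu.-integrable setT (fun y => (f k x y)%:E).
Proof.
by apply: (integrable_mul_bounded measurableT (ksub_integrable k x) (measurable_funB _ _) (psi1 x)).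
Qed.

(** Averaging the substitutions y = x + z and y = x - z, which are allowed because
    the truncated kernel is even and integrable, exhibits the second difference. *)
Lemma inner_le k x : (\int[mu]_y (f k x y)%:E <= (A * L * \1_Q x)%:E)%E.
Proof.
have E1 := @integral_isometry R n 1 x _ (or_introl erefl) (measurable_int _ (fi k x)).
have E2 := @integral_isometry R n (-1) x _ (or_intror erefl) (measurable_int _ (fi k x)).
have I1 := @integrable_isometry R n 1 x _ (or_introl erefl) (fi k x).
have I2 := @integrable_isometry R n (-1) x _ (or_intror erefl) (fi k x).
have H2 : (\int[mu]_y (f k x y)%:E + \int[mu]_y (f k x y)%:E <=
    (2 * A * L * \1_Q x)%:E)%E.
  rewrite -{1}E1 -E2 -integralD//.
  have mm : measurable_fun setT (fun z : V => Num.min (`|z| ^+ 2) 1 * kern p z * \1_(shell k) z).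
    apply: measurable_funM; last by apply: measurable_indic; exact: measurable_shell.
    apply: measurable_funM; last exact: measurable_kern.
    apply: measurable_minr => //; apply: measurable_funX.
    by apply: continuous_measurable_rV; exact: norm_continuous.
  have m0 (z : V) : 0 <= Num.min (`|z| ^+ 2) 1 * kern p z * \1_(shell k) z.
    apply: mulr_ge0 => //; apply: mulr_ge0; last exact: powR_ge0.
    by rewrite le_min exprn_ge0//= ler01.
  have c0 : 0 <= 2 * A * \1_Q x by rewrite !mulr_ge0.
  apply: (@le_trans _ _ (\int[mu]_z ((2 * A * \1_Q x)%:E *
      (Num.min (`|z| ^+ 2) 1 * kern p z * \1_(shell k) z)%:E))%E); last first.
    have mme := proj2 (measurable_EFinP setT _) mm.
    rewrite (ge0_integralZl _ measurableT mme)//; last by move=> z _; rewrite lee_fin.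
    rewrite (_ : 2 * A * L * \1_Q x = 2 * A * \1_Q x * L); last by ring.
    rewrite [leRHS]EFinM; apply: lee_wpmul2l; [by rewrite lee_fin|exact: HL].
  apply: le_integral => //.
  - exact: integrableD.
  - apply: integrableZl => //.
    apply/integrableP; split; first exact/measurable_EFinP.
    under eq_integral do rewrite gee0_abs ?lee_fin//.
    by apply: le_lt_trans (HL k) _; rewrite ltry.
  move=> z _; rewrite -EFinD -EFinM lee_fin /f.
  rewrite scale1r scaleN1r.
  have -> : x - (z + x) = - z by rewrite opprD addrCA subrr addr0.
  have -> : x - (- z + x) = z by rewrite opprD addrCA subrr addr0 opprK.
  rewrite truncated_kernN [z + x]addrC [- z + x]addrC.
  rewrite [leRHS](_ : _ = (2 * A * \1_Q x * Num.min (`|z| ^+ 2) 1) * kk k z); last first.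
    by rewrite /kk; ring.
  rewrite [leLHS](_ : _ = (2 * psi x - psi (x + z) - psi (x - z)) * kk k z); last by ring.
  apply: ler_wpM2r; first exact: truncated_kern_ge0.
  have /andP[a1 a2] := psi01 x; have /andP[a3 a4] := psi01 (x + z).
  have /andP[a5 a6] := psi01 (x - z).
  rewrite indicE; have [/set_mem Qx|/negP nQ] := boolP (x \in Q); last first.
    rewrite mulr0 mul0r psiQ; last by move=> Qx; apply: nQ; rewrite inE.
    lra.
  rewrite mulr1; have D2 := psi2 x z; have t0 := exprn_ge0 2 (normr_ge0 z).
  have A1' := A1; case: (leP (`|z| ^+ 2) 1) => Hz; last lra.
  by apply: le_trans D2 _; rewrite ler_wpM2r// mulr_natl mulr2n lerDl.
move: H2; have /fineK <- := integrable_fin_num measurableT (fi k x).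
by rewrite -EFinD !lee_fin => H2; lra.
Qed.

Let F k (q : V * V) := u q.1 * f k q.1 q.2.

Let mF k : measurable_fun setT (F k).
Proof.
apply: measurable_funM; first exact: measurableT_comp mu_ measurable_fst.
apply: measurable_funM.
  exact: measurableT_comp (measurable_truncated_kern k) measurable_subv.
apply: measurable_funB.
  exact: measurableT_comp mpsi measurable_fst.
exact: measurableT_comp mpsi measurable_snd.
Qed.

Let Fi k : (mu \x mu)%E.-integrable setT (EFin \o F k).
Proof.
apply/integrable12ltyP; first exact/measurable_EFinP.
pose c := (\int[mu]_z (kk k z)%:E)%E.
have cE x : (\int[mu]_y (kk k (x - y))%:E = c)%E.
  have := @integral_isometry R n (-1) x (EFin \o kk k) (or_intror erefl)
    (measurable_int _ (truncated_kern_integrable k)).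
  move=> E; transitivity (\int[mu]_y (EFin \o kk k) (-1 *: y + x)%R)%E; last exact: E.
  by apply: eq_integral => y _ /=; rewrite scaleN1r addrC.
have cf : c \is a fin_num by apply: integrable_fin_num => //; exact: truncated_kern_integrable.
have c0 : (0 <= c)%E by apply: integral_ge0 => z _; rewrite lee_fin truncated_kern_ge0.
apply: (@le_lt_trans _ _ (\int[mu]_x ((u x)%:E * c))%E).
  apply: ge0_le_integral => //.
  - by move=> x _; apply: integral_ge0.
  - apply: (measurable_fun_fubini_tonelli_F (fun q => `|(F k q)%:E|%E)) => //.
    by apply: measurableT_comp => //; exact/measurable_EFinP.
  - by apply: emeasurable_funM => //; exact/measurable_EFinP.
  move=> x _; rewrite -(cE x) -ge0_integralZl ?lee_fin//; last 2 first.
  - exact: measurable_int (ksub_integrable k x).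
  - by move=> y _; rewrite lee_fin truncated_kern_ge0.
  apply: ge0_le_integral => //.
  - have MM : measurable_fun setT (fun y => (F k (x, y))%:E : \bar R).
      by apply/measurable_EFinP; exact: (measurable_funM (measurable_cst (u x)) (mf k x)).
    exact: (measurableT_comp _ MM).
  - by apply: emeasurable_funM => //; exact: measurable_int (ksub_integrable k x).
  move=> y _; rewrite -EFinM lee_fin /F /= normrM (ger0_norm (u0 x)) ler_wpM2l//.
  have k0 := truncated_kern_ge0 k (x - y).
  by rewrite /f normrM (ger0_norm k0) ler_piMr.
have mue := proj2 (measurable_EFinP setT u) mu_.
rewrite (ge0_integralZr _ measurableT mue)//; last by move=> x _; rewrite lee_fin.
apply: lte_mul_pinfty.
- by apply: integral_ge0 => x _; rewrite lee_fin.
- exact: integrable_fin_num.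
- by rewrite -(fineK cf) ltry.
Qed.

Let F_le k : (\int[mu \x mu]_q (F k q)%:E <= (A * L)%:E * \int[mu]_(x in Q) (u x)%:E)%E.
Proof.
have AL0 : 0 <= A * L by rewrite mulr_ge0// ltW.
rewrite -(integral12_prod_meas1 (Fi k)) /fubini_F.
have uQ : mu.-integrable setT (fun x => (u x * \1_Q x)%:E).
  apply: (@integrable_mul_bounded _ _ _ mu setT u (\1_Q) 1) => //.
  by move=> x; rewrite indicE; case: (x \in Q); rewrite ?normr1 ?normr0.
apply: (@le_trans _ _ (\int[mu]_x ((A * L)%:E * (u x * \1_Q x)%:E))%E).
  apply: le_integral => //.
  - exact: integrable_fubini_F (Fi k).
  - exact: integrableZl.
  move=> x _.
  have -> : (\int[mu]_y (EFin \o F k) (x, y) = (u x)%:E * \int[mu]_y (f k x y)%:E)%E.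
    by rewrite -(integralZl measurableT (fi k x)); apply: eq_integral => y _; rewrite /= EFinM.
  rewrite -EFinM mulrCA EFinM; apply: lee_wpmul2l; first by rewrite lee_fin.
  exact: inner_le.
rewrite integralZl// lee_wpmul2l ?lee_fin// [leRHS]integral_mkcond.
rewrite le_eqVlt; apply/orP; left; apply/eqP; apply: eq_integral => x _.
by rewrite patchE indicE; case: (x \in Q); rewrite ?mulr1 ?mulr0.
Qed.

Let G k (q : V * V) := F k (q.2, q.1).

Let mG k : measurable_fun setT (G k).
Proof.
apply: (measurableT_comp (mF k)); apply/measurable_fun_pair => /=;
  [exact: measurable_snd|exact: measurable_fst].
Qed.

Let Gi k : (mu \x mu)%E.-integrable setT (EFin \o G k).
Proof.
apply/integrable21ltyP; first exact/measurable_EFinP.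
by have := Fi k => /integrable12ltyP; apply; exact/measurable_EFinP.
Qed.

Let GE k : (\int[mu \x mu]_q (G k q)%:E = \int[mu \x mu]_q (F k q)%:E)%E.
Proof. by rewrite -(integral12_prod_meas1 (Fi k)) -(integral21_prod_meas1 (Gi k)). Qed.

Let J (q : V * V) := (u q.1 - u q.2) * (psi q.1 - psi q.2) / enorm (q.1 - q.2) `^ p.

Let JE k q : J q * \1_(shell k) (q.1 - q.2) = F k q + G k q.
Proof.
rewrite /J /G /F /f /= -powRN -[q.2 - q.1]opprB truncated_kernN /kk /kern; ring.
Qed.

Let mJ : measurable_fun setT J.
Proof.
rewrite /J; under eq_fun do rewrite -powRN.
apply: measurable_funM; last exact: measurableT_comp (measurable_kern p) measurable_subv.
apply: measurable_funM; apply: measurable_funB.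
- exact: measurableT_comp mu_ measurable_fst.
- exact: measurableT_comp mu_ measurable_snd.
- exact: measurableT_comp mpsi measurable_fst.
- exact: measurableT_comp mpsi measurable_snd.
Qed.

(** The truncated integrand is [F k] plus its image [G k] under the exchange of the
    variables, so its integral is twice that of [F k]. The resulting bound is uniform
    in [k], and the truncation is removed by dominated convergence. *)
Lemma nonlocal_le : ae_integrable (mu \x mu)%E setT J ->
  \int[(mu \x mu)%E]_q J q <= 2 * A * L * \int[mu]_(x in Q) u x.
Proof.
move=> [J' J'i JJ'].
have Ji : (mu \x mu)%E.-integrable setT (EFin \o J).
  apply/integrableP; split; first exact/measurable_EFinP.
  have /integrableP[_] := J'i; apply: le_lt_trans.
  rewrite le_eqVlt; apply/orP; left; apply/eqP; apply: ae_eq_lower_integral.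
  by apply: filterS JJ' => q H /H /= ->.
have uQi : mu.-integrable Q (EFin \o u) by exact: integrableS ui.
pose b := ((2 * A * L)%:E * \int[mu]_(x in Q) (u x)%:E)%E.
have Hk k : (\int[mu \x mu]_q (J q * \1_(shell k) (q.1 - q.2))%:E <= b)%E.
  under eq_integral do rewrite JE EFinD.
  rewrite integralD//; [|exact: Fi|exact: Gi].
  rewrite GE; apply: le_trans (leeD (F_le k) (F_le k)) _.
  rewrite /b; have /fineK <- := integrable_fin_num mQ uQi.
  rewrite -!EFinM -EFinD lee_fin le_eqVlt; apply/orP; left; apply/eqP; ring.
have [|||||_ _ Hc] := @dominated_convergence _ _ _ (mu \x mu)%E setT measurableT
  (fun k q => (J q * \1_(shell k) (q.1 - q.2))%:E) (EFin \o J) (abse \o (EFin \o J)).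
- move=> k; apply/measurable_EFinP; apply: measurable_funM => //.
  apply: (measurableT_comp (measurable_indic _) measurable_subv).
  exact: measurable_shell.
- exact/measurable_EFinP.
- apply: aeW => q _ /=; apply: cvg_EFin; first exact: nearW.
  have [->|qn] := eqVneq (J q) 0.
    by under eq_fun do rewrite mul0r; exact: cvg_cst.
  have z0 : 0 < `|q.1 - q.2|.
    rewrite normr_gt0 subr_eq0; apply: contra_neq qn => E.
    by rewrite /J E !subrr !mul0r.
  apply: cvg_near_cst; near=> k; rewrite /= indicE mem_set ?mulr1// /shell /=.
  apply/andP; split.
    rewrite invf_ple ?posrE ?exprn_gt0//.
    apply: (@le_trans _ _ k%:R); last by rewrite -natrX ler_nat ltnW// ltn_expl.
    by near: k; exact: nbhs_infty_ger.
  apply: (@lt_le_trans _ _ k%:R); last by rewrite -natrX ler_nat ltnW// ltn_expl.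
  by near: k; exact: nbhs_infty_gtr.
- exact: integrable_abse.
- apply: aeW => q k _; rewrite /= lee_fin normrM ler_piMr// indicE.
  by case: (_ \in _); rewrite ?normr1 ?normr0.
have H : (\int[mu \x mu]_q (J q)%:E <= b)%E.
  have /cvg_lim <- := Hc => //; apply: lime_le; first by apply/cvg_ex; eexists; exact: Hc.
  by apply: nearW => k; exact: Hk.
have bf : b \is a fin_num by rewrite fin_numM// integrable_fin_num.
have Jf := integrable_fin_num measurableT Ji.
move: H; rewrite -(fineK bf) -(fineK Jf) lee_fin => H; apply: le_trans H _.
by rewrite /b fineM//; exact: integrable_fin_num.
Unshelve. all: by end_near. Qed.

End nonlocal.

(** * Geometry of the boundary *)

Section boundary.
Context {R : realType} {n : nat}.
Local Notation V := 'rV[R]_n.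
Implicit Types (A : set V) (x y : V).

Lemma open_normv A x : open A -> A x ->
  exists2 e : R, 0 < e & forall y, `|y - x| < e -> A y.
Proof.
move=> oA Ax; have /nbhs_ballP[e /= e0 He] := oA _ Ax.
by exists e => // y xy; apply: He; rewrite -ball_normE /= -opprB normrN.
Qed.

Lemma closure_normv A x : (forall e : R, 0 < e -> exists2 y, A y & `|y - x| < e) ->
  closure A x.
Proof.
move=> H B /nbhs_ballP[e /= e0 He]; have [y Ay yx] := H e e0.
by exists y; split=> //; apply: He; rewrite -ball_normE /= -opprB normrN.
Qed.

Lemma closure_normvE A x (e : R) : closure A x -> 0 < e -> exists2 y, A y & `|y - x| < e.
Proof.
move=> Ax e0; have [y [Ay yB]] := Ax _ (nbhsx_ballx x e e0).
by exists y => //; move: yB; rewrite -ball_normE /= -opprB normrN.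
Qed.

Lemma boundary_out A x : open A -> boundary A x -> ~ A x.
Proof. by move=> oA [_ nA] Ax; apply: nA; exact: oA. Qed.

(** The supremum of the times at which the segment is in [A] gives such a point. *)
Lemma segment_boundary A a b : open A -> A a -> ~ A b ->
  exists2 t : R, 0 <= t <= 1 & boundary A (a + t *: (b - a)).
Proof.
move=> oA Aa nAb; pose g (t : R) : V := a + t *: (b - a).
pose S := [set t : R | 0 <= t <= 1 /\ A (g t)].
have g0 : g 0 = a by rewrite /g scale0r addr0.
have g1 : g 1 = b by rewrite /g scale1r addrCA subrr addr0.
have S0 : S 0 by split; [rewrite lexx ler01|rewrite g0].
have Sub : has_ubound S by exists 1 => t [/andP[]].
have hS : has_sup S by split=> //; exists 0.
have sg0 : 0 <= sup S by exact: ub_le_sup.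
have sg1 : sup S <= 1 by apply: ge_sup => [|t [/andP[]]//]; exists 0.
have gs s t : g s - g t = (s - t) *: (b - a).
  by rewrite /g opprD addrACA subrr add0r -scalerBl.
have d0 : 0 < `|b - a| + 1 by rewrite ltr_wpDl.
have near_g (e : R) t s : 0 < e -> `|s - t| < e / (`|b - a| + 1) -> `|g s - g t| < e.
  move=> e0 st; rewrite gs normrZ; apply: (@le_lt_trans _ _ (`|s - t| * (`|b - a| + 1))).
    by rewrite ler_wpM2l// lerDl.
  by rewrite -ltr_pdivlMr.
have nAg : ~ A (g (sup S)).
  move=> Ag; have [e e0 He] := open_normv oA Ag.
  have f0 : 0 < e / (`|b - a| + 1) by rewrite divr_gt0.
  have s1 : sup S < 1.
    by rewrite lt_neqAle sg1 andbT; apply/eqP => s1; apply: nAb; rewrite -g1 -s1.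
  pose t := Num.min 1 (sup S + e / (`|b - a| + 1) / 2).
  have st : sup S < t by rewrite lt_min s1/= ltrDl divr_gt0.
  have : S t.
    split.
      by rewrite (le_trans sg0 (ltW st))/= ge_min lexx.
    apply: He; apply: near_g => //; rewrite gtr0_norm ?subr_gt0// ltrBlDl.
    apply: (@le_lt_trans _ _ (sup S + e / (`|b - a| + 1) / 2)); first by rewrite ge_min lexx orbT.
    by rewrite ltrD2l ltr_pdivrMr// ltr_pMr// ltr1n.
  by move=> /(ub_le_sup Sub); rewrite leNgt st.
exists (sup S); first by rewrite sg0 sg1.
split; last by move=> /interior_subset; exact: nAg.
apply: closure_normv => e e0.
have f0 : 0 < e / (`|b - a| + 1) by rewrite divr_gt0.
have [t [t01 At] tS] := sup_adherent f0 hS.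
exists (g t) => //; apply: near_g => //.
have ts : t <= sup S by apply: ub_le_sup.
by rewrite ler0_norm ?subr_le0// opprB ltrBlDr addrC -ltrBlDr.
Qed.

Lemma dist_boundary_le A x y : boundary A y -> dist_boundary A x <= enorm (x - y).
Proof.
move=> By; apply: ge_inf; last by exists y.
by exists 0 => _ [z _ <-]; exact: sqrtr_ge0.
Qed.

Lemma dist_boundary_gt0 A x y : open A -> A x -> boundary A y -> 0 < dist_boundary A x.
Proof.
move=> oA Ax By; have [e e0 He] := open_normv oA Ax.
apply: (lt_le_trans e0); apply: lb_le_inf; first by exists (enorm (x - y)), y.
move=> _ [z Bz <-]; rewrite leNgt; apply/negP => xz; apply: (boundary_out oA Bz).
apply: He; apply: le_lt_trans xz; rewrite -normrN opprB.
exact: normv_le_enorm.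
Qed.

End boundary.

Section chart.
Context {R : realType}.

(** A Lipschitz gradient is bounded on bounded sets. *)
Lemma C11_lipschitz (n : nat) (phi : 'rV[R]_n -> R^o) (M : R) : 0 <= M ->
  C11_function phi ->
  exists2 L : R, 0 <= L & forall y z : 'rV[R]_n, `|y| <= M -> `|z| <= M ->
    `|phi z - phi y| <= L * `|z - y|.
Proof.
move=> M0 [dphi [L HL]].
pose B := \sum_i `|'D_(basisv i) phi 0| + `|L| * (n%:R * (3 * M)).
have B0 : 0 <= B by rewrite addr_ge0 ?sumr_ge0// !mulr_ge0.
have DB (p : 'rV[R]_n) i : `|p| <= 3 * M -> `|'D_(basisv i) phi p| <= B.
  move=> pM; rewrite -['D_(basisv i) phi p](subrK ('D_(basisv i) phi 0)).
  apply: le_trans (ler_normD _ _) _; rewrite /B addrC lerD//.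
    by rewrite (bigD1 i)//= lerDl sumr_ge0.
  apply: le_trans (HL _ _ _) _; apply: (@le_trans _ _ (`|L| * enorm (p - 0))).
    by rewrite ler_wpM2r ?ler_norm// sqrtr_ge0.
  rewrite ler_wpM2l// subr0; apply: le_trans (enorm_le _) _.
  by rewrite ler_wpM2l.
exists (n%:R * B); first by rewrite mulr_ge0.
move=> y z yM zM; pose w := z - y.
have dF (t : R) : is_derive t 1 (fun s : R => phi (s *: w + y)) ('D_w phi (t *: w + y)).
  apply: (proj1 (is_derive_line phi y w t _)); apply/derivableP.
  exact: diff_derivable.
have [c c1] := mean_value 0 1 dF; rewrite subr0 in c1.
rewrite scale1r scale0r add0r subrK subr0 mulr1 => ->.
have pM : `|c *: w + y| <= 3 * M.
  apply: le_trans (ler_normD _ _) _; rewrite normrZ.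
  have w2 : `|w| <= 2 * M by apply: le_trans (ler_normB _ _) _; lra.
  have : `|c| * `|w| <= 1 * (2 * M).
    by apply: ler_pM => //; move: c1; rewrite subr0 normr1.
  lra.
have Ew : w = \sum_i w ord0 i *: basisv i by rewrite {1}(row_sum_delta w).
have -> : 'D_w phi (c *: w + y) = \sum_i w ord0 i * 'D_(basisv i) phi (c *: w + y).
  move: (c *: w + y) => q; rewrite deriveE// {1}Ew raddf_sum.
  apply: eq_bigr => i _; rewrite [LHS]linearZ deriveE//.
apply: le_trans (ler_norm_sum _ _ _) _.
apply: (@le_trans _ _ (\sum_(i < n) B * `|w|)); last first.
  by rewrite sumr_const card_ord -[_ *+ n]mulr_natl mulrA.
apply: ler_sum => i _; rewrite normrM mulrC.
by apply: ler_pM => //; [exact: DB|exact: coord_le_normv].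
Qed.

(** The uniform interior cone condition near [x0], with axis [v]: the cone at each base
    point [y] of [A] is described by its cross-sections at heights [t]. *)
Definition cone_property n (A : set 'rV[R]_n) (x0 v : 'rV[R]_n) (rho kappa : R) :=
  forall y z t, `|y - x0| < rho -> 0 < t < rho -> `|z - y - t *: v| <= kappa * t ->
    A y -> A z.

(** Above the graph of a Lipschitz function lies a cone of fixed aperture around the
    vertical direction; [v] is this direction in the original coordinates. *)
Lemma cone_condition n (A : set 'rV[R]_n.+1) x0 : C11_boundary A -> boundary A x0 ->
  exists v rho kappa, [/\ 0 < rho, 0 < kappa <= 1 & cone_property A x0 v rho kappa].
Proof.
move=> /[apply] -[r [Q [phi [r0 QQ Cphi HA]]]].
pose CQ := \sum_i \sum_j `|Q i j|.
have CQ0 : 0 <= CQ by apply: sumr_ge0 => i _; apply: sumr_ge0.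
have xQ (x : 'rV[R]_n.+1) j : `|(x *m Q) ord0 j| <= CQ * `|x|.
  rewrite mxE; apply: le_trans (ler_norm_sum _ _ _) _; rewrite mulr_suml.
  apply: ler_sum => i _; rewrite normrM mulrC; apply: ler_pM => //.
    by rewrite (bigD1 j)//= lerDl sumr_ge0.
  exact: coord_le_normv.
have xQ' (x : 'rV[R]_n.+1) : `|col' ord_max (x *m Q)| <= CQ * `|x|.
  by apply: normv_le => [|j]; [rewrite mulr_ge0|rewrite mxE].
pose d : 'rV[R]_n.+1 := delta_mx ord0 ord_max.
pose v := d *m Q^T.
have vQ : v *m Q = d by rewrite /v -mulmxA (mulmx1C QQ) mulmx1.
pose W := 2 + `|v|.
have W0 : 0 < W by rewrite ltr_wpDr.
have N0 : 0 < n.+1%:R :> R by rewrite ltr0n.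
pose rho := r / (2 * n.+1%:R * W).
have rho0 : 0 < rho by rewrite divr_gt0// !mulr_gt0.
pose M := CQ * (`|x0| + W * rho).
have M0 : 0 <= M by rewrite mulr_ge0// addr_ge0// mulr_ge0// ltW.
have [L L0 HL] := C11_lipschitz M0 Cphi.
have D1 : 1 <= 1 + CQ * (1 + L) by rewrite lerDl mulr_ge0// addr_ge0.
have D0 := lt_le_trans (@ltr01 R) D1.
exists v, rho, (1 + CQ * (1 + L))^-1; split=> //.
  by rewrite invr_gt0 D0 invf_le1.
move=> y z t yx0 /andP[t0 tr] ze Ay; set e := z - y - t *: v in ze.
have et : `|e| <= t.
  by apply: le_trans ze _; apply: ler_piMl; [exact: ltW|rewrite invf_le1].
have zE : z = y + t *: v + e.
  by rewrite /e -[z - y - _]addrA -opprD addrCA subrr addr0.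
have zx0 : `|z - x0| < W * rho.
  have -> : z - x0 = (y - x0) + (t *: v + e) by rewrite zE -[y + _ + e]addrA [RHS]addrAC.
  apply: le_lt_trans (ler_normD _ _) _.
  apply: (@lt_le_trans _ _ (rho + (`|t *: v| + `|e|))).
    by rewrite ltr_leD// ler_normD.
  rewrite normrZ gtr0_norm// /W.
  have := ler_wpM2r (normr_ge0 v) (ltW tr); lra.
have in_chart x : `|x - x0| < W * rho -> enorm (x - x0) < r.
  move=> xx0; apply: le_lt_trans (enorm_le _) _.
  apply: (@lt_le_trans _ _ (n.+1%:R * (W * rho))); first by rewrite ltr_pM2l.
  rewrite /rho; have -> : n.+1%:R * (W * (r / (2 * n.+1%:R * W))) = r / 2.
    by field; rewrite !gt_eqF.
  lra.
have yx0' : `|y - x0| < W * rho.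
  by apply: lt_le_trans yx0 _; rewrite ler_peMl ?ltW// /W; have := normr_ge0 v; lra.
have bM x : `|x - x0| < W * rho -> `|col' ord_max (x *m Q)| <= M.
  move=> xx0; apply: le_trans (xQ' _) _; rewrite ler_wpM2l//.
  have H : `|x| <= `|x - x0| + `|x0| by rewrite -{1}[x](subrK x0) ler_normD.
  by apply: le_trans H _; rewrite addrC lerD2l ltW.
have := proj1 (HA y (in_chart _ yx0')) Ay => Hy.
apply/(HA z (in_chart _ zx0)).
have Hphi := HL _ _ (bM _ yx0') (bM _ zx0).
have Ez : z *m Q = y *m Q + t *: d + e *m Q by rewrite zE !mulmxDl -scalemxAl vQ.
have E1 : col' ord_max (z *m Q) - col' ord_max (y *m Q) = col' ord_max (e *m Q).
  rewrite Ez; apply/rowP => j; rewrite !mxE eqxx /= eq_sym (negbTE (neq_lift _ _)) mulr0 addr0.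
  by rewrite addrAC subrr add0r.
have E2 : (z *m Q) ord0 ord_max = (y *m Q) ord0 ord_max + t + (e *m Q) ord0 ord_max.
  by rewrite Ez !mxE !eqxx /= mulr1.
rewrite E1 in Hphi; rewrite E2.
have H1 := le_trans Hphi (ler_wpM2l L0 (xQ' e)).
have H2 := xQ e ord_max.
have H3 : CQ * (1 + L) * `|e| <= t.
  apply: le_trans (ler_wpM2l _ ze) _; first by rewrite mulr_ge0// addr_ge0.
  rewrite mulrA ler_piMl ?(ltW t0)// ler_pdivrMr// mul1r lerDr//.
have := ler_norm (phi (col' ord_max (z *m Q)) - phi (col' ord_max (y *m Q))).
have := ler_norm (- (e *m Q) ord0 ord_max); rewrite normrN.
move: Hy H1 H2 H3.
set a := phi _; set b := phi _; set c := (e *m Q) ord0 ord_max; set g := (y *m Q) ord0 ord_max.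
by move=> Hy H1 H2 H3 H4 H5; lra.
Qed.

End chart.

(** * Functions of H^1_0 are small near the boundary *)

Lemma ge0_sume_const (R : realType) (x : \bar R) k :
  (0 <= x)%E -> (\sum_(j < k) x = k%:R%:E * x)%E.
Proof.
move=> x0; elim: k => [|k IH]; first by rewrite big_ord0 mul0e.
by rewrite big_ord_recr /= IH -natr1 EFinD ge0_muleDl ?mul1e// lee_fin.
Qed.

Section translation.
Context {R : realType} {n : nat}.
Local Notation V := 'rV[R]_n.
Local Notation mu := (@lebesgue_rV R n).
Implicit Types (phi : V -> R^o) (A : set V) (d : V).

Lemma sqr_sum_le (m : nat) (a : nat -> R) :
  (\sum_(j < m) a j) ^+ 2 <= m%:R * \sum_(j < m) a j ^+ 2.
Proof.
elim: m => [|m IH]; first by rewrite !big_ord0 expr0n mulr0.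
rewrite !big_ord_recr /=; set S := \sum_(j < m) a j in IH *.
set Q := \sum_(j < m) a j ^+ 2 in IH *; rewrite -natr1.
have Q0 : 0 <= Q by apply: sumr_ge0 => j _; exact: sqr_ge0.
case: m => [|m] in S Q IH Q0 *.
  rewrite mul0r in IH; have : S ^+ 2 = 0 by apply/eqP; rewrite eq_le IH sqr_ge0.
  move=> /eqP; rewrite sqrf_eq0 => /eqP ->.
  by rewrite !add0r mul1r lerDr.
have m0 : 0 < m.+1%:R :> R by rewrite ltr0n.
have H : m.+1%:R * (2 * S * a m.+1) <= m.+1%:R * (Q + m.+1%:R * a m.+1 ^+ 2).
  have := sqr_ge0 (S - m.+1%:R * a m.+1); rewrite mulrDr.
  by move: IH; rewrite !expr2; nra.
rewrite ler_pM2l// in H; move: IH H; rewrite !expr2; nra.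
Qed.

Definition translation_energy phi d := (\int[mu]_z ((phi (d + z) - phi z) ^+ 2)%:E)%E.

Lemma measurable_translate phi d : measurable_fun setT (phi : V -> R) ->
  measurable_fun setT (fun z => phi (d + z) : R).
Proof.
move=> mphi; rewrite (_ : (fun z => _) = phi \o (fun z => 1 *: z + d)).
  exact: measurableT_comp mphi (measurable_isometry _ _).
by apply/funext => z /=; rewrite scale1r addrC.
Qed.

(** Telescoping and the Cauchy-Schwarz inequality; each intermediate translation
    preserves the integral. *)
Lemma translation_energy_sum phi (d : nat -> V) m :
  measurable_fun setT (phi : V -> R) ->
  (translation_energy phi (\sum_(j < m) d j) <=
   m%:R%:E * \sum_(j < m) translation_energy phi (d j))%E.
Proof.
move=> mphi; pose D j := \sum_(i < j) d i.
pose a j z := phi (D j.+1 + z) - phi (D j + z).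
have ma j : measurable_fun setT (fun z => a j z ^+ 2 : R).
  by apply: measurable_funX; apply: measurable_funB; exact: measurable_translate.
have aE j : (\int[mu]_z (a j z ^+ 2)%:E = translation_energy phi (d j))%E.
  rewrite /translation_energy -[RHS](ge0_integral_isometry (D j) (or_introl erefl)).
  - apply: eq_integral => z _; rewrite /a scale1r [z + _]addrC.
    by have -> : D j.+1 + z = d j + (D j + z) by rewrite /D big_ord_recr /= addrA [d j + _]addrC.
  - apply/measurable_EFinP; apply: measurable_funX; apply: measurable_funB => //.
    exact: measurable_translate.
  - by move=> z; rewrite lee_fin sqr_ge0.
have sE : (\sum_(j < m) translation_energy phi (d j) =
    \int[mu]_z (\sum_(j < m) a j z ^+ 2)%:E)%E.
  under eq_integral do rewrite -sumEFin.
  rewrite ge0_integral_sum//.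
  - by apply: eq_bigr => j _; rewrite aE.
  - by move=> j; apply/measurable_EFinP; exact: ma.
  - by move=> j z _; rewrite lee_fin sqr_ge0.
have ms : measurable_fun setT (fun z => (\sum_(j < m) a j z ^+ 2)%:E : \bar R).
  by apply/measurable_EFinP; apply: measurable_sum => j; exact: ma.
rewrite sE -(ge0_integralZl _ measurableT ms); last 2 first.
- by move=> z _; rewrite lee_fin sumr_ge0// => j _; exact: sqr_ge0.
- by rewrite lee_fin.
apply: ge0_le_integral => //.
- by move=> z _; rewrite lee_fin sqr_ge0.
- apply/measurable_EFinP; apply: measurable_funX; apply: measurable_funB => //.
  exact: measurable_translate.
- exact: emeasurable_funM.
move=> z _; rewrite -EFinM lee_fin; apply: le_trans (sqr_sum_le m (fun j => a j z)).
rewrite le_eqVlt; apply/orP; left; apply/eqP; congr (_ ^+ 2).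
rewrite -(big_mkord xpredT (fun j => a j z)) /a telescope_sumr//.
by rewrite /D big_ord0 add0r.
Qed.

Lemma dirichlet_integrable A phi i : test_function A phi ->
  mu.-integrable setT (fun z => (('D_(basisv i) phi z) ^+ 2)%:E).
Proof.
move=> tphi; have t1 := test_function_partial i tphi.
have [s1 _] := t1.
have := test_function_integrable (test_functionM t1 s1).
by apply: eq_integrable => // z _ /=; rewrite expr2.
Qed.

(** Dividing the step into [m] equal ones bounds the energy by t^2 times the integral of
    a squared difference quotient of step t / m, which tends to the integral of the
    squared derivative. *)
Lemma translation_energy_coord A phi i (t : R) : test_function A phi -> `|t| <= 1 ->
  (translation_energy phi (t *: basisv i) <=
   (t ^+ 2)%:E * \int[mu]_z (('D_(basisv i) phi z) ^+ 2)%:E)%E.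
Proof.
move=> tphi t1; have mphi := test_function_measurable tphi.
have [->|tn0] := eqVneq t 0.
  rewrite /translation_energy scale0r expr0n mul0e.
  under eq_integral do rewrite add0r subrr expr0n.
  by rewrite integral0.
have [C [M [C0 M0 HC]]] := translate_difference i tphi.
pose h m : R := t / m.+1%:R.
have hn0 m : h m != 0 by rewrite mulf_neq0// invr_neq0// pnatr_eq0.
have h1 m : `|h m| <= 1.
  rewrite /h normrM normfV normr_nat; apply: mulr_ile1 => //.
  by rewrite invf_le1 ?ltr0n// ler1n.
have hc : h m @[m --> \oo] --> (0 : R).
  by rewrite -(mulr0 t); apply: cvgMl_tmp; exact: (@cvg_harmonic R).
pose q m z : R := ((h m)^-1 * (phi (h m *: basisv i + z) - phi z)) ^+ 2.
have mq m : measurable_fun setT (q m).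
  apply: measurable_funX; apply: measurable_funM => //; apply: measurable_funB => //.
  exact: measurable_translate.
have Hq m : (translation_energy phi (t *: basisv i) <= (t ^+ 2)%:E * \int[mu]_z (q m z)%:E)%E.
  have tE : t *: basisv i = \sum_(j < m.+1) h m *: basisv i :> V.
    by rewrite sumr_const card_ord -scaler_nat scalerA /h mulrCA mulfV ?mulr1 ?pnatr_eq0.
  rewrite [X in translation_energy _ X]tE.
  apply: le_trans (translation_energy_sum (fun=> h m *: basisv i) m.+1 mphi) _.
  have -> : translation_energy phi (h m *: basisv i) = ((h m ^+ 2)%:E * \int[mu]_z (q m z)%:E)%E.
    have mqe := proj2 (measurable_EFinP setT _) (mq m).
    rewrite -(ge0_integralZl _ measurableT mqe); last 2 first.
    - by move=> z _; rewrite lee_fin sqr_ge0.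
    - by rewrite lee_fin sqr_ge0.
    apply: eq_integral => z _; rewrite /= /q -EFinM -exprMn mulrA mulfV ?mul1r//.
  rewrite ge0_sume_const; last first.
    by apply: mule_ge0; rewrite ?lee_fin ?sqr_ge0//; apply: integral_ge0 => z _; rewrite lee_fin sqr_ge0.
  rewrite muleA muleA -!EFinM.
  rewrite (_ : m.+1%:R * m.+1%:R * h m ^+ 2 = t ^+ 2)//.
  by rewrite -expr2 -exprMn /h mulrCA mulfV ?mulr1// pnatr_eq0.
have [|||||_ _ Hc] := @dominated_convergence _ _ _ mu setT measurableT
  (fun m z => (q m z)%:E) (fun z => (('D_(basisv i) phi z) ^+ 2)%:E)
  (fun z => ((C ^+ 2) * \1_[set z : V | `|z - 0| < M] z)%:E).
- by move=> m; apply/measurable_EFinP.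
- exact: measurable_int (dirichlet_integrable i tphi).
- apply: aeW => z _; apply: cvg_EFin; first exact: nearW.
  have H := @difference_quotient_cvg R n A phi i h z tphi hn0 hc.
  exact: (cvgM H H).
- apply: (@integrableZl _ _ _ mu setT measurableT (C ^+ 2)
    (fun x => (\1_[set z : V | `|z - 0| < M] x)%:E)).
  apply: integrable_indic_lty; first exact: measurable_cube.
  by rewrite [ltLHS](measure_cube (0 : V) M0) ltry.
- apply: aeW => z m _; rewrite abse_EFin lee_fin ger0_norm ?sqr_ge0//.
  have Hz := HC (h m) z (h1 m); have hp : 0 < `|h m| by rewrite normr_gt0.
  have H : `|(h m)^-1 * (phi (h m *: basisv i + z) - phi z)| <=
      C * \1_[set z : V | `|z - 0| < M] z.
    by rewrite normrM normfV ler_pdivrMl// mulrCA mulrA.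
  rewrite /q -(real_normK (num_real _)).
  have Cn : 0 <= C * \1_[set z : V | `|z - 0| < M] z by rewrite mulr_ge0// ltW.
  apply: le_trans (lerXn2r 2 _ _ H) _; rewrite ?nnegrE//.
  by rewrite exprMn indicE; case: (_ \in _); rewrite /= ?expr1n ?expr0n.
have Hc' := cvgeZl (isT : (t ^+ 2)%:E \is a fin_num) Hc.
by apply: (cvge_ge _ Hc'); apply: nearW => m; exact: Hq.
Qed.

End translation.

(** Translating one coordinate at a time avoids directional derivatives. *)
Lemma translation_energy_le (R : realType) n (A : set 'rV[R]_n) (phi : 'rV[R]_n -> R^o) d :
  test_function A phi -> `|d| <= 1 ->
  (translation_energy phi d <=
   (n%:R * `|d| ^+ 2)%:E * \sum_(i < n) \int[lebesgue_rV n]_z (('D_(basisv i) phi z) ^+ 2)%:E)%E.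
Proof.
move=> tphi d1; have mphi := test_function_measurable tphi.
case: n A phi d d1 tphi mphi => [|m] A phi d d1 tphi mphi.
  rewrite big_ord0 mule0 /translation_energy.
  rewrite (eq_integral (cst 0%E)) ?integral0// => z _.
  by rewrite (_ : d + z = z) ?subrr ?expr0n//; apply/rowP => -[].
pose e (j : nat) : 'rV[R]_m.+1 := d ord0 (inord j) *: basisv (inord j).
have dE : d = \sum_(j < m.+1) e j.
  rewrite [LHS](row_sum_delta d).
  by apply: eq_bigr => j _; rewrite /e inord_val.
have H := translation_energy_sum e m.+1 mphi; rewrite -dE in H.
apply: (le_trans H).
rewrite EFinM -muleA lee_wpmul2l ?lee_fin//.
rewrite ge0_sume_distrr; last by move=> i _; apply: integral_ge0 => z _; rewrite lee_fin sqr_ge0.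
apply: lee_sum => j _; rewrite /e inord_val.
apply: le_trans (translation_energy_coord _ tphi _) _.
  exact: le_trans (coord_le_normv _ _) d1.
apply: lee_wpmul2r; first by apply: integral_ge0 => z _; rewrite lee_fin sqr_ge0.
rewrite lee_fin -(real_normK (num_real (d ord0 j))) lerXn2r ?nnegrE//.
exact: coord_le_normv.
Qed.

Section lower_integral.
Context d (T : measurableType d) (R : realType) (mu : {measure set T -> \bar R}).
Local Open Scope ereal_scope.

Import HBNNSimple.

(** The integral of a nonnegative function is a supremum over simple functions, so it
    is monotone without measurability. *)
Lemma le_lower_integral (D : set T) (f g : T -> \bar R) :
  (forall x, D x -> 0 <= f x) -> (forall x, D x -> f x <= g x) ->
  \int[mu]_(x in D) f x <= \int[mu]_(x in D) g x.
Proof.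
move=> f0 fg; rewrite integral_mkcond [leRHS]integral_mkcond.
have f0' x : 0 <= (f \_ D) x by rewrite patchE; case: ifPn => // /set_mem /f0.
have fg' x : (f \_ D) x <= (g \_ D) x.
  by rewrite !patchE; case: ifPn => // /set_mem /fg.
rewrite !ge0_integralTE//; last by move=> x; exact: le_trans (f0' x) (fg' x).
apply: ge_ereal_sup => _ [/= h hf <-]; apply: ereal_sup_ubound; exists h => //= x.
exact: le_trans (hf x) (fg' x).
Qed.

End lower_integral.

Section approximation.
Context {R : realType} {n : nat}.
Local Notation V := 'rV[R]_n.
Local Notation mu := (@lebesgue_rV R n).
Implicit Types (w g : V -> R) (A : set V).

(** Almost everywhere measurable functions are replaced by Borel ones on the whole
    space, for which the integration theorems apply. *)
Lemma L2_borel A w : open A -> in_L2 mu A w ->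
  exists g : V -> R, [/\ measurable_fun setT g, {ae mu, forall x, A x -> w x = g x},
    forall x, ~ A x -> g x = 0 &
    exists2 c : R, 0 <= c & (\int[mu]_x ((g x) ^+ 2)%:E = c%:E)%E].
Proof.
move=> oA [[h mh wh] wfin]; have mA := open_measurable_rV oA.
have wg : {ae mu, forall x, A x -> w x = (h \_ A) x}.
  by apply: filterS wh => x Hx Ax; rewrite patchE mem_set// Hx.
have gA x : ~ A x -> (h \_ A) x = 0 by move=> nA; rewrite patchE memNset.
have E : (\int[mu]_x (((h \_ A) x) ^+ 2)%:E = \int[mu]_(x in A) ((w x) ^+ 2)%:E)%E.
  rewrite -(@integral_out0 _ _ _ mu A); last by move=> x nA; rewrite gA// expr0n.
  by apply: ae_eq_lower_integral; apply: filterS wg => x Hx Ax; rewrite Hx.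
have I0 : (0 <= \int[mu]_(x in A) ((w x) ^+ 2)%:E)%E.
  by apply: integral_ge0 => x _; rewrite lee_fin sqr_ge0.
exists (h \_ A); split=> //.
  by apply/(measurable_restrictT _ mA).
exists (fine (\int[mu]_(x in A) ((w x) ^+ 2)%:E)); first by rewrite fine_ge0.
by rewrite fineK// ge0_fin_numE.
Qed.

(** The bound [M] on the Dirichlet integral does not depend on the accuracy [e], so that
    [e] can later be chosen in terms of the size of the cubes. *)
Lemma H10_approximation A w : open A -> sobolev_H10 A w ->
  exists g : V -> R, [/\ measurable_fun setT g, {ae mu, forall x, A x -> w x = g x} &
  exists2 M : R, 0 < M & forall e : R, 0 < e <= 1 ->
    exists phi : V -> R^o, [/\ test_function A phi,
      (\int[mu]_x ((g x - phi x) ^+ 2 * \1_A x)%:E <= e%:E)%E &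
      (\sum_i \int[mu]_x (('D_(basisv i) phi x) ^+ 2)%:E <= M%:E)%E]].
Proof.
move=> oA [[wL2 [G wG GL2]] _ Happ]; have mA := open_measurable_rV oA.
have [g [mg wg gA _]] := L2_borel oA wL2.
have /choice[f Hf] : forall i, exists f : V -> R, [/\ measurable_fun setT f,
    {ae mu, forall x, A x -> G x ord0 i = f x}, forall x, ~ A x -> f x = 0 &
    exists2 c : R, 0 <= c & (\int[mu]_x ((f x) ^+ 2)%:E = c%:E)%E].
  by move=> i; exact: L2_borel (GL2 i).
have /choice[c Hc] : forall i, exists c : R, 0 <= c /\ (\int[mu]_x ((f i x) ^+ 2)%:E = c%:E)%E.
  by move=> i; have [_ _ _ [c]] := Hf i; exists c.
set W := weak_gradient A w in Happ.
have Wf i : {ae mu, forall x, A x -> W x ord0 i = f i x}.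
  have [_ H _ _] := Hf i.
  apply: filterS2 (weak_gradient_unique oA (weak_gradientP wG) wG i) H => x E1 E2 Ax.
  by rewrite -E2// -E1.
exists g; split=> //; exists (1 + \sum_i (2 + 2 * c i)).
  by rewrite ltr_wpDr// sumr_ge0// => i _; have [? _] := Hc i; rewrite addr_ge0// mulr_ge0.
move=> e /andP[e0 e1]; have [phi tphi Hphi] := Happ e e0.
have mphi := test_function_measurable tphi.
have psum0 x : 0 <= \sum_i (W x ord0 i - 'D_(basisv i) phi x) ^+ 2.
  by apply: sumr_ge0 => i _; exact: sqr_ge0.
exists phi; split=> //.
  apply: le_trans (ltW Hphi).
  apply: (@le_trans _ _ (\int[mu]_(x in A) ((w x - phi x) ^+ 2)%:E)%E); last first.
    apply: le_lower_integral => x Ax; rewrite lee_fin ?sqr_ge0//.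
    by rewrite lerDl.
  rewrite le_eqVlt; apply/orP; left; apply/eqP.
  rewrite -(@integral_out0 _ _ _ mu A); last by move=> x nA; rewrite indicE memNset// mulr0.
  apply: ae_eq_lower_integral; apply: filterS wg => x Hx Ax.
  by rewrite indicE mem_set// mulr1 Hx.
rewrite (@le_trans _ _ (\sum_i (2 + 2 * c i)%:E)%E)//; last first.
  by rewrite sumEFin lee_fin lerDr.
apply: lee_sum => i _; have [mfi _ fA _] := Hf i; have [_ cE] := Hc i.
have tD := test_function_partial i tphi; have mD := test_function_measurable tD.
set D := fun x => 'D_(basisv i) phi x in tD mD.
have m1 : measurable_fun setT (fun x => ((f i x - D x) ^+ 2)%:E : \bar R).
  by apply/measurable_EFinP; apply: measurable_funX; exact: measurable_funB.
have m2 : measurable_fun setT (fun x => ((f i x) ^+ 2)%:E : \bar R).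
  by apply/measurable_EFinP; apply: measurable_funX.
have s0 (a : R) : (0 <= (a ^+ 2)%:E)%E by rewrite lee_fin sqr_ge0.
apply: (@le_trans _ _ (\int[mu]_x (2%:E * ((f i x - D x) ^+ 2)%:E + 2%:E * ((f i x) ^+ 2)%:E))%E).
  apply: le_lower_integral => x _ //.
  rewrite -!EFinM -EFinD lee_fin -/(D x) !expr2.
  by have := sqr_ge0 (2 * f i x - D x); rewrite expr2; nra.
have two0 : (0 <= 2%:E :> \bar R)%E by rewrite lee_fin.
rewrite ge0_integralD//; first last.
- exact: emeasurable_funM.
- by move=> x _; rewrite mule_ge0.
- exact: emeasurable_funM.
- by move=> x _; rewrite mule_ge0.
rewrite (ge0_integralZl _ measurableT m1)// (ge0_integralZl _ measurableT m2)// cE.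
rewrite [leRHS]EFinD -[(2%:E * (c i)%:E)%E]EFinM; apply: leeD => //.
rewrite -[leRHS]mule1 lee_wpmul2l//.
apply: (@le_trans _ _ e%:E); last by rewrite lee_fin.
apply: le_trans (ltW Hphi).
rewrite -(@integral_out0 _ _ _ mu A); last first.
  by move=> x nA; rewrite fA// (test_function_out tD nA) subrr expr0n.
rewrite (@ae_eq_lower_integral _ _ _ mu A _ (fun x => ((W x ord0 i - D x) ^+ 2)%:E)); last first.
  by apply: filterS (Wf i) => x Hx Ax; rewrite Hx.
apply: le_lower_integral => x Ax //; rewrite lee_fin.
rewrite (bigD1 i)//= -/(D x) addrCA lerDl addr_ge0 ?sqr_ge0//.
by apply: sumr_ge0 => j _; exact: sqr_ge0.
Qed.

End approximation.

Section averaging.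
Context {R : realType} {n : nat}.
Local Notation V := 'rV[R]_n.
Local Notation mu := (@lebesgue_rV R n).

(** The lower bound is integrated over [S] and the integrals are exchanged: a given [z]
    lies in the cube around [x + v] only for [x] in a cube of the same size. *)
Lemma averaging (S : set V) (H : V -> R) (v : V) (r b : R) :
  measurable S -> measurable_fun setT H -> (forall z, 0 <= H z) -> 0 < r -> 0 <= b ->
  (forall x, S x ->
    (b%:E <= \int[mu]_(z in [set z : V | (`|z - (x + v)| < r)%R]) (H z)%:E)%E) ->
  (b%:E * mu S <= ((2 * r) ^+ n)%:E * \int[mu]_z (H z)%:E)%E.
Proof.
move=> mS mH H0 r0 b0 HS.
pose U : set (V * V) := [set q | `|q.2 - (q.1 + v)| < r].
have mU : measurable U.
  have mf : measurable_fun setT (fun q : V * V => q.2 - (q.1 + v) : V).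
    apply: measurable_fun_rV => i.
    rewrite (_ : _ \o _ = fun q : V * V => q.2 ord0 i - (q.1 ord0 i + v ord0 i)); last first.
      by apply/funext => q; rewrite /rV_coord /= !mxE.
    apply: measurable_funB.
      exact: (measurableT_comp (measurable_coord i) measurable_snd).
    apply: measurable_funD => //.
    exact: (measurableT_comp (measurable_coord i) measurable_fst).
  rewrite (_ : U = (fun q : V * V => q.2 - (q.1 + v)) @^-1` [set z | `|z - 0| < r]).
    by rewrite -[X in measurable X]setTI; apply: mf => //; exact: measurable_cube.
  by apply/seteqP; split=> q /=; rewrite subr0.
pose K (q : V * V) : \bar R := (\1_S q.1 * \1_U q * H q.2)%:E.
have mK : measurable_fun setT K.
  apply/measurable_EFinP; apply: measurable_funM; last exact: measurableT_comp mH measurable_snd.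
  apply: measurable_funM; last exact: measurable_indic.
  exact: (measurableT_comp (measurable_indic mS) measurable_fst).
have K0 q : (0 <= K q)%E by rewrite lee_fin !mulr_ge0.
apply: (@le_trans _ _ (\int[mu]_x \int[mu]_z K (x, z))%E).
  have -> : mu S = (\int[mu]_x (\1_S x)%:E)%E by rewrite integral_indic// setIT.
  have mSe : measurable_fun setT (fun x => (\1_S x)%:E : \bar R).
    by apply/measurable_EFinP; exact: measurable_indic.
  rewrite -(ge0_integralZl _ measurableT mSe)//.
  apply: ge0_le_integral => //.
  - by move=> x _; rewrite -EFinM lee_fin mulr_ge0.
  - by apply/measurable_EFinP; apply: measurable_funM => //; exact: measurable_indic.
  - by apply: (measurable_fun_fubini_tonelli_F K).
  move=> x _; rewrite -EFinM indicE; have [/set_mem Sx|_] := boolP (x \in S); last first.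
    by rewrite mulr0; apply: integral_ge0.
  rewrite mulr1; apply: le_trans (HS _ Sx) _.
  rewrite integral_mkcond le_eqVlt; apply/orP; left; apply/eqP.
  apply: eq_integral => z _; rewrite patchE /K /= !indicE (mem_set Sx) mul1r.
  have -> : ((x, z) \in U) = (z \in [set z | `|z - (x + v)| < r]).
    by apply/idP/idP; rewrite !inE.
  by case: (z \in _); rewrite ?mul1r ?mul0r.
rewrite (fubini_tonelli K)//.
have mHe := proj2 (measurable_EFinP setT _) mH.
rewrite -(ge0_integralZl _ measurableT mHe)//; last 2 first.
- by move=> z _; rewrite lee_fin.
- by rewrite lee_fin exprn_ge0// mulr_ge0// ltW.
apply: ge0_le_integral => //.
- by move=> z _; apply: integral_ge0.
- by apply: (measurable_fun_fubini_tonelli_G K).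
- exact: emeasurable_funM.
move=> z _.
pose Q := [set x : V | `|x - (z - v)| < r].
have mQ : measurable Q by exact: measurable_cube.
apply: (@le_trans _ _ (\int[mu]_x ((H z)%:E * (\1_Q x)%:E))%E).
  apply: le_lower_integral => x _ //; rewrite -EFinM lee_fin /K /= mulrC ler_wpM2l//.
  have -> : \1_U (x, z) = \1_Q x :> R.
    have E : `|z - (x + v)| = `|x - (z - v)|.
      by rewrite -normrN; congr (`|_|); rewrite !opprB addrA.
    rewrite !indicE; congr (_%:R); congr nat_of_bool.
    by apply/idP/idP; rewrite !inE /U /Q /= E.
  by rewrite ler_piMl// indicE; case: (x \in S).
have mQe : measurable_fun setT (fun x => (\1_Q x)%:E : \bar R).
  by apply/measurable_EFinP; exact: measurable_indic.
rewrite (ge0_integralZl _ measurableT mQe)//; last by rewrite lee_fin.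
by rewrite integral_indic// setIT [X in (_ * X <= _)%E](measure_cube (z - v) r0) muleC.
Qed.

End averaging.

Section good_cube.
Context {R : realType} {n : nat}.
Local Notation V := 'rV[R]_n.
Local Notation mu := (@lebesgue_rV R n).

(** The part near [x0] of the boundary layer of thickness [tau] in the direction [v]. *)
Definition layer (A : set V) (x0 v : V) (d tau : R) : set V :=
  [set x | `|x - x0| < d] `&` A `\` [set x | A (x - tau *: v)].

Lemma measurable_layer A x0 v d tau : open A -> measurable (layer A x0 v d tau).
Proof.
move=> oA; have mA := open_measurable_rV oA; apply: measurableD.
  by apply: measurableI => //; exact: measurable_cube.
rewrite (_ : [set x | A (x - tau *: v)] = (fun x => 1 *: x + - (tau *: v)) @^-1` A).
  by rewrite -[X in measurable X]setTI; exact: (measurable_isometry 1 (- (tau *: v)) measurableT mA).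
by apply/seteqP; split=> x /=; rewrite scale1r.
Qed.

(** A thick layer is covered by translates of thin ones: on its way back along [v],
    a point leaves [A] within one of the [m] steps. *)
Lemma layer_measure A x0 v (a d T : R) m : open A -> 0 <= T -> (0 < m)%N ->
  a + T * `|v| <= d -> (forall x, A x -> `|x - x0| < a -> ~ A (x - T *: v)) ->
  (mu (A `&` [set x | (`|x - x0| < a)%R]) <= m%:R%:E * mu (layer A x0 v d (T / m%:R)))%E.
Proof.
move=> oA T0 m0 ad HT; pose tau := T / m%:R.
have mL := measurable_layer x0 v d tau oA.
have mm0 : m%:R != 0 :> R by rewrite pnatr_eq0 -lt0n.
pose F (j : nat) := (fun x => 1 *: x + - ((j%:R * tau) *: v)) @^-1` layer A x0 v d tau.
have mF j : measurable (F j).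
  by rewrite -[X in measurable X]setTI; exact: (measurable_isometry 1 _ measurableT mL).
have FE j : mu (F j) = mu (layer A x0 v d tau).
  by apply: lebesgue_rV_isometry => //; left.
have mU : measurable (\big[setU/set0]_(j < m) F j) by exact: bigsetU_measurable.
apply: (@le_trans _ _ (mu (\big[setU/set0]_(j < m) F j))).
  apply: le_measure; rewrite ?inE//.
    by apply: measurableI; [exact: open_measurable_rV|exact: measurable_cube].
  move=> x [Ax xa].
  have nAT : ~ A (x - (m%:R * tau) *: v).
    by rewrite /tau mulrCA mulfV// mulr1; exact: HT.
  have exit k : ~ A (x - (k%:R * tau) *: v) -> exists2 j, (j < k)%N &
      A (x - (j%:R * tau) *: v) /\ ~ A (x - (j.+1%:R * tau) *: v).
    elim: k => [|k IH] nAk; first by exfalso; apply: nAk; rewrite mul0r scale0r subr0.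
    have [Ak|nAk'] := pselect (A (x - (k%:R * tau) *: v)); first by exists k.
    by have [j jm Hj] := IH nAk'; exists j => //; exact: ltnW.
  have [j jm [Aj nAj]] := exit _ nAT.
  rewrite -(bigcup_mkord m F); exists j => //=; rewrite /F /layer /= scale1r.
  split; last first.
    move=> H; apply: nAj; move: H; congr A.
    by rewrite -addrA -opprD -scalerDl -natr1 mulrDl mul1r.
  split=> //; apply: lt_le_trans ad.
  rewrite addrAC; apply: le_lt_trans (ler_normD _ _) _.
  apply: ltr_leD => //; rewrite normrN normrZ ler_wpM2r// ger0_norm.
    rewrite /tau mulrCA ler_piMr// ler_pdivrMr ?ltr0n// mul1r ler_nat.
    exact: ltnW.
  by rewrite mulr_ge0// divr_ge0.
apply: (le_trans (@Boole_inequality _ _ _ mu F m (fun j _ => mF j))).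
rewrite (eq_bigr (fun=> mu (layer A x0 v d tau))) => [|j _]; last exact: FE.
by rewrite ge0_sume_const.
Qed.

End good_cube.

(** The cube is centred at [x + tau v] for some [x] in the layer of thickness [tau].
    The cone condition, used forwards from [x] and backwards to [x - tau v], puts the
    cube inside [A] and its translate by [- 3 tau v] outside, where test functions
    vanish; so the mean of [w^2] is controlled by a translation energy of order
    [tau^2]. The layer having measure of order [tau], averaging leaves a mean of order
    [tau]. *)
Lemma good_cube (R : realType) n (A : set 'rV[R]_n) (x0 v : 'rV[R]_n) (rho kappa : R) :
  open A -> boundary A x0 -> 0 < rho -> 0 < kappa <= 1 -> cone_property A x0 v rho kappa ->
  forall w (eps tau0 : R), sobolev_H10 A w -> 0 < eps -> 0 < tau0 ->
  exists tau y, [/\ 0 < tau < tau0,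
    forall z, `|z - y| <= kappa * tau ->
      A z /\ 0 < dist_boundary A z <= n%:R * (3 * (`|v| + 1)) * tau &
    (\int[lebesgue_rV n]_(z in [set z : 'rV[R]_n | (`|z - y| < kappa * tau)%R]) ((w z) ^+ 2)%:E
      <= (eps * (2 * (kappa * tau)) ^+ n)%:E)%E].
Proof.
move=> oA Bx0 rho0 /andP[k0 k1] cone w eps tau0 wH eps0 tau00.
have [g [mg wg [M M0 Happ]]] := H10_approximation oA wH.
set V0 := `|v|; have V00 : 0 <= V0 by exact: normr_ge0.
(* All translations used below stay within the ball of radius rho around x0, and have
   length at most 1. *)
pose T := Num.min rho 1 / (2 * (2 + 3 * V0)).
have D0 : 0 < 2 + 3 * V0 by rewrite ltr_wpDr// mulr_ge0.
have mr0 : 0 < Num.min rho 1 by rewrite lt_min rho0 ltr01.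
have T0 : 0 < T by rewrite divr_gt0// mulr_gt0.
have TE : T * (2 + 3 * V0) = Num.min rho 1 / 2 by rewrite /T; field; rewrite gt_eqF.
have Tr : T * (2 + 3 * V0) < rho.
  have H : Num.min rho 1 <= rho by rewrite ge_min lexx.
  by rewrite TE; lra.
have T1 : T * (2 + 3 * V0) <= 1 / 2.
  by rewrite TE ler_pM2r ?invr_gt0// ge_min lexx orbT.
pose a := kappa * T. have a0 : 0 < a by rewrite mulr_gt0.
have aT : a <= T by rewrite ler_piMl// ltW.
have TV0 : 0 <= T * V0 by rewrite mulr_ge0// ltW.
have Trho : T < rho by lra.
pose d := a + T * V0.
have drho : d < rho by rewrite /d; lra.
(* Otherwise the boundary point x0 would lie in a cone inside A. *)
have Bout : forall x, A x -> `|x - x0| < a -> ~ A (x - T *: v).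
  move=> x Ax xa AxT; apply: (boundary_out oA Bx0).
  apply: (cone (x - T *: v) x0 T _ _ _ AxT).
  - rewrite addrAC; apply: le_lt_trans (ler_normB _ _) _.
    by rewrite normrZ (gtr0_norm T0) -/V0; lra.
  - by rewrite T0.
  - by rewrite -[x0 - _ - _]addrA -opprD subrK -normrN opprB ltW.
pose B0 := A `&` [set x | `|x - x0| < a].
have mB0 : measurable B0.
  by apply: measurableI; [exact: open_measurable_rV|exact: measurable_cube].
have [b0 b0A b0a] := closure_normvE (proj1 Bx0) a0.
have [e1 e10 He1] := open_normv oA b0A.
pose e2 := Num.min e1 (a - `|b0 - x0|).
have e20 : 0 < e2 by rewrite lt_min e10 subr_gt0.
have B0sub : [set z | `|z - b0| < e2] `<=` B0.
  move=> z /= ze; split; first by apply: He1; apply: lt_le_trans ze _; rewrite ge_min lexx.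
  have H : `|z - b0| < a - `|b0 - x0| by apply: lt_le_trans ze _; rewrite ge_min lexx orbT.
  by apply: le_lt_trans (ler_distD b0 _ _) _; lra.
have B0fin : (lebesgue_rV n B0 < +oo)%E.
  apply: (@le_lt_trans _ _ (lebesgue_rV n [set z | `|z - x0| < a])).
    by apply: le_measure; rewrite ?inE//; [exact: measurable_cube|move=> z []].
  by rewrite [ltLHS](measure_cube x0 a0) ltry.
have B0pos : (0 < lebesgue_rV n B0)%E.
  apply: (@lt_le_trans _ _ (lebesgue_rV n [set z | `|z - b0| < e2])).
    by rewrite [ltRHS](measure_cube b0 e20) lte_fin exprn_gt0// mulr_gt0.
  by apply: le_measure; rewrite ?inE//; exact: measurable_cube.
pose m0 := fine (lebesgue_rV n B0).
have m00 : 0 < m0 by rewrite fine_gt0// B0pos.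
have m0E : lebesgue_rV n B0 = m0%:E by rewrite fineK// ge0_fin_numE// ltW.
pose C := 2 * (n%:R * (3 * V0) ^+ 2 * M) + 2.
have C0 : 0 < C by rewrite ltr_wpDl// !mulr_ge0 ?exprn_ge0 ?mulr_ge0// ltW.
(* tau is T / m with m > q: the first term makes tau smaller than tau0, the second makes
   the energy C tau^2, divided by the measure m0 / m of the layer, smaller than eps. *)
pose q := T / tau0 + C * T ^+ 2 / (eps * m0).
have q1 : 0 <= T / tau0 by apply: divr_ge0; exact: ltW.
have q2 : 0 <= C * T ^+ 2 / (eps * m0).
  by apply: divr_ge0; apply: mulr_ge0; rewrite ?exprn_ge0// ltW.
have q0 : 0 <= q by exact: addr_ge0.
pose m := (Num.truncn q).+1.
have qm : q < m%:R by exact: truncnS_gt.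
have mR0 : 0 < m%:R :> R by rewrite ltr0n.
have m1 : 1 <= m%:R :> R by rewrite ler1n.
pose tau := T / m%:R.
have t0 : 0 < tau by rewrite divr_gt0.
have tT : tau <= T by rewrite ler_pdivrMr// ler_peMr// ltW.
have ttau0 : tau < tau0.
  rewrite ltr_pdivrMr// mulrC -ltr_pdivrMr//; apply: le_lt_trans qm.
  by rewrite lerDl.
have Cm : C * T ^+ 2 < m%:R * (eps * m0).
  rewrite -ltr_pdivrMr ?mulr_gt0//; apply: le_lt_trans qm.
  by rewrite lerDr.
have tau1 : tau <= 1 by lra.
have e01 : 0 < tau ^+ 2 <= 1 by rewrite exprn_gt0//= exprn_ile1// ltW.
have [phi [tphi Hg Hphi]] := Happ _ e01.
have mphi := test_function_measurable tphi.
pose dv := - (3 * tau) *: v.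
have dvE : `|dv| = 3 * tau * V0 by rewrite normrZ normrN gtr0_norm// mulr_gt0.
have tV : tau * V0 <= T * V0 by rewrite ler_wpM2r.
have dv1 : `|dv| <= 1 by rewrite dvE; lra.
pose H (z : 'rV[R]_n) : R := 2 * (phi (dv + z) - phi z) ^+ 2 + 2 * ((g z - phi z) ^+ 2 * \1_A z).
have mI1 : measurable_fun setT (fun z => (phi (dv + z) - phi z) ^+ 2 : R).
  by apply: measurable_funX; apply: measurable_funB => //; exact: measurable_translate.
have mI2 : measurable_fun setT (fun z => (g z - phi z) ^+ 2 * \1_A z : R).
  apply: measurable_funM; last by apply: measurable_indic; exact: open_measurable_rV.
  by apply: measurable_funX; exact: measurable_funB.
have p1 z : 0 <= (phi (dv + z) - phi z) ^+ 2 by exact: sqr_ge0.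
have p2 z : 0 <= (g z - phi z) ^+ 2 * \1_A z by rewrite mulr_ge0// sqr_ge0.
have H0 z : 0 <= H z by rewrite addr_ge0// mulr_ge0.
have mH : measurable_fun setT H by apply: measurable_funD; exact: measurable_funM.
have HC : (\int[lebesgue_rV n]_z (H z)%:E <= (C * tau ^+ 2)%:E)%E.
  have mI1e := proj2 (measurable_EFinP setT _) mI1.
  have mI2e := proj2 (measurable_EFinP setT _) mI2.
  rewrite (_ : (\int[lebesgue_rV n]_z (H z)%:E)%E =
    (2%:E * translation_energy phi dv +
     2%:E * \int[lebesgue_rV n]_z ((g z - phi z) ^+ 2 * \1_A z)%:E)%E); last first.
    rewrite -(ge0_integralZl _ measurableT mI1e)//; last by move=> z _; rewrite lee_fin.
    rewrite -(ge0_integralZl _ measurableT mI2e)//; last by move=> z _; rewrite lee_fin.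
    rewrite -ge0_integralD//.
    - by move=> z _; rewrite mule_ge0// lee_fin.
    - exact: emeasurable_funM.
    - by move=> z _; rewrite mule_ge0// lee_fin.
    - exact: emeasurable_funM.
  have HT := translation_energy_le tphi dv1.
  have HT2 : (translation_energy phi dv <= (n%:R * (3 * tau * V0) ^+ 2 * M)%:E)%E.
    apply: le_trans HT _; rewrite [leRHS]EFinM dvE; apply: lee_wpmul2l => //.
    by rewrite lee_fin mulr_ge0// sqr_ge0.
  apply: (@le_trans _ _ (2%:E * (n%:R * (3 * tau * V0) ^+ 2 * M)%:E + 2%:E * (tau ^+ 2)%:E)%E).
    by apply: leeD; apply: lee_wpmul2l => //; rewrite lee_fin.
  by rewrite -!EFinM -EFinD lee_fin /C le_eqVlt; apply/orP; left; apply/eqP; ring.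
have d_ad : a + T * `|v| <= d by rewrite /d.
have HL := layer_measure oA (ltW T0) (ltn0Sn _ : (0 < m)%N) d_ad Bout.
rewrite -/B0 -/tau m0E in HL.
have mL := measurable_layer x0 v d tau oA.
pose r := kappa * tau. have r0 : 0 < r by rewrite mulr_gt0.
have rn0 : 0 < (2 * r) ^+ n by rewrite exprn_gt0// mulr_gt0.
have [x Lx Hx] : exists2 x, layer A x0 v d tau x &
    (\int[lebesgue_rV n]_(z in [set z : 'rV[R]_n | (`|z - (x + tau *: v)| < r)%R]) (H z)%:E
       <= (eps * (2 * r) ^+ n)%:E)%E.
  apply: contrapT => nx.
  have b0' : 0 <= eps * (2 * r) ^+ n by rewrite mulr_ge0 ?(ltW eps0) ?(ltW rn0).
  have HS x : layer A x0 v d tau x -> ((eps * (2 * r) ^+ n)%:E <=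
      \int[lebesgue_rV n]_(z in [set z : 'rV[R]_n | (`|z - (x + tau *: v)| < r)%R]) (H z)%:E)%E.
    by move=> Lx; apply/ltW; rewrite ltNge; apply/negP => Hx; apply: nx; exists x.
  have Hav := averaging mL mH H0 r0 b0' HS.
  have H1 := le_trans Hav (lee_wpmul2l _ HC).
  have : ((eps * (2 * r) ^+ n * m0)%:E <= (m%:R * ((2 * r) ^+ n * (C * tau ^+ 2)))%:E)%E.
    rewrite [leLHS]EFinM; apply: le_trans (lee_wpmul2l _ HL) _; first by rewrite lee_fin.
    rewrite muleCA [leRHS]EFinM; apply: lee_wpmul2l; first by rewrite lee_fin.
    by rewrite EFinM; apply: H1; rewrite lee_fin ltW.
  rewrite lee_fin leNgt => /negP; apply.
  rewrite [X in X < _](_ : _ = (2 * r) ^+ n / m%:R * (C * T ^+ 2)); last first.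
    by rewrite /tau; field; rewrite gt_eqF.
  rewrite [X in _ < X](_ : _ = (2 * r) ^+ n / m%:R * (m%:R * (eps * m0))); last first.
    by field; rewrite gt_eqF.
  by rewrite ltr_pM2l// divr_gt0.
have t20 : 0 < 2 * tau by rewrite mulr_gt0.
have t30 : 0 < 3 * tau by rewrite mulr_gt0.
have [[/= xd Ax] nAx] := Lx.
have far z : `|z - (x + tau *: v)| <= r -> A z /\ ~ A (z - (3 * tau) *: v).
  move=> zr; split.
    apply: (cone x z tau) => //.
    - exact: lt_trans xd drho.
    - by rewrite t0/= (le_lt_trans tT).
    - by rewrite -addrA -opprD.
  move=> Az; apply: nAx; apply: (cone (z - (3 * tau) *: v) _ tau) Az.
  - have -> : z - (3 * tau) *: v - x0 = (z - (x + tau *: v)) + (x - x0) - (2 * tau) *: v.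
      by apply/rowP => i; rewrite !mxE; ring.
    apply: le_lt_trans (ler_normB _ _) _; rewrite normrZ (gtr0_norm t20) -/V0.
    have := ler_normD (z - (x + tau *: v)) (x - x0).
    have rT : r <= T by apply: le_trans tT; rewrite ler_piMl// ltW.
    by move: xd zr tV; rewrite /d; lra.
  - by rewrite t0/= (le_lt_trans tT).
  - rewrite (_ : x - tau *: v - (z - (3 * tau) *: v) - tau *: v = x + tau *: v - z).
      by rewrite -normrN opprB.
    by apply/rowP => i; rewrite !mxE; ring.
exists tau, (x + tau *: v); split.
- by rewrite t0.
- move=> z zr; have [Az nAz] := far z zr; split=> //; rewrite (dist_boundary_gt0 oA Az Bx0)/=.
  have [t /andP[t00 t01] Bp] := segment_boundary oA Az nAz.
  apply: le_trans (dist_boundary_le z Bp) _; apply: le_trans (enorm_le _) _.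
  rewrite -!mulrA ler_wpM2l// opprD addrA subrr add0r normrN normrZ (ger0_norm t00).
  rewrite addrAC subrr add0r normrN normrZ (gtr0_norm t30).
  apply: (@le_trans _ _ (1 * (3 * tau * `|v|))).
    by apply: ler_wpM2r => //; apply: mulr_ge0 => //; exact: ltW.
  rewrite mul1r -mulrA ler_pM2l// mulrC ler_pM2r// lerDl//.
- apply: le_trans Hx.
  set Q := [set z | _]; have QA z : Q z -> A z by move=> /ltW /far[].
  rewrite (@ae_eq_lower_integral _ _ _ _ Q _ (fun z => ((g z) ^+ 2)%:E)); last first.
    by apply: filterS wg => z Hz /QA Az; rewrite Hz.
  apply: le_lower_integral => z Qz; first by rewrite lee_fin sqr_ge0.
  have [Az nAz] := far z (ltW Qz).
  rewrite lee_fin /H indicE mem_set// mulr1 (_ : dv + z = z - (3 * tau) *: v); last first.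
    by rewrite /dv addrC scaleNr.
  rewrite (test_function_out tphi nAz) sub0r sqrrN !expr2.
  by have := sqr_ge0 (g z - 2 * phi z); rewrite expr2; nra.
Qed.

(** * Bumps on cubes *)

Section cube_bump.
Context {R : realType} {n : nat}.
Local Notation V := 'rV[R]_n.
Local Notation mu := (@lebesgue_rV R n).

Definition cube (y : V) (r : R) : set V := [set z | `|z - y| < r].

Lemma open_cube (y : V) r : open (cube y r).
Proof.
rewrite (_ : cube y r = ball y r); first exact: ball_open.
by rewrite -ball_normE /=; apply/seteqP; split=> z /=; rewrite /cube /= -normrN opprB.
Qed.

Definition unit_bump : V -> R^o := boxbump 1 (const_mx (- 2^-1)) (const_mx 2^-1).

Definition cube_bump (y : V) (r : R) : V -> R^o := fun z => unit_bump (r^-1 *: z + - (r^-1 *: y)).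

Lemma unit_bump_test : test_function (cube 0 1) unit_bump.
Proof.
apply: boxbump_test => // x Hx; rewrite /cube /= subr0.
apply: (@le_lt_trans _ _ 2^-1); last by rewrite invf_lt1// ltr1n.
apply: normv_le => // j; have := Hx j.
by rewrite /= in_itv /= !mxE -ler_norml.
Qed.

Lemma cube_bump_arg (y z : V) r : 0 < r -> cube 0 1 (r^-1 *: z + - (r^-1 *: y)) <-> cube y r z.
Proof.
move=> r0; rewrite /cube /= subr0 -scalerBr normrZ gtr0_norm ?invr_gt0//.
by rewrite ltr_pdivrMl// mulr1.
Qed.

Lemma cube_bump_out (y z : V) r : 0 < r -> ~ cube y r z -> cube_bump y r z = 0.
Proof.
move=> r0 nz; apply: (test_function_out unit_bump_test).
by move/(cube_bump_arg _ _ r0).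
Qed.

Lemma cube_bump_ge0 y r z : 0 <= cube_bump y r z.
Proof. exact: boxbump_ge0. Qed.

Lemma cube_bump_le1 y r z : cube_bump y r z <= 1.
Proof. exact: boxbump_le1. Qed.

Lemma cube_bump_test (y : V) r : 0 < r -> test_function (cube y r) (cube_bump y r).
Proof.
move=> r0; apply/test_functionP; split.
  by apply: smooth_affine; exact: (proj1 unit_bump_test).
have h0 : 0 < r / 2 by rewrite divr_gt0.
exists (closed_box (y - const_mx (r / 2)) (y + const_mx (r / 2))); split.
- exact: compact_box.
- move=> z Hz; apply: (@le_lt_trans _ _ (r / 2)); last by rewrite ltr_pdivrMr// ltr_pMr// ltr1n.
  apply: normv_le => [|j]; first exact: ltW.
  have := Hz j; rewrite /= in_itv /= !mxE => /andP[? ?].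
  by rewrite ler_norml; apply/andP; split; lra.
move=> z nz; apply: boxbump_out => // H; apply: nz => j; have := H j.
rewrite /= !in_itv /= !mxE -mulrBr ltr_pdivlMl// ltr_pdivrMl// => /andP[? ?].
by apply/andP; split; lra.
Qed.

(** Each derivative of the rescaled bump brings out a factor 1 / r. *)
Lemma cube_bump_laplacian : exists2 K : R, 0 < K & forall y r z, 0 < r ->
  `|\sum_i 'D_(basisv i) (fun x => 'D_(basisv i) (cube_bump y r) x) z| <=
  K * r ^- 2 * \1_(cube y r) z.
Proof.
have tD i : test_function (cube 0 1)
    (fun x => 'D_(basisv i) (fun x => 'D_(basisv i) unit_bump x) x).
  exact/test_function_partial/test_function_partial/unit_bump_test.
have /choice[K HK] : forall i, exists K : R,
    0 < K /\ forall x, `|'D_(basisv i) (fun x => 'D_(basisv i) unit_bump x) x| <= K.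
  by move=> i; have [K K0 HK] := test_function_bounded (tD i); exists K.
have K0 : 0 <= \sum_i K i by apply: sumr_ge0 => i _; rewrite ltW//; have [] := HK i.
exists (1 + \sum_i K i) => [|y r z r0]; first by rewrite ltr_wpDr.
have [sb _] := unit_bump_test.
set T := fun x : V => r^-1 *: x + - (r^-1 *: y).
have D1 i : (fun x => 'D_(basisv i) (cube_bump y r) x) =
    (fun x => r^-1 * 'D_(basisv i) unit_bump (T x)).
  apply/funext => x.
  by have [_ ->] := is_derive_affine (smooth_is_derive (T x) i sb).
have D2 i : 'D_(basisv i) (fun x => 'D_(basisv i) (cube_bump y r) x) z =
    r ^- 2 * 'D_(basisv i) (fun x => 'D_(basisv i) unit_bump x) (T z).
  rewrite D1; have sd := smooth_partial i sb.
  have H := is_derive_affine (smooth_is_derive (T z) i sd).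
  have [_ ->] := is_deriveZ r^-1 H.
  by rewrite /GRing.scale /= mulrA -invfM -expr2.
rewrite (eq_bigr _ (fun i _ => D2 i)) -mulr_sumr normrM gtr0_norm; last first.
  by rewrite invr_gt0 exprn_gt0.
rewrite mulrAC [leRHS]mulrC ler_wpM2l//; first by rewrite invr_ge0 exprn_ge0// ltW.
rewrite indicE; have [/set_mem zy|/negP nz] := boolP (z \in cube y r).
  rewrite mulr1; apply: le_trans (ler_norm_sum _ _ _) _.
  apply: (@le_trans _ _ (\sum_i K i)); last by rewrite lerDr.
  by apply: ler_sum => i _; have [_] := HK i; exact.
rewrite mulr0 big1 ?normr0// => i _.
apply: (test_function_out (tD i)) => /(cube_bump_arg _ _ r0) H.
by apply: nz; rewrite inE.
Qed.

(** The odd part of the expansion of the bump cancels. *)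
Lemma cube_bump_second_difference : exists2 C : R, 0 < C & forall y r x z, 0 < r ->
  2 * cube_bump y r x - cube_bump y r (x + z) - cube_bump y r (x - z) <= C * r ^- 2 * `|z| ^+ 2.
Proof.
have [C C0 HC] := @boxbump_quadratic R n 1 (const_mx (- 2^-1)) (const_mx 2^-1).
exists (2 * C) => [|y r x z r0]; first by rewrite mulr_gt0.
set p := r^-1 *: x + - (r^-1 *: y).
have [l lN [_ _ _ Hl]] := HC p.
have E1 : r^-1 *: (x + z) + - (r^-1 *: y) = p + r^-1 *: z by rewrite scalerDr addrAC.
have E2 : r^-1 *: (x - z) + - (r^-1 *: y) = p + - (r^-1 *: z).
  by rewrite scalerBr addrAC.
rewrite /cube_bump E1 E2 -/p.
have H1 := Hl (r^-1 *: z); have H2 := Hl (- (r^-1 *: z)).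
rewrite normrN normrZ (gtr0_norm (_ : 0 < r^-1)) ?invr_gt0// in H1 H2.
rewrite lN in H2; rewrite exprMn in H1 H2.
rewrite -exprVn; move: H1 H2; rewrite -/unit_bump !ler_norml => /andP[H1 _] /andP[H2 _].
have -> : 2 * C * r^-1 ^+ 2 * `|z| ^+ 2 = 2 * (C * (r^-1 ^+ 2 * `|z| ^+ 2)) by rewrite !mulrA.
move: H1 H2; move: (C * _) (unit_bump p) (unit_bump (p + r^-1 *: z)) (unit_bump (p + - (r^-1 *: z))) (l _).
by move=> q0 a0 b0 c0 d0 *; lra.
Qed.

Lemma cube_bump_mass : exists2 c : R, 0 < c & forall y r, 0 < r ->
  ((c * (2 * r) ^+ n)%:E <= \int[mu]_z (cube_bump y r z)%:E)%E.
Proof.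
pose b0 := unit_bump 0.
have b00 : 0 < b0.
  apply: prodr_gt0 => j _; rewrite !mxE /expinv !mul1r opprK !add0r subr0 invr_gt0 ltr0n /=.
  by rewrite mulr_gt0 ?expr0 ?mul1r ?expR_gt0.
have cb : continuous unit_bump by apply: smooth_continuous; exact: (proj1 unit_bump_test).
have [d d0 Hd] : exists2 d : R, 0 < d & forall z, `|z| < d -> b0 / 2 <= unit_bump z.
  have o : open [set t : R | b0 / 2 < t] by exact: open_gt.
  have /(cb 0) : nbhs (unit_bump 0) [set t : R | b0 / 2 < t].
    by apply: open_nbhs_nbhs; split=> //=; rewrite ltr_pdivrMr// ltr_pMr// ltr1n.
  move=> /nbhs_ballP[d /= d0 Hd]; exists d => // z zd; apply/ltW; apply: Hd.
  by rewrite -ball_normE /= sub0r normrN.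
exists (b0 / 2 * d ^+ n); first by rewrite mulr_gt0 ?divr_gt0 ?exprn_gt0.
move=> y r r0; have rd0 : 0 < r * d by rewrite mulr_gt0.
have tb := cube_bump_test y r0; have mb := test_function_measurable tb.
apply: (@le_trans _ _ (\int[mu]_z ((b0 / 2)%:E * (\1_(cube y (r * d)) z)%:E))%E); last first.
  apply: le_lower_integral => z _.
    by rewrite -EFinM lee_fin mulr_ge0// divr_ge0// ltW.
  rewrite -EFinM lee_fin indicE; have [/set_mem zy|_] := boolP (z \in _); last first.
    by rewrite mulr0 cube_bump_ge0.
  rewrite mulr1; apply: Hd; rewrite -scalerBr normrZ gtr0_norm ?invr_gt0//.
  by rewrite ltr_pdivrMl.
have mC : measurable (cube y (r * d)) by exact: measurable_cube.
have mI : measurable_fun setT (fun z => (\1_(cube y (r * d)) z)%:E : \bar R).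
  by apply/measurable_EFinP; exact: measurable_indic.
rewrite (ge0_integralZl _ measurableT mI)//; last by rewrite lee_fin divr_ge0// ltW.
rewrite integral_indic// setIT [X in (_ * X)%E](measure_cube y rd0) -EFinM lee_fin.
have -> : 2 * (r * d) = d * (2 * r) by ring.
by rewrite [X in _ <= _ * X]exprMn mulrA.
Qed.

End cube_bump.

(** * Upper bound for the tested equation *)

(** The difference is nonnegative only almost everywhere, and is replaced by its
    absolute value. *)
Lemma ae_le_Rintegral d (T : measurableType d) (R : realType)
    (mu : {measure set T -> \bar R}) (D : set T) (f g : T -> R) : measurable D ->
  ae_integrable mu D f -> ae_integrable mu D g ->
  {ae mu, forall x, D x -> f x <= g x} ->
  \int[mu]_(x in D) f x <= \int[mu]_(x in D) g x.
Proof.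
move=> mD fi gi fg; have [Nfi E1] := ae_integrableZ (-1) mD fi.
have [_ E2] := ae_integrableD mD gi Nfi.
rewrite -subr_ge0 -[- _]mulN1r -E1 -E2.
rewrite (@ae_eq_Rintegral _ _ _ mu D _ (fun x => `|g x + -1 * f x|)); last first.
  by apply: filterS fg => x H Dx; rewrite ger0_norm// mulN1r subr_ge0 H.
exact: Rintegral_ge0.
Qed.

Lemma ae_product d (T : measurableType d) (R : realType)
    (mu : {sigma_finite_measure set T -> \bar R}) (P : T -> Prop) :
  {ae mu, forall x, P x} -> {ae (mu \x mu)%E, forall q, P q.1 /\ P q.2}.
Proof.
move=> [N [mN N0 PN]].
have n1 : (mu \x mu)%E.-negligible (N `*` [set: T]).
  have E : (mu \x mu)%E (N `*` setT) = 0%E.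
    by transitivity (mu N * mu setT)%E; [exact: product_measure1E | rewrite N0 mul0e].
  by apply/negligibleP => //; exact: measurableX.
have n2 : (mu \x mu)%E.-negligible ([set: T] `*` N).
  have E : (mu \x mu)%E (setT `*` N) = 0%E.
    by transitivity (mu setT * mu N)%E; [exact: product_measure1E | rewrite N0 mule0].
  by apply/negligibleP => //; exact: measurableX.
apply: negligibleS (negligibleU n1 n2).
by move=> q /= /not_andP[H|H]; [left|right]; split=> //; exact: PN.
Qed.

Section upper_bound.
Context {R : realType} {n : nat}.
Local Notation V := 'rV[R]_n.+1.
Local Notation mu := (@lebesgue_rV R n.+1).
Variables (Omega : set V) (f u g : V -> R) (s gamma zeta : R).
Hypotheses (oO : open Omega) (hs : 0 < s < 1).
Hypotheses (mg : measurable_fun setT g) (g0 : forall x, 0 <= g x)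
  (ug : {ae mu, forall x, u x = g x}) (gi : mu.-integrable setT (EFin \o g)).
Hypothesis hG : exists G, is_weak_gradient Omega u G.

Let p := n.+1%:R + 2 * s.

Let hp : n.+1%:R < p < n.+1%:R + 2.
Proof. by case/andP: hs => s0 s1; apply/andP; split; rewrite /p; lra. Qed.

Lemma frac_const_ge0 : 0 <= @frac_const R n s.
Proof.
rewrite invr_ge0; apply: Rintegral_ge0 => x _.
by rewrite divr_ge0 ?powR_ge0// subr_ge0 cos_le1.
Qed.

(** As [u] is nonnegative, upper bounds for the Laplacian and for the second differences
    of the bump turn the left-hand side of the equation into a multiple of the integral
    of [u] over the cube. The factor 1 + C makes the bound on the second differences
    at least 1, which covers the tail of the kernel. *)
Lemma weak_identity_estimate (K C L : R) : 0 < K -> 0 < C -> 0 < L ->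
  (forall (y : V) (r : R) (z : V), 0 < r -> `|\sum_i 'D_(basisv i) (fun x => 'D_(basisv i) (cube_bump y r) x) z| <=
    K * r ^- 2 * \1_(cube y r) z) ->
  (forall (y : V) (r : R) (x z : V), 0 < r ->
    2 * cube_bump y r x - cube_bump y r (x + z) - cube_bump y r (x - z) <=
    C * r ^- 2 * `|z| ^+ 2) ->
  (forall k, (\int[mu]_z (Num.min (`|z| ^+ 2) 1 * kern p z * \1_(shell k) z)%:E <= L%:E)%E) ->
  forall (y : V) (r : R), 0 < r <= 1 -> cube y r `<=` Omega ->
  weak_identity s gamma Omega f u (cube_bump y r) ->
  \int[mu]_(x in Omega) (f x / u x `^ gamma * cube_bump y r x) <=
  (K + @frac_const R n s * (1 + C) * L) * r ^- 2 * \int[mu]_(x in cube y r) g x.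
Proof.
move=> K0 C0 L0 HK HC HL y r /andP[r0 r1] QO [_ Hn _ <-].
have mO := open_measurable_rV oO.
have mQ : measurable (cube y r) := measurable_cube y r.
have tQ := cube_bump_test y r0; have tO := test_function_sub QO tQ.
have mpsi := test_function_measurable tQ.
have gO : mu.-integrable Omega (EFin \o g) by exact: integrableS gi.
have gQ : mu.-integrable (cube y r) (EFin \o g) by exact: integrableS gi.
have [G HG] := hG; rewrite (integral_gradient oO HG tO).
set Lap := fun x => \sum_i 'D_(basisv i) (fun x => 'D_(basisv i) (cube_bump y r) x) x.
have ri0 : 0 < r ^- 2 by rewrite invr_gt0 exprn_gt0.
have r1i : 1 <= r ^- 2 by rewrite invf_ge1 ?exprn_gt0// exprn_ile1// ltW.
have Kr0 : 0 <= K * r ^- 2 by rewrite mulr_ge0 ?(ltW K0) ?(ltW ri0).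
have mLap : measurable_fun setT (Lap : V -> R).
  apply: measurable_sum => i.
  exact: test_function_measurable (test_function_partial i (test_function_partial i tQ)).
have bLap x : `|Lap x| <= K * r ^- 2.
  apply: le_trans (HK y r x r0) _; rewrite ler_piMr// indicE; case: (_ \in _).
have bI x : `|K * r ^- 2 * \1_(cube y r) x| <= K * r ^- 2.
  by rewrite normrM (ger0_norm Kr0) ler_piMr// indicE; case: (_ \in _); rewrite ?normr1 ?normr0.
have local_le : - (\int[mu]_(x in Omega) (u x * Lap x)) <=
    K * r ^- 2 * \int[mu]_(x in cube y r) g x.
  rewrite (@ae_eq_Rintegral _ _ _ mu Omega _ (fun x => g x * Lap x)); last first.
    by apply: filterS ug => x H _; rewrite H.
  have i1 := integrable_mul_bounded mO gO (measurable_funTS mLap) bLap.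
  have mI : measurable_fun Omega (fun x => K * r ^- 2 * \1_(cube y r) x).
    by apply: measurable_funTS; apply: measurable_funM => //; exact: measurable_indic.
  have i2 := integrable_mul_bounded mO gO mI bI.
  have iN : mu.-integrable Omega (fun x => (-1 * (g x * Lap x))%:E).
    exact: (integrableZl mO (-1) i1).
  have EN : - (\int[mu]_(x in Omega) (g x * Lap x)) = \int[mu]_(x in Omega) (-1 * (g x * Lap x)).
    by rewrite RintegralZl// mulN1r.
  rewrite EN; apply: (@le_trans _ _ (\int[mu]_(x in Omega) (g x * (K * r ^- 2 * \1_(cube y r) x)))).
    apply: le_Rintegral => // x _; rewrite mulN1r -mulrN ler_wpM2l//.
    by apply: le_trans (HK y r x r0); rewrite -normrN ler_norm.
  rewrite -RintegralZl// -[X in _ <= \int[mu]_(x in X) _](setIidr QO) Rintegral_mkcondr.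
  rewrite le_eqVlt; apply/orP; left; apply/eqP; apply: eq_Rintegral => x _.
  by rewrite patchE indicE; case: (x \in cube y r); rewrite ?mulr1 ?mulr0 // mulrC.
set J := fun q : V * V => _ in Hn *.
pose J' := fun q : V * V => (g q.1 - g q.2) * (cube_bump y r q.1 - cube_bump y r q.2)
   / enorm (q.1 - q.2) `^ p.
have JJ' : {ae (mu \x mu)%E, forall q, setT q -> J q = J' q}.
  by apply: filterS (ae_product ug) => q [E1 E2] _; rewrite /J /J' E1 E2.
have A1 : 1 <= (1 + C) * r ^- 2.
  by rewrite -[leLHS]mulr1; apply: ler_pM => //; rewrite lerDl ltW.
have nonlocal_bound : \int[(mu \x mu)%E]_q J q <=
    2 * ((1 + C) * r ^- 2) * L * \int[mu]_(x in cube y r) g x.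
  rewrite (ae_eq_Rintegral JJ').
  apply: (nonlocal_le hp mg g0 gi mpsi _ mQ _ A1 _ L0 HL).
  - by move=> x; rewrite cube_bump_ge0 cube_bump_le1.
  - by move=> x; exact: cube_bump_out.
  - move=> x z; apply: le_trans (HC y r x z r0) _.
    rewrite ler_wpM2r ?sqr_ge0// ler_wpM2r ?(ltW ri0)// lerDr//.
  - have [h hi hJ] := Hn; exists h => //.
    by apply: filterS2 hJ JJ' => q E1 E2 _; transitivity (J q); [symmetry; exact: E2|exact: E1].
have F2 : 0 <= @frac_const R n s / 2 by rewrite divr_ge0// frac_const_ge0.
have H := ler_wpM2l F2 nonlocal_bound.
apply: le_trans (lerD local_le H) _; rewrite le_eqVlt; apply/orP; left; apply/eqP.
set I := \int[mu]_(x in cube y r) g x.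
set c := @frac_const R n s; set q := r ^- 2.
by field.
Qed.

End upper_bound.

(** * Lower bound for the source, and the contradiction *)

(** The hypothesis zeta >= 2 enters here: the source is at least of the order of the inverse
    square of the distance to the boundary. *)
Lemma powRN_ge_sqr (R : realType) (d D zeta : R) : 0 < d <= D -> D <= 1 -> 2 <= zeta ->
  D ^- 2 <= d `^ (- zeta).
Proof.
move=> /andP[d0 dD] D1 z2; have D0 := lt_le_trans d0 dD.
rewrite powRN lef_pV2 ?posrE ?exprn_gt0 ?powR_gt0//.
apply: (@le_trans _ _ (d `^ 2%:R)).
  by apply: ger_powR => //; rewrite d0 (le_trans dD).
by rewrite powR_mulrn ?(ltW d0)// lerXn2r// nnegrE ltW.
Qed.

(** The negative power is bounded below by an affine function, whose integral is
    governed by the mean of [u] over the cube. *)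
Lemma inv_powR_ge (R : realType) (t a gamma : R) : 0 < t -> 0 < a <= 1 -> 0 < gamma ->
  1 - t / a <= (t `^ gamma)^-1.
Proof.
move=> t0 /andP[a0 a1] gamma0; have P0 : 0 < t `^ gamma by rewrite powR_gt0.
have [at_|ta] := leP a t.
  apply: (@le_trans _ _ 0); last by rewrite invr_ge0 ltW.
  by rewrite subr_le0 ler_pdivlMr// mul1r.
apply: (@le_trans _ _ 1); first by rewrite gerBl divr_ge0 ?ltW.
rewrite invf_ge1//; have := @ge0_ler_powR _ gamma (ltW gamma0) t 1; rewrite powR1; apply; rewrite ?nnegrE ?ltW//.
exact: lt_le_trans ta a1.
Qed.

(** Smallness in the mean square becomes smallness in the mean by w <= eps + w^2 / eps. *)
Lemma cube_mean_le (R : realType) n (Omega Q : set 'rV[R]_n) (g w : 'rV[R]_n -> R) (eps m : R) :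
  open Omega -> Q `<=` Omega -> measurable Q -> lebesgue_rV n Q = m%:E ->
  measurable_fun setT g -> (forall x, 0 <= g x) -> in_L2 (lebesgue_rV n) Omega w ->
  0 < eps -> {ae lebesgue_rV n, forall x, Omega x -> g x <= eps + w x} ->
  (\int[lebesgue_rV n]_(x in Q) ((w x) ^+ 2)%:E <= (eps ^+ 2 * m)%:E)%E ->
  \int[lebesgue_rV n]_(x in Q) g x <= 3 * eps * m.
Proof.
move=> oO QO mQ mQE mg g0 wL2 eps0 gw wQ.
have [h [mh wh _ _]] := L2_borel oO wL2.
have hQ : (\int[lebesgue_rV n]_(x in Q) ((h x) ^+ 2)%:E <= (eps ^+ 2 * m)%:E)%E.
  rewrite (@ae_eq_lower_integral _ _ _ (lebesgue_rV n) Q _ (fun x => ((w x) ^+ 2)%:E))//.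
  by apply: filterS wh => x H /QO /H ->.
have mh2 : measurable_fun Q (fun x => ((h x) ^+ 2)%:E).
  by apply/measurable_EFinP; apply: measurable_funTS; apply: measurable_funX.
have ie : 0 <= eps^-1 by rewrite invr_ge0 ltW.
have H : (\int[lebesgue_rV n]_(x in Q) (g x)%:E <= (3 * eps * m)%:E)%E.
  apply: (@le_trans _ _ (\int[lebesgue_rV n]_(x in Q) ((2 * eps)%:E + (eps^-1)%:E * ((h x) ^+ 2)%:E))%E).
    apply: ae_ge0_le_integral => //.
    - by move=> x _; rewrite lee_fin.
    - by apply/measurable_EFinP; apply: measurable_funTS.
    - move=> x _; rewrite -EFinM -EFinD lee_fin; apply: addr_ge0; apply: mulr_ge0 => //; [exact: ltW|exact: sqr_ge0].
    - by apply: emeasurable_funD => //; exact: measurable_funeM.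
    apply: filterS2 gw wh => x H1 H2 Qx; rewrite -EFinM -EFinD lee_fin.
    apply: le_trans (H1 (QO _ Qx)) _; rewrite (H2 (QO _ Qx)).
    rewrite -(ler_pM2l eps0) !mulrDr mulrA mulfV ?gt_eqF// mul1r.
    by have := sqr_ge0 (h x - eps); have := sqr_ge0 (h x + eps); rewrite !expr2; nra.
  have s1 x : Q x -> (0 <= (eps^-1)%:E * ((h x) ^+ 2)%:E)%E.
    by move=> _; rewrite -EFinM lee_fin; apply: mulr_ge0 => //; exact: sqr_ge0.
  have s2 x : Q x -> (0 <= (2 * eps)%:E)%E.
    by move=> _; rewrite lee_fin; apply: mulr_ge0 => //; exact: ltW.
  rewrite (ge0_integralD _ mQ s2 _ s1)//; last exact: measurable_funeM.
  have -> : (\int[lebesgue_rV n]_(x in Q) (2 * eps)%:E = (2 * eps)%:E * m%:E)%E.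
    by rewrite -mQE; exact: integral_cst.
  rewrite ge0_integralZl//; last by move=> x _; rewrite lee_fin sqr_ge0.
  apply: (@le_trans _ _ ((2 * eps * m)%:E + (eps^-1)%:E * (eps ^+ 2 * m)%:E)%E).
    by rewrite [X in (_ <= X + _)%E]EFinM leeD2l// lee_wpmul2l.
  rewrite -EFinM -EFinD lee_fin le_eqVlt; apply/orP; left; apply/eqP; field.
  by rewrite gt_eqF.
have I0 : (0 <= \int[lebesgue_rV n]_(x in Q) (g x)%:E)%E.
  by apply: integral_ge0 => x _; rewrite lee_fin.
rewrite /Rintegral -lee_fin fineK// ge0_fin_numE//.
by apply: le_lt_trans H _; rewrite ltry.
Qed.

Section lower_bound.
Context {R : realType} {n : nat}.
Local Notation V := 'rV[R]_n.+1.
Local Notation mu := (@lebesgue_rV R n.+1).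

Lemma source_lower_bound (Omega : set V) (f u g : V -> R) (zeta gamma c1 d a : R) (y : V) (r m : R) :
  open Omega -> 0 < gamma -> 2 <= zeta -> 0 < r -> 0 < c1 ->
  (forall x, Omega x -> c1 * dist_boundary Omega x `^ (- zeta) <= f x) ->
  cube y r `<=` Omega -> d <= 1 -> (forall x, cube y r x -> 0 < dist_boundary Omega x <= d) ->
  0 < a <= 1 ->
  {ae mu, forall x, u x = g x} -> mu.-integrable setT (EFin \o g) ->
  {ae mu, forall x, cube y r x -> 0 < u x} ->
  (m%:E <= \int[mu]_z (cube_bump y r z)%:E)%E ->
  ae_integrable mu Omega (fun x => f x / u x `^ gamma * cube_bump y r x) ->
  c1 * d ^- 2 * (m - a^-1 * \int[mu]_(x in cube y r) g x) <=
  \int[mu]_(x in Omega) (f x / u x `^ gamma * cube_bump y r x).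
Proof.
move=> oO gamma0 z2 r0 c10 hf QO d1 Hd ha ug gi up hm Si.
have mO := open_measurable_rV oO; have mQ : measurable (cube y r) := measurable_cube y r.
have tQ := cube_bump_test y r0; have mpsi := test_function_measurable tQ.
have psi_i : mu.-integrable Omega (EFin \o (cube_bump y r : V -> R)).
  by apply: integrableS (test_function_integrable tQ).
have gO : mu.-integrable Omega (EFin \o g) by exact: integrableS gi.
have gI : mu.-integrable Omega (fun x => (g x * \1_(cube y r) x)%:E).
  apply: (@integrable_mul_bounded _ _ _ _ _ g _ 1) => //.
  by move=> x; rewrite indicE; case: (_ \in _); rewrite ?normr1 ?normr0.
have /andP[a0 a1] := ha.
have F0 : 0 <= c1 * d ^- 2.
  by rewrite mulr_ge0 ?(ltW c10)// invr_ge0 sqr_ge0.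
set F := c1 * d ^- 2 in F0 *.
have psiA : ae_integrable mu Omega (cube_bump y r) by exists (cube_bump y r); [exact: psi_i|apply: aeW].
have gA : ae_integrable mu Omega (fun x => g x * \1_(cube y r) x).
  by exists (fun x => g x * \1_(cube y r) x); [exact: gI|apply: aeW].
have [A1 E1] := ae_integrableZ (- a^-1) mO gA.
have [A2 E2] := ae_integrableD mO psiA A1.
have [A3 E3] := ae_integrableZ F mO A2.
have Eg : \int[mu]_(x in Omega) (g x * \1_(cube y r) x) = \int[mu]_(x in cube y r) g x.
  rewrite -[X in _ = \int[mu]_(x in X) _](setIidr QO) Rintegral_mkcondr.
  apply: eq_Rintegral => x _.
  by rewrite patchE indicE; case: (x \in cube y r); rewrite ?mulr1 ?mulr0.
have Epsi : m <= \int[mu]_(x in Omega) cube_bump y r x.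
  rewrite /Rintegral integral_out0; last by move=> x nO; rewrite cube_bump_out// => /QO.
  rewrite -lee_fin fineK//; apply: integrable_fin_num => //; exact: test_function_integrable tQ.
apply: (@le_trans _ _ (\int[mu]_(x in Omega) (F * (cube_bump y r x + - a^-1 * (g x * \1_(cube y r) x))))).
  by rewrite E3 E2 E1 Eg ler_wpM2l// mulNr lerD2r.
apply: ae_le_Rintegral => //; apply: filterS2 ug up => x H1 H2 Ox.
rewrite indicE; have [Qx|nQ] := pselect (cube y r x); last first.
  by rewrite cube_bump_out// memNset// !mulr0 addr0 mulr0.
have ux := H2 Qx; rewrite mem_set// mulr1 -H1 mulNr [a^-1 * _]mulrC.
have p0 := cube_bump_ge0 y r x; have p1 := cube_bump_le1 y r x.
have fF : F <= f x.
  apply: le_trans (hf x Ox); rewrite ler_wpM2l ?(ltW c10)//.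
  by apply: powRN_ge_sqr => //; exact: Hd.
have X0 : 0 <= (u x `^ gamma)^-1 by rewrite invr_ge0 powR_ge0.
have X1 := inv_powR_ge ux ha gamma0.
apply: (@le_trans _ _ (F * ((u x `^ gamma)^-1 * cube_bump y r x))); last first.
  by rewrite -mulrA ler_wpM2r// mulr_ge0.
apply: ler_wpM2l => //.
apply: (@le_trans _ _ ((1 - u x / a) * cube_bump y r x)); last by rewrite ler_wpM2r.
rewrite mulrBl mul1r lerD2l lerN2 ler_piMr// divr_ge0 ?ltW//.
Qed.

End lower_bound.

Section no_solution.
Context {R : realType} {n : nat}.
Local Notation V := 'rV[R]_n.+1.
Local Notation mu := (@lebesgue_rV R n.+1).

(** The bound of [weak_identity_estimate] and that of [source_lower_bound] contradict
    each other on a cube where the mean of [u] is at most [3 * eps]. *)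
Lemma no_solution (Omega : set V) (f u g : V -> R) (s gamma zeta rho kappa : R) (x0 v : V) :
  open Omega -> boundary Omega x0 -> 0 < rho -> 0 < kappa <= 1 ->
  cone_property Omega x0 v rho kappa ->
  0 < s < 1 -> 0 < gamma -> 2 <= zeta -> class_A zeta Omega f ->
  measurable_fun setT g -> (forall x, 0 <= g x) -> {ae mu, forall x, u x = g x} ->
  mu.-integrable setT (EFin \o g) -> (exists G, is_weak_gradient Omega u G) ->
  (forall (y : V) r, 0 < r -> (forall z, `|z - y| <= r -> Omega z) ->
    {ae mu, forall x, cube y r x -> 0 < u x} /\
    weak_identity s gamma Omega f u (cube_bump y r)) ->
  (forall eps : R, 0 < eps -> exists2 w, sobolev_H10 Omega w &
    {ae mu, forall x, Omega x -> u x <= eps + w x}) -> False.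
Proof.
move=> oO Bx0 rho0 kap cone hs gamma0 z2 [_ [c1 [c2 [c10 _ hf]]]] mg g0 ug gi hG Hid Hw.
have [K K0 HK] := @cube_bump_laplacian R n.+1.
have [C C0 HC] := @cube_bump_second_difference R n.+1.
have [c c0 Hc] := @cube_bump_mass R n.+1.
have hp : n.+1%:R < n.+1%:R + 2 * s < n.+1%:R + 2.
  by case/andP: hs => s0 s1; apply/andP; split; lra.
have [L L0 HL] := kernel_integral hp.
have /andP[k0 k1] := kap.
pose D := n.+1%:R * (3 * (`|v| + 1)).
have D0 : 0 < D by rewrite mulr_gt0// mulr_gt0// ltr_wpDl.
pose Lam := K + @frac_const R n s * (1 + C) * L.
have Lam0 : 0 < Lam.
  have F0 := @frac_const_ge0 R n s.
  by rewrite ltr_wpDr//; apply: mulr_ge0; [apply: mulr_ge0 => //; apply: addr_ge0|]; rewrite ?ltW.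
(* The level a = 6 eps / c halves the lower bound for the source: 3 eps / a = c / 2. It
   is at most 1 when eps <= b1, and eps <= b2 makes the upper bound smaller than this
   half. *)
pose b1 := c / 6; pose b2 := c1 * D ^- 2 * c / (12 * Lam * kappa ^- 2).
have b10 : 0 < b1 by rewrite divr_gt0.
have D20 : 0 < D ^- 2 by rewrite invr_gt0 exprn_gt0.
have k20 : 0 < kappa ^- 2 by rewrite invr_gt0 exprn_gt0.
have b20 : 0 < b2.
  by apply: divr_gt0; apply: mulr_gt0 => //; apply: mulr_gt0.
have [eps [eps0 e1 e2]] : exists eps : R, [/\ 0 < eps, eps <= b1 & eps <= b2].
  exists (Num.min b1 b2); split; by rewrite ?lt_min ?b10 ?ge_min ?lexx ?orbT.
pose a := 6 * eps / c.
have a01 : 0 < a <= 1.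
  rewrite divr_gt0 ?mulr_gt0//= ler_pdivrMr// mul1r.
  by move: e1; rewrite /b1 ler_pdivlMr// mulrC.
have [w wH uw] := Hw eps eps0.
have tau00 : 0 < Num.min 1 D^-1 by rewrite lt_min ltr01 invr_gt0.
have [tau [y [/andP[tau0 taum] Hcube wQ]]] :=
  good_cube oO Bx0 rho0 kap cone wH (exprn_gt0 2 eps0) tau00.
move: taum; rewrite lt_min => /andP[tau1 tauD].
have Dtau : D * tau <= 1 by rewrite -ler_pdivlMl// mulr1 ltW.
pose r := kappa * tau.
have r0 : 0 < r by rewrite mulr_gt0.
have r1 : 0 < r <= 1.
  by rewrite r0 mulr_ile1 ?(ltW k0) ?(ltW tau0) ?(ltW tau1).
have closedQ z : `|z - y| <= r -> Omega z by move=> /Hcube[].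
have QO : cube y r `<=` Omega by move=> z /ltW /closedQ.
have [up Id] := Hid y r r0 closedQ.
set M := (2 * r) ^+ n.+1 in wQ.
have M0 : 0 < M by rewrite exprn_gt0// mulr_gt0.
have gw : {ae mu, forall x, Omega x -> g x <= eps + w x}.
  by apply: filterS2 ug uw => x <-.
have wL2 : in_L2 mu Omega w by have [[]] := wH.
have H1 := cube_mean_le oO QO (measurable_cube y r) (measure_cube y r0) mg g0 wL2 eps0 gw wQ.
have H2 := weak_identity_estimate oO hs mg g0 ug gi hG K0 C0 L0
  (fun y r z r0 => HK y r z r0) (fun y r x z r0 => HC y r x z r0) HL r1 QO Id.
have [_ _ Si _] := Id.
have Hd x : cube y r x -> 0 < dist_boundary Omega x <= D * tau.
  by move=> /ltW /Hcube[].
have hf1 x : Omega x -> c1 * dist_boundary Omega x `^ (- zeta) <= f x.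
  by move=> /hf /andP[].
have H3 := source_lower_bound oO gamma0 z2 r0 c10 hf1 QO Dtau Hd a01 ug gi up (Hc y r r0) Si.
move: (le_trans H3 H2); rewrite -/Lam -/M.
set I := \int[mu]_(x in cube y r) g x in H1 *; move: I H1 => I H1.
apply/negP; rewrite -ltNge.
have t20 : 0 < tau ^- 2 by rewrite invr_gt0 exprn_gt0.
have Er : r ^- 2 = kappa ^- 2 * tau ^- 2 by rewrite /r exprMn invfM.
have ED : (D * tau) ^- 2 = D ^- 2 * tau ^- 2 by rewrite exprMn invfM.
have Ea : a^-1 * (3 * eps * M) = c / 2 * M.
  by rewrite /a; field; rewrite !gt_eqF.
have e3 : 12 * Lam * kappa ^- 2 * eps <= c1 * D ^- 2 * c.
  by move: e2; rewrite /b2 ler_pdivlMr ?mulr_gt0// mulrC.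
have ai0 : 0 <= a^-1 by rewrite invr_ge0 ltW//; have /andP[] := a01.
apply: (@le_lt_trans _ _ (Lam * r ^- 2 * (3 * eps * M))).
  by rewrite ler_wpM2l// mulr_ge0 ?ltW// Er mulr_gt0.
apply: (@lt_le_trans _ _ (c1 * (D * tau) ^- 2 * (c * M - a^-1 * (3 * eps * M)))); last first.
  apply: ler_wpM2l; first by rewrite mulr_ge0 ?ltW// ED mulr_gt0.
  by rewrite lerD2l lerN2 ler_wpM2l.
rewrite Ea Er ED.
have tM : 0 < tau ^- 2 * M by rewrite mulr_gt0.
rewrite (_ : c1 * (D ^- 2 * tau ^- 2) * _ = c1 * D ^- 2 * c / 2 * (tau ^- 2 * M)); last first.
  by set t := tau ^- 2; set d := D ^- 2; field.
rewrite (_ : Lam * _ * _ = 12 * Lam * kappa ^- 2 * eps / 4 * (tau ^- 2 * M)); last first.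
  by set t := tau ^- 2; set d := kappa ^- 2; field.
rewrite ltr_pM2r//.
have : 0 < c1 * D ^- 2 * c by rewrite !mulr_gt0.
by move: e3; set A := c1 * _ * c; set B := 12 * _ * _ * eps; move: A B => A B; lra.
Qed.

End no_solution.

(** * Borel representatives of solutions *)

Section bounded_open.
Context {R : realType} {n : nat}.
Local Notation V := 'rV[R]_n.
Local Notation mu := (@lebesgue_rV R n).
Implicit Types (Omega : set V).

Lemma cube_compactly_contained Omega (y : V) r : 0 < r ->
  (forall z, `|z - y| <= r -> Omega z) -> compactly_contained (cube y r) Omega.
Proof.
move=> r0 H; pose B := closed_box (y - const_mx r) (y + const_mx r).
have cB : compact B := @compact_box R n _ _.
have clB : closed B := compact_closed rV_hausdorff cB.
have QB : cube y r `<=` B.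
  move=> z zy j; have := le_lt_trans (coord_le_normv (z - y) j) zy.
  by rewrite /= in_itv /= !mxE ltr_norml => /andP[? ?]; apply/andP; split; lra.
have BO : B `<=` Omega.
  move=> z zB; apply: H; apply: normv_le => [|j]; first exact: ltW.
  have := zB j; rewrite /= in_itv /= !mxE => /andP[? ?].
  by rewrite ler_norml; apply/andP; split; lra.
have cQ : closure (cube y r) `<=` B by rewrite closureE; exact: smallest_sub.
split; first exact: subclosed_compact (@closed_closure _ _) cB cQ.
by move=> z /cQ /BO.
Qed.

(** On a set of finite measure, square integrability of [w] yields integrability. *)
Lemma nonneg_borel_representative Omega (u w : V -> R) : open Omega -> bounded_set Omega ->
  ae_measurable mu Omega u -> {ae mu, forall x, 0 <= u x} ->
  {ae mu, forall x, ~ Omega x -> u x = 0} -> in_L2 mu Omega w ->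
  {ae mu, forall x, Omega x -> u x <= 1 + w x} ->
  exists g : V -> R, [/\ measurable_fun setT g, forall x, 0 <= g x,
    {ae mu, forall x, u x = g x} & mu.-integrable setT (EFin \o g)].
Proof.
move=> oO bO [h mh uh] u0 uout wL2 uw; have mO := open_measurable_rV oO.
have [k [mk wk kout [c c0 kE]]] := L2_borel oO wL2.
have hO : measurable_fun setT (h \_ Omega) by apply/(measurable_restrictT _ mO).
exists (fun x => `|(h \_ Omega) x|).
have mg : measurable_fun setT (fun x => `|(h \_ Omega) x|) by exact: measurableT_comp hO.
have ug : {ae mu, forall x, u x = `|(h \_ Omega) x|}.
  apply: filterS3 uh u0 uout => x H1 H2 H3; rewrite patchE.
  have [Ox|nO] := pselect (Omega x); first by rewrite mem_set// -H1// ger0_norm.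
  by rewrite memNset// normr0 H3.
split=> //; apply/integrableP; split; first exact/measurable_EFinP.
have m2 : measurable_fun setT (fun x => ((k x) ^+ 2)%:E) by apply/measurable_EFinP; exact: measurable_funX.
have m1 : measurable_fun setT (fun x => (\1_Omega x : R)%:E) by exact/measurable_EFinP.
have s1 x : setT x -> (0 <= (2%:E * (\1_Omega x)%:E : \bar R))%E by rewrite -EFinM lee_fin mulr_ge0.
have s2 x : setT x -> (0 <= ((k x) ^+ 2)%:E)%E by rewrite lee_fin sqr_ge0.
apply: (@le_lt_trans _ _ (\int[mu]_x (2%:E * (\1_Omega x)%:E + ((k x) ^+ 2)%:E))%E).
  apply: ae_ge0_le_integral => //.
  - by apply: measurableT_comp => //; exact/measurable_EFinP.
  - by move=> x Tx; rewrite adde_ge0// ?s1 ?s2.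
  - by apply: emeasurable_funD => //; exact: emeasurable_funM.
  apply: filterS3 ug uw wk => x H1 H2 H3 _.
  rewrite /= normr_id -H1 -EFinM -EFinD lee_fin indicE.
  have [Ox|nO] := pselect (Omega x).
    rewrite mem_set// mulr1; apply: le_trans (H2 Ox) _; rewrite (H3 Ox).
    by have := sqr_ge0 (k x - 1); have := sqr_ge0 (k x); rewrite !expr2; nra.
  by rewrite memNset// mulr0 add0r H1 patchE memNset// normr0 sqr_ge0.
rewrite (ge0_integralD _ measurableT s1 _ s2)//; last exact: emeasurable_funM.
rewrite (ge0_integralZl _ measurableT m1)//.
rewrite kE integral_indic// setIT lte_add_pinfty ?ltry// lte_mul_pinfty//.
exact: bounded_lebesgue_lty.
Qed.

(** [u] is the limit of its truncations, off a common null set. *)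
Lemma ae_measurable_truncations Omega (u : V -> R) : open Omega ->
  {ae mu, forall x, 0 <= u x} ->
  (forall e : R, 0 < e -> in_L2 mu Omega (fun x => Num.max (u x - e) 0)) ->
  ae_measurable mu Omega u.
Proof.
move=> oO u0 H; have mO := open_measurable_rV oO.
have /choice[h Hh] : forall k : nat, exists h : V -> R, measurable_fun Omega h /\
    {ae mu, forall x, Omega x -> Num.max (u x - k.+1%:R^-1) 0 = h x}.
  by move=> k; have [|[h mh uh] _] := H k.+1%:R^-1; [rewrite invr_gt0|exists h].
have uh := ae_foralln (fun k => proj2 (Hh k)).
have [N [mN N0 HN]] : {ae mu, forall x, 0 <= u x /\
    forall k : nat, Omega x -> Num.max (u x - k.+1%:R^-1) 0 = h k x}.
  by apply: filterS2 u0 uh => x.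
have mON : measurable (Omega `\` N) by exact: measurableD.
have good x : ~ N x -> 0 <= u x /\
    forall k : nat, Omega x -> Num.max (u x - k.+1%:R^-1) 0 = h k x.
  by move=> nN; apply: contrapT => B; apply: nN; exact: HN.
have mu_ : measurable_fun (Omega `\` N) u.
  apply: (measurable_fun_cvg (h := h)).
    by move=> k; apply: measurable_funS (proj1 (Hh k)) => // x [].
  move=> x [Ox nN]; have [ux Hx] := good x nN.
  have -> : h ^~ x = (fun k => Num.max (u x - k.+1%:R^-1) 0).
    by apply/funext => k; rewrite Hx.
  apply: (@squeeze_cvgr _ _ _ _ (fun k => u x - k.+1%:R^-1) (fun=> u x)); last exact: cvg_cst.
    by apply: nearW => k; rewrite le_max lexx /= ge_max ux andbT gerBl invr_ge0.
  rewrite -[X in _ --> X]subr0.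
  by apply: cvgB; [exact: cvg_cst|exact: cvg_harmonic].
exists (u \_ (Omega `\` N)).
  by apply: measurable_funTS; apply/(measurable_restrictT _ mON).
exists N; split=> // x B; apply: contrapT => nN; apply: B => Ox.
by rewrite patchE mem_set.
Qed.

End bounded_open.

Lemma exists_boundary (R : realType) n (Omega : set 'rV[R]_n.+1) : open Omega ->
  Omega !=set0 -> bounded_set Omega -> exists x, boundary Omega x.
Proof.
move=> oO [a Oa] /bounded_set_normv[M M0 HM].
have nO : ~ Omega (const_mx M).
  move=> /HM; apply/negP; rewrite -leNgt.
  by have := coord_le_normv (const_mx M : 'rV[R]_n.+1) ord0; rewrite mxE (gtr0_norm M0).
have [t _ Bt] := segment_boundary oO Oa nO.
by eexists; exact: Bt.
Qed.

(** * Nonexistence of weak solutions *)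

Theorem theorem2p9 (R : realType) (n : nat) (hn : (3 <= n.+1)%N)
    (Omega : set 'rV[R]_n.+1) (hOmega : bounded_domain Omega)
    (hC11 : C11_boundary Omega)
    (s : R) (hs : 0 < s < 1)
    (gamma : R) (hgamma : 0 < gamma)
    (zeta : R) (hzeta : 2 <= zeta)
    (f : 'rV[R]_n.+1 -> R) (hf : class_A zeta Omega f) :
  (~ exists u : 'rV[R]_n.+1 -> R, weak_solution_A s gamma Omega f u) /\
  (~ exists u : 'rV[R]_n.+1 -> R, weak_solution_B s gamma Omega f u).
Proof.
have [oO _ neO bO] := hOmega.
have [x0 Bx0] := exists_boundary oO neO bO.
have [v [rho [kappa [rho0 kap cone]]]] := cone_condition hC11 Bx0.
split=> -[u].
  move=> [up uH Hid]; have [[uL2 [G HG _]] uout _] := uH.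
  have u0 : {ae @lebesgue_rV R n.+1, forall x, 0 <= u x}.
    apply: filterS2 up uout => x H1 H2; have [Ox|nO] := pselect (Omega x).
      exact/ltW/H1.
    by rewrite H2.
  have uw (e : R) : 0 <= e -> {ae @lebesgue_rV R n.+1, forall x, Omega x -> u x <= e + u x}.
    by move=> e0; apply: aeW => x _; rewrite lerDr.
  have [g [mg g0 ug gi]] := nonneg_borel_representative oO bO (proj1 uL2) u0 uout uL2 (uw 1 ler01).
  apply: (no_solution oO Bx0 rho0 kap cone hs hgamma hzeta hf mg g0 ug gi); first by exists G.
    move=> y r r0 Q; have QO : cube y r `<=` Omega by move=> z /ltW /Q.
    split; first by apply: filterS up => x H /QO.
    apply/Hid/test_function_H10 => //; exact: test_function_sub QO (cube_bump_test y r0).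
  by move=> e e0; exists u => //; apply: uw; exact: ltW.
move=> [[G HG _] [u0 [uout Hw]] up Hid].
have uw (e : R) : {ae @lebesgue_rV R n.+1, forall x, Omega x -> u x <= e + Num.max (u x - e) 0}.
  by apply: aeW => x _; rewrite -lerBlDl le_max lexx.
have wL2 (e : R) : 0 < e -> in_L2 (@lebesgue_rV R n.+1) Omega (fun x => Num.max (u x - e) 0).
  by move=> /Hw[[]].
have um := ae_measurable_truncations oO u0 wL2.
have [g [mg g0 ug gi]] := nonneg_borel_representative oO bO um u0 uout (wL2 1 ltr01) (uw 1).
apply: (no_solution oO Bx0 rho0 kap cone hs hgamma hzeta hf mg g0 ug gi); first by exists G.
  move=> y r r0 Q; have Qc := cube_compactly_contained r0 Q.
  have [C C0 HC] := up _ Qc.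
  split; first by apply: filterS HC => x H /H; exact: lt_le_trans.
  apply: (Hid _ (@open_cube R n.+1 y r) Qc); apply: test_function_H10; first exact: open_cube.
  exact: cube_bump_test.
by move=> e e0; exists (fun x => Num.max (u x - e) 0); [exact: Hw|exact: uw].
Qed.
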